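(* Let $d\ge 2$ be an integer, $p=p(n)\in[0,1]$, $q=p(1-p)$, and let $A$ be the adjacency operator of the Linial–Meshulam complex $X(d,n,p)$. If $\lim_{n\to\infty}nq=\infty$, then, almost surely, the empirical spectral measures $L_{(dnq)^{-1/2}A}$ converge in distribution (i.e. weakly), as $n\to\infty$, to the semicircle distribution $\nu(\mathrm{d}x)=\frac{\sqrt{(4-x^2)_+}}{2\pi}\,\mathrm{d}x$.
   Context: Cells. Let $V$ be a vertex set with $|V|=n\ge d+1$. A simplicial complex on $V$ is a collection of subsets of $V$ (called cells) closed under taking subsets; a $j$-cell is a cell with $j+1$ elements. For a complex $X$, $X^j$ is the set of its $j$-cells. For $j\ge 1$ each $j$-cell has two orientations, corresponding to the orderings of its vertices modulo even permutations; $[\sigma^0,\dots,\sigma^j]$ denotes an oriented cell, $\overline{\sigma}$ (also written $(-1)\sigma$) is $\sigma$ with the opposite orientation, and $X^j_\pm$ is the set of oriented $j$-cells. An oriented cell $[\sigma^0,\dots,\sigma^{j+1}]$ induces on the $j$-cell of its boundary obtained by deleting $\sigma^i$ the orientation $(-1)^i[\sigma^0,\dots,\sigma^{i-1},\sigma^{i+1},\dots,\sigma^{j+1}]$. Model. For $p=p(n)\in[0,1]$, the Linial–Meshulam complex $X=X(d,n,p)$ is the random $d$-dimensional complex on $V$ that contains all subsets of $V$ of size at most $d$ (complete $(d-1)$-skeleton) and in which each $(d+1)$-element subset of $V$ is included as a $d$-cell independently with probability $p$. Set $q:=p(1-p)$. Coupling. All complexes $X(d,n,p)$, $n\in\mathbb{N}$,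 are defined on one probability space in the standard fashion: $V=\{1,\dots,n\}$, there is a family of independent Bernoulli variables $\chi_\tau$ with parameter $p$ indexed by all $(d+1)$-element subsets $\tau$ of $\{1,2,3,\dots\}$, and $\tau\subset\{1,\dots,n\}$ is a $d$-cell of $X(d,n,p)$ if and only if $\chi_\tau=1$. When $p=p(n)$ depends on $n$, take $\chi_\tau=\chi_\tau^{(n)}=\mathbf 1\{U_\tau\le p(n)\}$ with $(U_\tau)_\tau$ i.i.d. uniform on $[0,1]$. Adjacency operator. $\Omega^{d-1}$ is the real vector space of functions $f:X^{d-1}_\pm\to\mathbb{R}$ with $f(\overline{\sigma})=-f(\sigma)$, with inner product $\langle f,g\rangle=\sum_{\sigma\in X^{d-1}}f(\sigma)g(\sigma)$; its dimension is $N=\binom nd$. For $\sigma,\sigma'\in X^{d-1}_\pm$ write $\sigma'\sim\sigma$ if there is an oriented $d$-cell $\tau\in X^d_\pm$ such that both $\sigma$ and $\overline{\sigma'}$ are in the boundary of $\tau$ with the induced orientations. The adjacency operator $A$ is the self-adjoint operator $Af(\sigma)=\sum_{\sigma'\sim\sigma}f(\sigma')$ on $\Omega^{d-1}$. Empirical spectral measure. For a self-adjoint operator $B$ on an $N$-dimensional space with eigenvalues $\lambda_1(B)\le\dots\le\lambda_N(B)$, $L_B:=\frac1N\sum_{i=1}^N\delta_{\lambda_i(B)}$. *)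

(* Defs.v *)
From HB Require Import structures.
From mathcomp Require Export all_boot all_order all_algebra all_fingroup finmap.
From mathcomp Require Export all_classical all_reals all_analysis.
From mathcomp Require Export measurable_realfun.

Set Implicit Arguments.
Unset Strict Implicit.
Unset Printing Implicit Defensive.

Export Order.TTheory GRing.Theory Num.Theory.
Export numFieldNormedType.Exports.

Local Open Scope classical_set_scope.
Local Open Scope ring_scope.

Section OrientedCells.
Variable V : finType.
Implicit Types X : {set {set V}}.

Definition is_complex X :=
  forall s t : {set V}, s \in X -> t \subset s -> t \in X.

Definition reorder j (s : {ffun 'I_j.+1 -> V}) (pi : 'S_j.+1) :=
  [ffun i => s (pi i)].

(* The oriented cell [s 0, ..., s j]: the orderings that differ from s by an
   even permutation. *)
Definition orient j (s : {ffun 'I_j.+1 -> V}) : {set {ffun 'I_j.+1 -> V}} :=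
  [set reorder s pi | pi : 'S_j.+1 in [pred pi : 'S_j.+1 | ~~ odd_perm pi]]%SET.

(* Meaningful for j > 0 only: there is no odd permutation of one vertex. *)
Definition opposite j (c : {set {ffun 'I_j.+1 -> V}}) :
    {set {ffun 'I_j.+1 -> V}} :=
  [set reorder s pi | s in c, pi in [pred pi : 'S_j.+1 | odd_perm pi]]%SET.

Definition is_oriented_cell X j (c : {set {ffun 'I_j.+1 -> V}}) :=
  [exists s : {ffun 'I_j.+1 -> V},
    [&& injectiveb s, [set s i | i in 'I_j.+1]%SET \in X & c == orient s]].

Definition oriented_cell X j :=
  {c : {set {ffun 'I_j.+1 -> V}} | is_oriented_cell X c}.

Definition delete_vertex j (t : {ffun 'I_j.+2 -> V}) (i : 'I_j.+2) :
    {ffun 'I_j.+1 -> V} :=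
  [ffun k => t (lift i k)].

Definition induced_face j (t : {ffun 'I_j.+2 -> V}) (i : 'I_j.+2) :=
  if odd i then opposite (orient (delete_vertex t i))
  else orient (delete_vertex t i).

Definition in_boundary j (c : {set {ffun 'I_j.+1 -> V}})
    (b : {set {ffun 'I_j.+2 -> V}}) :=
  [exists t in b, exists i : 'I_j.+2, c == induced_face t i].

(* This includes c' = opposite c as soon as c lies in some (j+1)-cell, so that
   the sum over the neighbours of c then has a term - f c. *)
Definition adjacent X j (c' c : oriented_cell X j) :=
  [exists b : oriented_cell X j.+1,
    in_boundary (val c) (val b) && in_boundary (opposite (val c')) (val b)].

Lemma reorder1 j (s : {ffun 'I_j.+1 -> V}) : reorder s 1%g = s.
Proof. by apply/ffunP => i; rewrite ffunE perm1. Qed.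

Lemma reorderM j (s : {ffun 'I_j.+1 -> V}) (a b : 'S_j.+1) :
  reorder (reorder s a) b = reorder s (b * a)%g.
Proof. by apply/ffunP => i; rewrite !ffunE permM. Qed.

Lemma oppositeE j (s : {ffun 'I_j.+1 -> V}) (a : 'S_j.+1) :
  odd_perm a -> opposite (orient s) = orient (reorder s a).
Proof.
move=> oa; apply/setP => x; apply/imset2P/imsetP => /=.
  move=> [y b /imsetP[c ec ->] ob ->]; exists (b * c * a^-1)%g.
    by move: ec ob; rewrite !inE !odd_permM odd_permV oa => /negbTE-> ->.
  by rewrite !reorderM mulgKV.
move=> [b eb ->]; exists s (b * a)%g; last by rewrite reorderM.
  by apply/imsetP; exists 1%g; rewrite ?inE ?odd_perm1 ?reorder1.
by move: eb; rewrite !inE odd_permM oa => /negbTE->.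
Qed.

Lemma odd_perm_exists j : (0 < j)%N -> {a : 'S_j.+1 | odd_perm a}.
Proof.
case: j => // j _; exists (tperm ord0 (lift ord0 ord0)).
by rewrite odd_tperm.
Qed.

Lemma opposite_orientK j (s : {ffun 'I_j.+1 -> V}) :
  (0 < j)%N -> opposite (opposite (orient s)) = orient s.
Proof.
move=> /odd_perm_exists[a oa].
rewrite (oppositeE s oa) (@oppositeE _ _ a^-1%g) ?odd_permV//.
by rewrite reorderM mulVg reorder1.
Qed.

Lemma opposite_cell X j (c : {set {ffun 'I_j.+1 -> V}}) :
  (0 < j)%N -> is_oriented_cell X c -> is_oriented_cell X (opposite c).
Proof.
move=> /odd_perm_exists[a oa] /existsP[s /and3P[/injectiveP si sX /eqP->]].
apply/existsP; exists (reorder s a); rewrite (oppositeE _ oa) eqxx andbT.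
apply/andP; split.
  by apply/injectiveP => x y; rewrite !ffunE => /si /perm_inj.
suff -> : [set reorder s a i | i in 'I_j.+1]%SET = [set s i | i in 'I_j.+1]%SET
  by [].
apply/setP => v; apply/imsetP/imsetP => -[i _ ->].
  by exists (a i); rewrite ?ffunE.
by exists (a^-1%g i); rewrite ?ffunE ?permKV.
Qed.

Lemma oppositeK X j (c : oriented_cell X j) :
  (0 < j)%N -> opposite (opposite (val c)) = val c.
Proof.
move=> j0; case: c => c /= /existsP[s /and3P[_ _ /eqP->]].
exact: opposite_orientK.
Qed.

Lemma in_boundary_opposite j (c : {set {ffun 'I_j.+1 -> V}})
    (b : {set {ffun 'I_j.+2 -> V}}) : (0 < j)%N ->
  in_boundary c b -> in_boundary (opposite c) (opposite b).
Proof.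
move=> j0 /existsP[t /andP[tb /existsP[i /eqP->]]].
have [a oa] := odd_perm_exists j0.
have ola : odd_perm (lift_perm i i a) by rewrite odd_lift_perm addbb.
apply/existsP; exists (reorder t (lift_perm i i a)); apply/andP; split.
  by apply/imset2P; exists t (lift_perm i i a).
apply/existsP; exists i; rewrite /induced_face.
have -> : delete_vertex (reorder t (lift_perm i i a)) i =
    reorder (delete_vertex t i) a.
  by apply/ffunP => k; rewrite !ffunE lift_perm_lift.
by rewrite -(oppositeE _ oa); case: ifP.
Qed.

End OrientedCells.

Section Adjacency.
Variables (V : finType) (R : fieldType) (X : {set {set V}}) (j : nat).
Local Notation C := (oriented_cell X j).

Definition pair_sum (c c' : C) (f : {ffun C -> R^o}) : R^o := f c' + f c.

Fact pair_sum_is_linear c c' : linear (pair_sum c c').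
Proof.
by move=> a f g; rewrite /pair_sum !ffunE scalerDr addrACA.
Qed.
HB.instance Definition _ c c' :=
  GRing.isLinear.Build R {ffun C -> R^o} R^o _ (pair_sum c c')
    (pair_sum_is_linear c c').

Definition Omega : {vspace {ffun C -> R^o}} :=
  (\bigcap_(c : C) \bigcap_(c' : C | val c' == opposite (val c))
     lker (linfun (pair_sum c c')))%VS.

Lemma OmegaP (f : {ffun C -> R^o}) :
  f \in Omega <->
  forall c c' : C, val c' = opposite (val c) -> f c' = - f c.
Proof.
split=> [fO c c' /eqP cc'|fP].
  move: fO => /subv_bigcapP /(_ c isT) /subv_bigcapP /(_ c' cc').
  by rewrite -memvE memv_ker lfunE /= /pair_sum addr_eq0 => /eqP.
apply/subv_bigcapP => c _; apply/subv_bigcapP => c' /eqP cc'.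
by rewrite -memvE memv_ker lfunE /= /pair_sum (fP _ _ cc') addNr.
Qed.

Definition adjacency_sum (f : {ffun C -> R^o}) : {ffun C -> R^o} :=
  [ffun c => \sum_(c' : C | adjacent c' c) f c'].

Definition adjacency_fun (f : subvs_of Omega) : subvs_of Omega :=
  vsproj Omega (adjacency_sum (vsval f)).

Fact adjacency_fun_is_linear : linear adjacency_fun.
Proof.
move=> a f g; rewrite /adjacency_fun -linearP; congr vsproj.
apply/ffunP => c; rewrite !ffunE scaler_sumr -big_split /=.
by apply: eq_bigr => c' _; rewrite !ffunE.
Qed.
HB.instance Definition _ :=
  GRing.isLinear.Build R (subvs_of Omega) (subvs_of Omega) _ adjacency_fun
    adjacency_fun_is_linear.

Definition adjacency : 'End(subvs_of Omega) := linfun adjacency_fun.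

(* The projection in adjacency_fun changes nothing. *)
Lemma adjacencyE (f : subvs_of Omega) (c : C) : (0 < j)%N ->
  vsval (adjacency f) c = \sum_(c' : C | adjacent c' c) vsval f c'.
Proof.
move=> j0; rewrite lfunE /= /adjacency_fun vsprojK ?ffunE//.
apply/OmegaP => {}c d cd; rewrite !ffunE -sumrN.
pose h (x : C) : C := Sub (opposite (val x)) (opposite_cell j0 (valP x)).
have hK : involutive h by move=> x; apply: val_inj; rewrite /= oppositeK.
have -> : d = h c by apply: val_inj.
rewrite (reindex_inj (inv_inj hK)) /=.
have adjh x y : adjacent x y -> adjacent (h x) (h y).
  move=> /existsP[b /andP[yb xb]]; apply/existsP.
  exists (Sub (opposite (val b)) (opposite_cell (ltn0Sn j) (valP b))).
  by rewrite !SubK !in_boundary_opposite.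
apply: eq_big => [x|x _].
  by apply/idP/idP => [/adjh|/adjh//]; rewrite !hK.
by apply: (OmegaP _).1 => //; exact: valP.
Qed.

End Adjacency.
Arguments adjacency {V} R X j.

(* Vertex i of 'I_n stands for the vertex i + 1 of {1, ..., n}; chi selects the
   d-cells among the finite subsets of nat that have d + 1 elements. *)
Definition LM_complex (d : nat) (chi : {fset nat} -> bool) (n : nat) :
    {set {set 'I_n}} :=
  [set s : {set 'I_n} | (#|s| <= d)%N ||
     (#|s| == d.+1) && chi [fset nat_of_ord i | i in s]%fset]%SET.

Lemma LM_complexP d chi n : is_complex (LM_complex d chi n).
Proof.
move=> s t; rewrite !inE => sX ts; have [sd|sd] := leqP #|s| d.
  by rewrite (leq_trans (subset_leq_card ts)).
move: sX; rewrite leqNgt sd /= => /andP[/eqP sE chis].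
have [/eqP ->|tNs] := boolP (t == s); first by rewrite sE eqxx chis orbT.
have : t \proper s by rewrite finset.properEneq tNs.
by move=> /proper_card; rewrite sE ltnS => ->.
Qed.

Section SpectralMeasure.
Variables (R : realType) (vT : vectType R).

(* The eigenvalues with their multiplicities, in nondecreasing order; the
   default value is never taken for a self-adjoint B. *)
Definition eigenvalues (B : 'End(vT)) : seq R :=
  xget [::] [set s : seq R | sorted <=%R s /\
    char_poly (passmx.mxof (vbasis {:vT}) (vbasis {:vT}) B) =
      \prod_(a <- s) ('X - a%:P)].

Definition spectral_measure (B : 'End(vT)) : {measure set R -> \bar R} :=
  mscale (((\dim {:vT})%:R^-1 : R)%:nng)
    (msum (fun i : nat => \d_((eigenvalues B)`_i) : {measure set R -> \bar R})
       (\dim {:vT})).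

End SpectralMeasure.

Section Semicircle.
Variable R : realType.
Local Notation mu := (@lebesgue_measure R).

Definition semicircle_pdf (x : R) : R :=
  Num.sqrt (Num.max (4 - x ^+ 2) 0) / (2 * pi).

Lemma semicircle_pdf_ge0 x : 0 <= semicircle_pdf x.
Proof. by rewrite divr_ge0 ?sqrtr_ge0 ?mulr_ge0 ?pi_ge0. Qed.

Lemma measurable_semicircle_pdf : measurable_fun [set: R] semicircle_pdf.
Proof.
apply: measurable_funM => //; apply: measurableT_comp.
  by apply: continuous_measurable_fun; exact: sqrt_continuous.
apply: measurable_maxr => //.
by apply: measurable_funB => //; exact: measurable_funX.
Qed.

Definition semicircle (A : set R) : \bar R :=
  (\int[mu]_(x in A) (semicircle_pdf x)%:E)%E.

Let semicircle0 : semicircle set0 = 0%E.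
Proof. by rewrite /semicircle integral_set0. Qed.

Let semicircle_ge0 A : (0 <= semicircle A)%E.
Proof.
by apply: integral_ge0 => x _; rewrite lee_fin semicircle_pdf_ge0.
Qed.

Let semicircle_sigma_additive : semi_sigma_additive semicircle.
Proof.
move=> /= F mF tF mUF; rewrite /semicircle; apply: cvg_toP.
  apply: ereal_nondecreasing_is_cvgn => m n mn.
  apply: lee_sum_nneg_natr => // k _ _.
  by apply: integral_ge0 => /= x Fkx; rewrite lee_fin semicircle_pdf_ge0.
rewrite ge0_integral_bigcup//=.
- apply: measurable_funTS; apply: measurableT_comp => //.
  exact: measurable_semicircle_pdf.
- by move=> x _; rewrite lee_fin semicircle_pdf_ge0.
Qed.

HB.instance Definition _ := isMeasure.Build _ _ _ semicircle
  semicircle0 semicircle_ge0 semicircle_sigma_additive.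

End Semicircle.
Arguments semicircle : clear implicits.

Definition weak_cvg (R : realType) (mu : nat -> {measure set R -> \bar R})
    (nu : {measure set R -> \bar R}) : Prop :=
  forall f : R -> R, continuous f -> [bounded f x | x in [set: R]] ->
    (\int[mu n]_x (f x)%:E @[n --> \oo] --> \int[nu]_x (f x)%:E)%E.

Definition mutually_independent (disp : measure_display)
    (T : measurableType disp) (R : realType) (P : probability T R)
    (I : choiceType) (D : set I) (Y : I -> {RV P >-> R}) : Prop :=
  forall (J : {fset I}) (B : I -> set R), [set` J] `<=` D ->
    (forall i, i \in J -> measurable (B i)) ->
    P (\bigcap_(i in [set` J]) (Y i @^-1` B i)) =
      (\prod_(i <- J) P (Y i @^-1` B i))%E.

(* Main.v *)
From HB Require Import structures.
Require Import Defs.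
From mathcomp Require Import complex ring lra zify spectral.

(** The spectral measure is controlled through its Stieltjes transform, that is
    through the trace of the resolvent [G] of the scaled adjacency matrix, taken
    only at points [i e] with [e >= 2] of the imaginary axis.

    Choosing an orientation of every (d-1)-cell turns the adjacency operator into a
    real symmetric matrix indexed by the d-subsets of the vertices
    ([char_poly_adjacency], [eigenvalues_resolvent]). Two distinct cells that lie in
    a common d-cell determine it, and the entry is then [incidence r x * incidence
    r y], where [r] is their intersection ([adjacency_entryE]). So, off the
    diagonal, the mean of the matrix is [p] times a Gram matrix whose rank is at
    most the number of (d-2)-cells, which is negligible against that of the
    (d-1)-cells; removing it and the bounded diagonal moves the normalised trace by
    a vanishing amount ([mxtrace_adjacency_dist]).

    What remains is [H = s sum_t (chi_t - p) H_t] with independent [chi_t], where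
    [H_t] is a matrix of signs on the d+1 facets of [t]. The blocks form a linear
    hypergraph: two facets share at most one block. This structure alone gives the
    limit. Integration by parts for Bernoulli variables ([expect_by_parts]),
    applied to the diagonal entries of [H G = 1 + i e G], together with the bounds
    that the Ward identity gives on the rows of [G], shows that the means [a_x] of
    the [G x x] satisfy [1 + i e a_x + a_x b_x = 0] up to an error that is of order
    [s] in mean, [b_x] being [1 / (d n)] times the sum of [a] over the neighbours of [x].
    For [e >= 2] this system is stable, so that the [a_x] are on average close to
    the solution [m] of [1 + i e m + m^2 = 0] ([expect_mxtrace_dist]). The
    Efron-Stein inequality bounds the variance of the trace by a multiple of the
    number [N] of (d-1)-cells ([cvar_mxtrace]); as [N] is at least of order [n^2] for
    [d >= 2], Chebyshev and Borel-Cantelli give almost sure convergence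
    ([ae_stieltjes]).

    The number [m] is the Stieltjes transform at [i e] of the semicircle law
    ([semicircle_kernel], [semicircle_kernel_odd]). Convergence at countably many
    such points is convergence of the integrals of [1 / (x^2 + t)] and
    [x / (x^2 + t)] for a sequence of values [t] that decreases to 4. By partial fractions
    and a limit these kernels yield all polynomials in [u = 1 / (x^2 + 4)] and
    [x u] times such polynomials, and the theorem of Weierstrass then yields all
    continuous functions of compact support. Since the limit has all its mass in
    [-2, 2] no mass escapes, and the convergence is weak ([means_converge]). *)

Set Implicit Arguments.
Unset Strict Implicit.
Unset Printing Implicit Defensive.

Local Open Scope classical_set_scope.
Local Open Scope ring_scope.

(** * The modulus of complex numbers *)

Section ComplexModulus.
Variable R : rcfType.
Implicit Types z w : R[i].

(** The norm of [R[i]] takes its values in [R[i]]; estimates need a real number. *)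
Definition cabs z : R := Num.sqrt (complex.Re z ^+ 2 + complex.Im z ^+ 2).

Lemma cabsE z : cabs z = ComplexField.Normc.normc z.
Proof. by case: z. Qed.

Lemma cabs_ge0 z : 0 <= cabs z.
Proof. exact: sqrtr_ge0. Qed.

Lemma sqr_cabs z : cabs z ^+ 2 = complex.Re z ^+ 2 + complex.Im z ^+ 2.
Proof. by rewrite sqr_sqrtr // addr_ge0 // sqr_ge0. Qed.

Lemma cabsM z w : cabs (z * w) = cabs z * cabs w.
Proof. by rewrite !cabsE ComplexField.Normc.normcM. Qed.

Lemma cabsD z w : cabs (z + w) <= cabs z + cabs w.
Proof. by rewrite !cabsE; exact: le_normcD. Qed.

Lemma cabsN z : cabs (- z) = cabs z.
Proof. by rewrite !cabsE; exact: normcN. Qed.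

Lemma cabs0 : cabs 0 = 0.
Proof. by rewrite cabsE ComplexField.Normc.normc0. Qed.

Lemma cabs1 : cabs 1 = 1.
Proof. by rewrite cabsE ComplexField.Normc.normc1. Qed.

Lemma cabs0_eq0 z : cabs z = 0 -> z = 0.
Proof. by rewrite cabsE => /ComplexField.Normc.eq0_normc. Qed.

Lemma cabs_real (x : R) : cabs (x%:C)%C = `|x|.
Proof. by rewrite /cabs /= expr0n addr0 sqrtr_sqr. Qed.

Lemma cabs_sum (I : Type) (r : seq I) (P : pred I) (F : I -> R[i]) :
  cabs (\sum_(i <- r | P i) F i) <= \sum_(i <- r | P i) cabs (F i).
Proof.
elim/big_rec2: _ => [|i y x _ le_xy]; first by rewrite cabs0.
by apply: le_trans (cabsD _ _) _; rewrite lerD2l.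
Qed.

Lemma abs_Re_le z : `|complex.Re z| <= cabs z.
Proof.
by rewrite -sqrtr_sqr ler_sqrt ?lerDl ?addr_ge0 ?sqr_ge0.
Qed.

Lemma abs_Im_le z : `|complex.Im z| <= cabs z.
Proof.
by rewrite -sqrtr_sqr ler_sqrt ?lerDr ?addr_ge0 ?sqr_ge0.
Qed.

Lemma mulc_conj z : z * conjc z = ((cabs z ^+ 2)%:C)%C.
Proof.
rewrite sqr_cabs; case: z => a b; apply/eqP; rewrite eq_complex /=.
by apply/andP; split; apply/eqP; ring.
Qed.

Lemma Re_sum (I : Type) (r : seq I) (P : pred I) (F : I -> R[i]) :
  complex.Re (\sum_(i <- r | P i) F i) = \sum_(i <- r | P i) complex.Re (F i).
Proof. by elim/big_rec2: _ => // i y x _ <-; case: (F i) x => a b []. Qed.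

Lemma Im_sum (I : Type) (r : seq I) (P : pred I) (F : I -> R[i]) :
  complex.Im (\sum_(i <- r | P i) F i) = \sum_(i <- r | P i) complex.Im (F i).
Proof. by elim/big_rec2: _ => // i y x _ <-; case: (F i) x => a b []. Qed.

End ComplexModulus.

(** * Sums of squares *)

Section SumInequalities.
Variable R : realFieldType.

Lemma sqr_sum_le (I : finType) (A : {set I}) (x : I -> R) :
  (\sum_(i in A) x i) ^+ 2 <= #|A|%:R * \sum_(i in A) x i ^+ 2.
Proof.
have h : 0 <= \sum_(i in A) \sum_(j in A) (x i - x j) ^+ 2.
  by apply: sumr_ge0 => i _; apply: sumr_ge0 => j _; exact: sqr_ge0.
have e : \sum_(i in A) \sum_(j in A) (x i - x j) ^+ 2 =
    2 * (#|A|%:R * \sum_(i in A) x i ^+ 2) - 2 * (\sum_(i in A) x i) ^+ 2.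
  transitivity (\sum_(i in A) (#|A|%:R * x i ^+ 2 + \sum_(j in A) x j ^+ 2
      - 2 * (x i * \sum_(j in A) x j))).
    apply: eq_bigr => i _.
    rewrite -[#|A|%:R](@sumr_const _ _ (mem A) 1) mulr_suml mulr_sumr.
    rewrite mulr_sumr -sumrN -!big_split /=.
    by apply: eq_bigr => j _; ring.
  rewrite !big_split /= sumr_const sumrN -!mulr_sumr -mulr_suml expr2.
  by rewrite -mulr_natl; ring.
rewrite e in h; lra.
Qed.

Lemma mul_le_half_sqr (x y : R) : x * y <= (x ^+ 2 + y ^+ 2) / 2.
Proof. have := sqr_ge0 (x - y); lra. Qed.

End SumInequalities.

(** * Resolvents of real symmetric matrices *)

Section Resolvent.
Variables (R : rcfType) (N : nat).
Implicit Types (A B : 'M[R]_N) (e : R).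
Local Notation MtoC := (map_mx (real_complex R)).
Local Notation conjmx := (map_mx (@conjc R)).

(** The points [i e] of the imaginary axis suffice, and there the limit equation has a
    purely imaginary solution. *)
Definition shifted A e : 'M[R[i]]_N := MtoC A - (0 +i* e)%C%:M.

Definition resolvent A e : 'M[R[i]]_N := invmx (shifted A e).

(** A left kernel vector [v] would satisfy both [v A v^* = i e |v|^2] and, by
    symmetry of [A], [v A v^* = - i e |v|^2]. *)
Lemma shifted_unit A e : A^T = A -> 0 < e -> shifted A e \in unitmx.
Proof.
move=> symA e0; rewrite -row_free_unit -kermx_eq0.
apply/negPn/negP => /matrix0Pn [i [j vij]].
set v := row i (kermx (shifted A e)).
have vA : v *m MtoC A = (0 +i* e)%C *: v.
  have /eqP := mulmx_ker (shifted A e).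
  move=> /eqP/(congr1 (row i)); rewrite row_mul -/v row0.
  by rewrite /shifted mulmxBr mul_mx_scalar => /eqP; rewrite subr_eq0 => /eqP.
have wA : conjmx v *m MtoC A = (0 -i* e)%C *: conjmx v.
  have /(congr1 conjmx) := vA.
  rewrite map_mxM map_mxZ /= => <-; congr (_ *m _).
  by apply/matrixP => a b; rewrite !mxE conjc_real.
have e1 : v *m MtoC A *m (conjmx v)^T = (0 -i* e)%C *: (v *m (conjmx v)^T).
  apply: trmx_inj; rewrite !trmx_mul !trmxK.
  rewrite (map_trmx (real_complex R)) symA mulmxA wA.
  by rewrite -scalemxAl linearZ /= trmx_mul trmxK.
move: e1; rewrite vA -scalemxAl => /matrixP/(_ ord0 ord0); rewrite !mxE.
have -> : \sum_j0 v ord0 j0 * (conjmx v)^T j0 ord0 =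
    ((\sum_k cabs (v ord0 k) ^+ 2)%:C)%C.
  rewrite rmorph_sum; apply: eq_bigr => k _; rewrite /= -mulc_conj.
  by congr (_ * _); rewrite !mxE.
move=> /(congr1 (@complex.Im _)) /=; rewrite !mul0r !add0r mulNr.
move=> /eqP; rewrite -subr_eq0 opprK -mulr2n -mulr_natl !mulf_eq0.
rewrite pnatr_eq0 (gt_eqF e0) /= psumr_eq0 => [|k _]; last exact: sqr_ge0.
move=> /allP/(_ j); rewrite mem_index_enum => /(_ isT) /=.
rewrite expf_eq0 /= => /eqP/cabs0_eq0; rewrite mxE => vij0.
by rewrite vij0 eqxx in vij.
Qed.

Section SymmetricResolvent.
Variables (A : 'M[R]_N) (e : R).
Hypotheses (symA : A^T = A) (e0 : 0 < e).
Local Notation G := (resolvent A e).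

Lemma mul_resolvent : shifted A e *m G = 1%:M.
Proof. by rewrite mulmxV // shifted_unit. Qed.

Lemma resolvent_mul : G *m shifted A e = 1%:M.
Proof. by rewrite mulVmx // shifted_unit. Qed.

Lemma mul_map_resolvent : MtoC A *m G = 1%:M + (0 +i* e)%C *: G.
Proof.
rewrite -mul_resolvent /shifted mulmxBl mul_scalar_mx subrK //.
Qed.

Lemma resolvent_sym : G^T = G.
Proof.
rewrite /resolvent trmx_inv; congr invmx.
by rewrite /shifted linearB /= tr_scalar_mx map_trmx symA.
Qed.

Lemma resolvent_symE a b : G a b = G b a.
Proof. by rewrite -[in LHS]resolvent_sym mxE. Qed.

(** The Ward identity in matrix form: [conj (A - i e) = (A - i e) + 2 i e]. *)
Lemma resolvent_im :
  G - conjmx G = (0 +i* (e *+ 2))%C *: (conjmx G *m G).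
Proof.
have conjS : conjmx (shifted A e) = shifted A e + (0 +i* (e *+ 2))%C%:M.
  apply/matrixP => i j; rewrite !mxE rmorphB /=.
  case: (i == j); rewrite ?mulr1n ?mulr0n ?conjc0; apply/eqP;
    by rewrite eq_complex /=; apply/andP; split; apply/eqP; ring.
have conjG : conjmx G *m conjmx (shifted A e) = 1%:M.
  by rewrite -map_mxM resolvent_mul map_mx1.
have := congr1 (mulmx^~ G) conjG.
rewrite conjS mulmxDr mulmxDl -mulmxA mul_resolvent mulmx1 mul_mx_scalar.
by rewrite -scalemxAl mul1mx => GE; rewrite -[X in X - _]GE addrC addKr.
Qed.

(** The source of all a priori bounds on entries: the squares of a whole row are
    controlled by its diagonal entry, uniformly in the size of the matrix. *)
Lemma ward a : \sum_b cabs (G a b) ^+ 2 = complex.Im (G a a) / e.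
Proof.
have := resolvent_im.
move=> /matrixP/(_ a a); rewrite !mxE.
have -> : \sum_j (conjmx G) a j * G j a = ((\sum_b cabs (G a b) ^+ 2)%:C)%C.
  rewrite rmorph_sum; apply: eq_bigr => k _.
  by rewrite mxE mulrC resolvent_symE /= -mulc_conj.
case: (G a a) => x y /(congr1 (@complex.Im _)) /=.
rewrite opprK mul0r add0r => h; apply: (mulfI (lt0r_neq0 e0)).
rewrite mulrCA divff ?gt_eqF // mulr1.
move: h; rewrite -mulr_natl; lra.
Qed.

Lemma resolvent_diag_le a : cabs (G a a) <= e^-1.
Proof.
have h : cabs (G a a) ^+ 2 <= cabs (G a a) / e.
  apply: (@le_trans _ _ (complex.Im (G a a) / e)); last first.
    rewrite ler_pM2r ?invr_gt0 //.
    by apply: le_trans (abs_Im_le _); exact: ler_norm.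
  rewrite -ward (bigD1 a) //= lerDl.
  by apply: sumr_ge0 => i _; exact: sqr_ge0.
have := cabs_ge0 (G a a); rewrite le_eqVlt => /orP[/eqP <-|c0].
  by rewrite invr_ge0 ltW.
by move: h; rewrite expr2 ler_pM2l.
Qed.

Lemma resolvent_row_le a : \sum_b cabs (G a b) ^+ 2 <= e^-1 ^+ 2.
Proof.
rewrite ward expr2 ler_pM2r ?invr_gt0 //.
apply: le_trans (resolvent_diag_le a).
by apply: le_trans (abs_Im_le _); exact: ler_norm.
Qed.

Lemma resolvent_entry_le a b : cabs (G a b) <= e^-1.
Proof.
rewrite -(@ler_pXn2r _ 2) ?nnegrE ?invr_ge0 ?cabs_ge0 ?(ltW e0) //.
apply: le_trans (resolvent_row_le a).
by rewrite (bigD1 b) //= lerDl; apply: sumr_ge0 => i _; exact: sqr_ge0.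
Qed.

End SymmetricResolvent.

Lemma resolvent_identity A B e : A^T = A -> B^T = B -> 0 < e ->
  resolvent B e - resolvent A e =
  resolvent A e *m MtoC (A - B) *m resolvent B e.
Proof.
move=> symA symB e0.
have -> : MtoC (A - B) = shifted A e - shifted B e.
  by rewrite /shifted opprB addrA subrK map_mxB.
rewrite mulmxBr resolvent_mul // mulmxBl mul1mx -mulmxA mul_resolvent //.
by rewrite mulmx1.
Qed.

(** Cauchy-Schwarz against the row bounds of two resolvents. *)
Lemma resolvent_prod_le A B e a b : A^T = A -> B^T = B -> 0 < e ->
  cabs ((resolvent A e *m resolvent B e) a b) <= e^-1 ^+ 2.
Proof.
move=> symA symB e0; rewrite mxE.
apply: le_trans (cabs_sum _ _ _) _.
apply: (@le_trans _ _ (\sum_j ((cabs (resolvent A e a j) ^+ 2 +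
    cabs (resolvent B e b j) ^+ 2) / 2))).
  apply: ler_sum => j _; rewrite cabsM (resolvent_symE e symB j b).
  exact: mul_le_half_sqr.
rewrite -mulr_suml big_split /=.
have := resolvent_row_le symA e0 a; have := resolvent_row_le symB e0 b.
lra.
Qed.

End Resolvent.

(** * Perturbation of the trace of a resolvent *)

Section TracePerturbation.
Variables (R : rcfType) (N : nat).
Implicit Types (A B : 'M[R]_N) (e c : R).
Local Notation MtoC := (map_mx (real_complex R)).

(** By the resolvent identity the difference is the trace of
    [(A - B) (resolvent B e) (resolvent A e)], in which only the diagonal of
    [A - B] is left. *)
Lemma mxtrace_resolvent_diag A B e c :
  A^T = A -> B^T = B -> 0 < e ->
  (forall i j, i != j -> A i j = B i j) ->
  (forall i, `|A i i - B i i| <= c) ->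
  cabs (\tr (resolvent B e) - \tr (resolvent A e)) <= N%:R * (c / e ^+ 2).
Proof.
move=> symA symB e0 ABij ABii.
rewrite -linearB /= resolvent_identity // -mulmxA mxtrace_mulC -mulmxA.
rewrite [\tr _]/mxtrace.
apply: le_trans (cabs_sum _ _ _) _.
rewrite -[N in N%:R]card_ord mulr_natl -sumr_const.
apply: ler_sum => i _; rewrite mxE (bigD1 i) //= big1 ?addr0.
  rewrite cabsM [in MtoC _ _ _]mxE cabs_real -exprVn.
  apply: ler_pM; rewrite ?cabs_ge0 ?normr_ge0 //; first by rewrite !mxE ABii.
  exact: resolvent_prod_le.
move=> j ji; rewrite mxE [in X in real_complex R X]mxE [in X in _ + X]mxE.
by rewrite (ABij i j) 1?eq_sym // subrr mul0r.
Qed.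

(** The Ward identity tested against a real vector. *)
Lemma ward_quadratic A e (v : 'rV[R]_N) : A^T = A -> 0 < e ->
  \sum_j cabs ((MtoC v *m resolvent A e) ord0 j) ^+ 2 =
  complex.Im ((MtoC v *m resolvent A e *m MtoC v^T) ord0 ord0) / e.
Proof.
move=> symA e0; set G := resolvent A e; set x := MtoC v *m G.
have cv k l (M : 'M[R]_(k, l)) : map_mx (@conjc R) (MtoC M) = MtoC M.
  by apply/matrixP => i j; rewrite !mxE /= oppr0.
have xT : x^T = G *m MtoC v^T by rewrite trmx_mul resolvent_sym // map_trmx.
have : (x *m MtoC v^T) - map_mx (@conjc R) (x *m MtoC v^T) =
    (0 +i* (e *+ 2))%C *: (map_mx (@conjc R) x *m x^T).
  rewrite xT /x !map_mxM !cv /=.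
  rewrite -mulmxA -[X in _ - X]mulmxA -mulmxBr -mulmxBl resolvent_im //.
  by rewrite -scalemxAl -scalemxAr !mulmxA.
move=> /matrixP/(_ ord0 ord0); rewrite mxE [X in _ = X]mxE => h.
have {}h : (x *m MtoC v^T) ord0 ord0 - conjc ((x *m MtoC v^T) ord0 ord0) =
   (0 +i* (e *+ 2))%C * ((\sum_j cabs (x ord0 j) ^+ 2)%:C)%C.
  have -> : ((\sum_j cabs (x ord0 j) ^+ 2)%:C)%C =
      (map_mx (@conjc R) x *m x^T) ord0 ord0.
    rewrite mxE rmorph_sum; apply: eq_bigr => j _ /=; rewrite -mulc_conj mulrC.
    by rewrite !mxE.
  by rewrite -h !mxE.
move: h; case: (_ ord0 ord0) => a b /(congr1 (@complex.Im _)) /=.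
rewrite opprK mul0r add0r => h; apply: (mulfI (lt0r_neq0 e0)).
rewrite mulrCA divff ?gt_eqF // mulr1.
move: h; rewrite -mulr_natl; lra.
Qed.

(** Adding a positive rank one matrix moves the trace of the resolvent by at
    most [e^-1], however large the matrix is: the change is
    [c v G^2 v^T / (1 + c v G v^T)] up to sign, and by the Ward identity its
    numerator is at most [e^-1] times the imaginary part of its denominator. *)
Lemma mxtrace_resolvent_rank1 A B e c (v : 'rV[R]_N) :
  A^T = A -> 0 < e -> 0 <= c -> B = A + c *: (v^T *m v) ->
  cabs (\tr (resolvent B e) - \tr (resolvent A e)) <= e^-1.
Proof.
move=> symA e0 c0 BE.
have symB : B^T = B.
  by rewrite BE linearD linearZ /= trmx_mul trmxK symA.
set G := resolvent A e; set G' := resolvent B e.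
set u := MtoC v; set uT := MtoC v^T.
have uTE : u^T = uT by rewrite map_trmx.
have ME : MtoC (A - B) = - (c%:C)%C *: (uT *m u).
  rewrite BE opprD addrA subrr add0r map_mxN map_mxZ map_mxM /=.
  by rewrite scaleNr.
set x := u *m G; set al := (x *m uT) ord0 ord0.
have alE : x *m uT = al%:M.
  by apply/matrixP => i j; rewrite !ord1 [RHS]mxE mulr1n.
have G'E : G' - G = - (c%:C)%C *: (x^T *m (u *m G')).
  rewrite resolvent_identity // ME -scalemxAr -scalemxAl /x trmx_mul.
  by rewrite resolvent_sym // uTE !mulmxA.
have uG' : (1 + (c%:C)%C * al) *: (u *m G') = x.
  have := congr1 (mulmx u) G'E; rewrite mulmxBr -/x -scalemxAr.
  have -> : u *m (x^T *m (u *m G')) = al *: (u *m G').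
    rewrite mulmxA /x trmx_mul resolvent_sym // uTE (mulmxA u) -/x.
    by rewrite alE mul_scalar_mx.
  move=> h; rewrite scalerDl scale1r -scalerA -[X in X + _](subrK x).
  by rewrite h scaleNr addrC addrA subrr add0r.
rewrite -linearB /= G'E linearZ /= mxtrace_mulC.
have trE : (1 + (c%:C)%C * al) * \tr (u *m G' *m x^T) = \tr (x *m x^T).
  by rewrite -{2}uG' -scalemxAl linearZ.
have xx : cabs (\tr (x *m x^T)) <= complex.Im al / e.
  rewrite /al -ward_quadratic // trace_mx11 mxE.
  apply: le_trans (cabs_sum _ _ _) _; apply: ler_sum => j _.
  by rewrite [x^T _ _]mxE cabsM -expr2.
have im0 : 0 <= complex.Im al / e.
  by apply: le_trans xx; exact: cabs_ge0.
have ge_im : c * complex.Im al <= cabs (1 + (c%:C)%C * al).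
  apply: le_trans (abs_Im_le _); case: al {alE uG' trE xx im0} => a b /=.
  by rewrite mul0r add0r addr0; exact: ler_norm.
have := congr1 (@cabs R) trE; rewrite cabsM => h.
rewrite cabsM cabsN cabs_real ger0_norm //.
have y0 := cabs_ge0 (\tr (u *m G' *m x^T)).
set y := cabs (\tr (u *m G' *m x^T)) in h y0 *.
set w := cabs (1 + _) in h ge_im.
have im1 : 0 <= complex.Im al by rewrite -(pmulr_lge0 (complex.Im al) (x:=e^-1)) ?invr_gt0.
have e1 : 0 < e^-1 by rewrite invr_gt0.
have [w0|w0] := ltrP 0 w.
  have : w * (c * y) <= w * e^-1.
    rewrite mulrCA h; apply: (@le_trans _ _ (c * (complex.Im al / e))).
      by rewrite ler_wpM2l.
    by rewrite mulrA ler_wpM2r // ltW.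
  by rewrite ler_pM2l.
(* otherwise [1 + c al = 0], so [x = 0] and [al = 0], which is absurd *)
have wz : w = 0 by apply/eqP; rewrite eq_le w0 cabs_ge0.
have x0 : x = 0 by rewrite -uG' (cabs0_eq0 wz) scale0r.
have alz : al = 0 by rewrite /al x0 mul0mx mxE.
by move: wz; rewrite /w alz mulr0 addr0 cabs1 => /eqP; rewrite oner_eq0.
Qed.

Lemma mxtrace_resolvent_low_rank (I : finType) (v : I -> 'rV[R]_N) A B e c :
  A^T = A -> 0 < e -> 0 <= c -> B = A + c *: \sum_i ((v i)^T *m v i) ->
  cabs (\tr (resolvent B e) - \tr (resolvent A e)) <= #|I|%:R / e.
Proof.
move=> symA e0 c0 ->.
rewrite -[\sum_i _]big_enum cardE; elim: (enum I) => [|i r IH].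
  by rewrite big_nil scaler0 addr0 subrr cabs0 mul0r.
rewrite big_cons scalerDr addrA -[A + _ + _]addrA [X in A + X]addrC addrA.
set A' := A + c *: _ in IH *.
have symA' : A'^T = A'.
  rewrite linearD linearZ /= symA linear_sum /=; congr (_ + _ *: _).
  by apply: eq_bigr => j _; rewrite trmx_mul trmxK.
rewrite -[X in X - _](subrK (\tr (resolvent A' e))) -addrA.
apply: le_trans (cabsD _ _) _.
rewrite [size _]/= -[(size r).+1]add1n natrD mulrDl mul1r lerD //.
exact: (mxtrace_resolvent_rank1 symA' e0 c0 (erefl _)).
Qed.

End TracePerturbation.

(** * Independent Bernoulli variables *)

Section BernoulliProduct.
Variable T : finType.
Local Notation config := {ffun T -> bool}.
Implicit Types (chi : config) (t u : T).

Definition upd chi t b : config := [ffun u => if u == t then b else chi u].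

Lemma upd_id chi t : upd chi t (chi t) = chi.
Proof. by apply/ffunP => u; rewrite ffunE; case: eqP => [->|]. Qed.

Lemma updE chi t b : upd chi t b t = b.
Proof. by rewrite ffunE eqxx. Qed.

Lemma updNE chi t b u : u != t -> upd chi t b u = chi u.
Proof. by rewrite ffunE => /negbTE->. Qed.

Lemma upd_upd chi t b c : upd (upd chi t b) t c = upd chi t c.
Proof. by apply/ffunP => u; rewrite !ffunE; case: eqP. Qed.

Lemma updC chi t u b c : t != u ->
  upd (upd chi t b) u c = upd (upd chi u c) t b.
Proof.
move=> tu; apply/ffunP => v; rewrite !ffunE.
by case: (eqVneq v u) => // ->; rewrite eq_sym (negbTE tu).
Qed.

Section Expectation.
Variables (K : comNzRingType) (p : K).
Implicit Type F : config -> K.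

Definition weight chi : K := \prod_t (if chi t then p else 1 - p).

Definition expect F : K := \sum_chi weight chi * F chi.

Definition average t F chi : K :=
  p * F (upd chi t true) + (1 - p) * F (upd chi t false).

Let sum_split t (g : config -> K) :
  \sum_(chi : config) g chi = \sum_(chi : config | chi t) (g chi + g (upd chi t false)).
Proof.
rewrite (bigID (fun chi : config => chi t)) big_split /=; congr (_ + _).
rewrite (reindex_onto (fun chi => upd chi t false) (fun chi => upd chi t true)).
  apply: eq_bigl => chi; rewrite updE upd_upd /=.
  by apply/eqP/idP => [<-|ct]; [rewrite updE|rewrite -{2}[chi](upd_id _ t) ct].
by move=> chi ct /=; rewrite upd_upd -(negbTE ct) upd_id.
Qed.

Lemma expect_average t F : expect (average t F) = expect F.
Proof.
pose w' chi := \prod_(u | u != t) (if chi u then p else 1 - p).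
have wE chi : weight chi = (if chi t then p else 1 - p) * w' chi.
  by rewrite /weight (bigD1 t).
have w'E chi b : w' (upd chi t b) = w' chi.
  by apply: eq_bigr => u ut; rewrite updNE.
rewrite /expect !(sum_split t); apply: eq_bigr => chi ct.
rewrite !wE !w'E ct updE /average !upd_upd.
have -> : upd chi t true = chi by rewrite -ct upd_id.
ring.
Qed.

Lemma expectD F F' : expect (fun chi => F chi + F' chi) = expect F + expect F'.
Proof. by rewrite -big_split; apply: eq_bigr => chi _; rewrite mulrDr. Qed.

Lemma expectZ a F : expect (fun chi => a * F chi) = a * expect F.
Proof. by rewrite mulr_sumr; apply: eq_bigr => chi _; rewrite mulrCA. Qed.

Lemma expectB F F' : expect (fun chi => F chi - F' chi) = expect F - expect F'.
Proof.
rewrite -[X in _ - X]mul1r -mulNr -expectZ -expectD.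
by apply: eq_bigr => chi _; rewrite mulN1r.
Qed.

Lemma expect_sum (I : Type) (r : seq I) (P : pred I) (F : I -> config -> K) :
  expect (fun chi => \sum_(i <- r | P i) F i chi) =
  \sum_(i <- r | P i) expect (F i).
Proof. by rewrite exchange_big; apply: eq_bigr => chi _; rewrite mulr_sumr. Qed.

Lemma eq_expect F F' : F =1 F' -> expect F = expect F'.
Proof. by move=> FF'; apply: eq_bigr => chi _; rewrite FF'. Qed.

Lemma sum_weight : \sum_chi weight chi = 1.
Proof.
rewrite /weight -(bigA_distr_bigA (fun (t : T) (b : bool) => if b then p else 1 - p)).
by rewrite big1 // => t _; rewrite big_bool /=; ring.
Qed.

Lemma expect_cst a : expect (fun=> a) = a.
Proof. by rewrite /expect -mulr_suml sum_weight mul1r. Qed.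

(** The Bernoulli analogue of Gaussian integration by parts, without remainder:
    both sides are computed after averaging over the coordinate [t] alone. *)
Lemma expect_by_parts t F :
  expect (fun chi => ((chi t)%:R - p) * F chi) =
  p * (1 - p) * expect (fun chi => F (upd chi t true) - F (upd chi t false)).
Proof.
rewrite -(expect_average t) -expectZ; apply: eq_expect => chi.
by rewrite /average !updE mulr0n mulr1n; ring.
Qed.

End Expectation.

Section RealExpectation.
Variables (R : realFieldType) (p : R).
Hypothesis p01 : 0 <= p <= 1.
Implicit Type F : config -> R.
Local Notation E := (expect p).

Lemma weight_ge0 chi : 0 <= weight p chi.
Proof.
case/andP: p01 => p0 p1.
by apply: prodr_ge0 => t _; case: ifP; rewrite ?subr_ge0.
Qed.

Lemma le_expect F F' : (forall chi, F chi <= F' chi) -> E F <= E F'.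
Proof. by move=> FF'; apply: ler_sum => chi _; rewrite ler_wpM2l ?weight_ge0. Qed.

Lemma expect_le F a : (forall chi, F chi <= a) -> E F <= a.
Proof. by move=> Fa; rewrite -[leRHS](expect_cst p); exact: le_expect. Qed.

Lemma average_sqr t F chi :
  average p t (fun c => F c ^+ 2) chi - average p t F chi ^+ 2 =
  p * (1 - p) * (F (upd chi t true) - F (upd chi t false)) ^+ 2.
Proof. by rewrite /average; ring. Qed.

Lemma sqr_average_le t F chi :
  average p t F chi ^+ 2 <= average p t (fun c => F c ^+ 2) chi.
Proof.
rewrite -subr_ge0 average_sqr mulr_ge0 ?sqr_ge0 //.
by case/andP: p01 => p0 p1; rewrite mulr_ge0 ?subr_ge0.
Qed.

Definition sqr_diff F t : R :=
  E (fun chi => (F (upd chi t true) - F (upd chi t false)) ^+ 2).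

Lemma expect_sqr_average t F :
  E (fun chi => F chi ^+ 2) - E (fun chi => average p t F chi ^+ 2) =
  p * (1 - p) * sqr_diff F t.
Proof.
rewrite -(expect_average p t) -expectB -expectZ; apply: eq_expect => chi.
exact: average_sqr.
Qed.

(** By convexity of the square, as differences along [u] commute with averages
    over [t]. *)
Lemma sqr_diff_average t u F : t != u ->
  sqr_diff (average p t F) u <= sqr_diff F u.
Proof.
move=> tu; rewrite /sqr_diff.
rewrite -[leRHS](expect_average p t); apply: le_expect => chi.
pose D c := F (upd c u true) - F (upd c u false).
have -> : average p t F (upd chi u true) - average p t F (upd chi u false) =
    average p t D chi.
  by rewrite /average /D !(updC _ _ _ tu); ring.
exact: sqr_average_le.
Qed.

Definition averages (s : seq T) F := foldr (average p) F s.

Let efron_stein_seq s F : uniq s ->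
  E (fun chi => F chi ^+ 2) - E (fun chi => averages s F chi ^+ 2) <=
    p * (1 - p) * \sum_(t <- s) sqr_diff F t /\
  forall u, u \notin s -> sqr_diff (averages s F) u <= sqr_diff F u.
Proof.
have q0 : 0 <= p * (1 - p).
  by case/andP: p01 => p0 p1; rewrite mulr_ge0 ?subr_ge0.
elim: s => [_|t s IH /= /andP[ts us]].
  by rewrite big_nil mulr0 subrr; split.
have [h1 h2] := IH us; split; last first.
  move=> u; rewrite inE negb_or => /andP[ut us'].
  apply: le_trans (h2 u us'); apply: sqr_diff_average.
  by rewrite eq_sym.
rewrite big_cons mulrDr.
have := expect_sqr_average t (averages s F).
have : p * (1 - p) * sqr_diff (averages s F) t <= p * (1 - p) * sqr_diff F t.
  by rewrite ler_wpM2l // h2.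
lra.
Qed.

Let averages_indep s F chi chi' :
  (forall u, u \notin s -> chi u = chi' u) ->
  averages s F chi = averages s F chi'.
Proof.
elim: s chi chi' => [|t s IH] chi chi' cc' /=.
  by congr F; apply/ffunP => u; exact: cc'.
rewrite /average; congr (_ * _ + _ * _); apply: IH => u us; rewrite !ffunE;
  by case: ifP => // ut; apply: cc'; rewrite inE ut.
Qed.

Let expect_averages s F : E (averages s F) = E F.
Proof. by elim: s => //= t s IH; rewrite expect_average. Qed.

(** The Efron-Stein inequality: replacing the coordinates one after another by
    their averages telescopes the variance into one-coordinate variances. *)
Lemma efron_stein F :
  E (fun chi => F chi ^+ 2) - E F ^+ 2 <= p * (1 - p) * \sum_t sqr_diff F t.
Proof.
have [h _] := efron_stein_seq F (index_enum_uniq T); apply: le_trans h.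
have cst chi : averages (index_enum T) F chi = E F.
  rewrite -(expect_averages (index_enum T)) -[LHS](expect_cst p).
  by apply: eq_expect => chi'; apply: averages_indep => u; rewrite mem_index_enum.
suff -> : E (fun chi => averages (index_enum T) F chi ^+ 2) = E F ^+ 2 by [].
by rewrite -[RHS](expect_cst p); apply: eq_expect => chi; rewrite cst.
Qed.

End RealExpectation.

Section ComplexExpectation.
Variables (R : rcfType) (p : R).
Hypothesis p01 : 0 <= p <= 1.
Implicit Type F : config -> R[i].
Local Notation E := (expect p).
Local Notation EC := (expect (p%:C)%C).

Lemma weight_complex chi : weight (p%:C)%C chi = ((weight p chi)%:C)%C.
Proof.
rewrite /weight rmorph_prod; apply: eq_bigr => t _ /=.
by case: ifP => _ //; rewrite -[RHS]/(real_complex R _) rmorphB rmorph1.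
Qed.

Lemma Re_expect F : complex.Re (EC F) = E (fun chi => complex.Re (F chi)).
Proof.
rewrite Re_sum; apply: eq_bigr => chi _; rewrite weight_complex.
by case: (F chi) => a b /=; rewrite mul0r subr0.
Qed.

Lemma Im_expect F : complex.Im (EC F) = E (fun chi => complex.Im (F chi)).
Proof.
rewrite Im_sum; apply: eq_bigr => chi _; rewrite weight_complex.
by case: (F chi) => a b /=; rewrite mul0r addr0.
Qed.

Lemma cabs_expect F : cabs (EC F) <= E (fun chi => cabs (F chi)).
Proof.
apply: le_trans (cabs_sum _ _ _) _; apply: ler_sum => chi _.
by rewrite cabsM weight_complex cabs_real ger0_norm // weight_ge0.
Qed.

(** The variance of a complex variable, the sum of those of its real and imaginary
    parts. *)
Definition cvar F : R := E (fun chi => cabs (F chi - EC F) ^+ 2).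

Lemma cvarE F : cvar F = E (fun chi => cabs (F chi) ^+ 2) - cabs (EC F) ^+ 2.
Proof.
rewrite sqr_cabs Re_expect Im_expect.
set a := E (fun chi => complex.Re (F chi)).
set b := E (fun chi => complex.Im (F chi)).
have -> : cvar F = E (fun chi => cabs (F chi) ^+ 2 +
  ((- (2 * a)) * complex.Re (F chi) + ((- (2 * b)) * complex.Im (F chi)
    + (a ^+ 2 + b ^+ 2)))).
  apply: eq_expect => chi; rewrite !sqr_cabs.
  have : complex.Re (EC F) = a by rewrite Re_expect.
  have : complex.Im (EC F) = b by rewrite Im_expect.
  clearbody a b.
  by case: (EC F) => x y /= -> ->; case: (F chi) => x' y' /=; ring.
apply: etrans (expectD _ _ _) _; congr (_ + _).
apply: etrans (expectD _ _ _) _; rewrite expectZ -/a.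
apply: etrans (congr1 (+%R _) (expectD _ _ _)) _; rewrite expectZ -/b expect_cst.
by clearbody a b; ring.
Qed.

(** The Efron-Stein inequality for the real and for the imaginary part. *)
Lemma cvar_le F (D : T -> config -> R) :
  (forall t chi, cabs (F (upd chi t true) - F (upd chi t false)) ^+ 2 <= D t chi) ->
  cvar F <= p * (1 - p) * \sum_t E (D t).
Proof.
move=> FD; rewrite cvarE.
have -> : E (fun chi => cabs (F chi) ^+ 2) =
    E (fun chi => complex.Re (F chi) ^+ 2) + E (fun chi => complex.Im (F chi) ^+ 2).
  by rewrite -expectD; apply: eq_expect => chi; rewrite sqr_cabs.
rewrite sqr_cabs Re_expect Im_expect.
have h1 := efron_stein p01 (fun chi => complex.Re (F chi)).
have h2 := efron_stein p01 (fun chi => complex.Im (F chi)).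
have q0 : 0 <= p * (1 - p).
  by case/andP: p01 => p0 p1; rewrite mulr_ge0 ?subr_ge0.
have : p * (1 - p) * (\sum_t sqr_diff p (fun chi => complex.Re (F chi)) t +
     \sum_t sqr_diff p (fun chi => complex.Im (F chi)) t) <=
    p * (1 - p) * \sum_t E (D t).
  rewrite ler_wpM2l // -big_split /=; apply: ler_sum => t _.
  rewrite /sqr_diff -expectD; apply: le_expect => // chi.
  apply: le_trans (FD t chi); rewrite sqr_cabs.
  by case: (F (upd _ _ _)) => a b; case: (F (upd _ _ _)) => a' b'.
lra.
Qed.

Lemma expect_chebyshev F e : 0 < e ->
  \sum_(chi | e <= cabs (F chi - EC F)) weight p chi <= cvar F / e ^+ 2.
Proof.
move=> e0; rewrite ler_pdivlMr ?exprn_gt0 // mulr_suml /cvar /expect.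
rewrite [leRHS](bigID (fun chi => e <= cabs (F chi - EC F))) /=.
rewrite -[leLHS]addr0 lerD //.
  apply: ler_sum => chi eF; rewrite ler_wpM2l ?weight_ge0 //.
  by rewrite ler_pXn2r ?nnegrE ?cabs_ge0 ?(ltW e0).
by apply: sumr_ge0 => chi _; rewrite mulr_ge0 ?weight_ge0 ?sqr_ge0.
Qed.

(** The covariance is the mean of a product of centred variables, bounded by the
    arithmetic-geometric inequality. *)
Lemma cabs_cov F F' :
  cabs (EC (fun chi => F chi * F' chi) - EC F * EC F') <= (cvar F + cvar F') / 2.
Proof.
have -> : EC (fun chi => F chi * F' chi) - EC F * EC F' =
    EC (fun chi => (F chi - EC F) * (F' chi - EC F')).
  set a := EC F; set b := EC F'.
  have -> : EC (fun chi => (F chi - a) * (F' chi - b)) =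
      EC (fun chi => F chi * F' chi + ((- b) * F chi + ((- a) * F' chi + a * b))).
    by apply: eq_expect => chi; clearbody a b; ring.
  apply: esym; apply: etrans (expectD _ _ _) _; congr (_ + _).
  apply: etrans (expectD _ _ _) _; rewrite expectZ -/a.
  apply: etrans (congr1 (+%R _) (expectD _ _ _)) _.
  by rewrite expect_cst expectZ -/b; clearbody a b; ring.
apply: le_trans (cabs_expect _) _.
rewrite mulrC /cvar -expectD -expectZ; apply: le_expect => // chi.
by rewrite cabsM; have := mul_le_half_sqr (cabs (F chi - EC F)) (cabs (F' chi - EC F')); lra.
Qed.

End ComplexExpectation.

End BernoulliProduct.

(** * Random matrices carried by a linear hypergraph *)

Section LinearHypergraph.
Variables (R : rcfType) (N d n D : nat) (T : finType).
(** A hypergraph on [N] points with blocks [blk t] of [d + 1] points, every point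
    lying in [D] blocks; it is linear: two points share at most one block. The
    signs [h] weight the pairs of points of a common block. The integer [n], which
    will be within [d] of [D], serves as normalisation: for the facets of the
    (d+1)-subsets of an n-set, [D = n - d]. *)
Variables (blk : T -> {set 'I_N}) (h : 'I_N -> 'I_N -> R).
Hypothesis h_sym : forall a b, h a b = h b a.
Hypothesis h_le : forall a b, `|h a b| <= (a != b)%:R.
Hypothesis h_sqr : forall t a b, a \in blk t -> b \in blk t -> a != b ->
  h a b ^+ 2 = 1.
Hypothesis blk_card : forall t, #|blk t| = d.+1.
Hypothesis blk_deg : forall a, #|[set t | a \in blk t]%SET| = D.
Hypothesis blk_lin : forall t t' a b, a != b ->
  a \in blk t -> b \in blk t -> a \in blk t' -> b \in blk t' -> t = t'.

Local Notation MtoC := (map_mx (real_complex R)).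
Local Notation k := (d.+1%:R : R).

Let k1 : 1 <= k. Proof. by rewrite ler1n. Qed.
Let k0 : 0 <= k. Proof. exact: ler0n. Qed.

Definition block_mx_of t : 'M[R]_N :=
  \matrix_(a, b) (((a \in blk t) && (b \in blk t))%:R * h a b).
Local Notation Ht := block_mx_of.

Lemma block_mx_sym t : (Ht t)^T = Ht t.
Proof. by apply/matrixP => a b; rewrite !mxE andbC h_sym. Qed.

Lemma mul_blockE t (X Y : 'M[R[i]]_N) a b :
  (X *m MtoC (Ht t) *m Y) a b =
  \sum_(c' in blk t) \sum_(c in blk t) X a c * ((h c c')%:C)%C * Y c' b.
Proof.
rewrite mxE [RHS]big_mkcond /=; apply: eq_bigr => c' _.
rewrite mxE mulr_suml; case: ifPn => tc'.
  rewrite [RHS]big_mkcond /=; apply: eq_bigr => c _.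
  by rewrite !mxE tc' andbT; case: ifP => _; rewrite ?mul1r // mul0r mulr0 mul0r.
by apply: big1 => c _; rewrite !mxE (negbTE tc') andbF mul0r mulr0 mul0r.
Qed.

Lemma cabs_mul_block t (X Y : 'M[R[i]]_N) a b :
  cabs ((X *m MtoC (Ht t) *m Y) a b) <=
  \sum_(c' in blk t) \sum_(c in blk t | c != c') cabs (X a c) * cabs (Y c' b).
Proof.
rewrite mul_blockE; apply: le_trans (cabs_sum _ _ _) _; apply: ler_sum => c' _.
apply: le_trans (cabs_sum _ _ _) _; rewrite [leRHS]big_mkcondr /=.
apply: ler_sum => c _; rewrite !cabsM cabs_real.
have := h_le c c'; case: (c != c') => /= hc.
  by rewrite mulrAC ler_piMr // mulr_ge0 ?cabs_ge0.
have /eqP -> : `|h c c'| == 0 by rewrite eq_le hc normr_ge0.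
by rewrite mulr0 mul0r.
Qed.

(** Linearity: no pair of points is counted twice. *)
Lemma sum_block_pairs_le (f : 'I_N -> 'I_N -> R) : (forall a b, 0 <= f a b) ->
  \sum_t \sum_(b in blk t) \sum_(a in blk t | a != b) f a b <=
  \sum_b \sum_a f a b.
Proof.
move=> f0.
have -> : \sum_t \sum_(b in blk t) \sum_(a in blk t | a != b) f a b =
  \sum_b \sum_a \sum_(t | [&& b \in blk t, a \in blk t & a != b]) f a b.
  rewrite (exchange_big_dep xpredT) //=; apply: eq_bigr => b _.
  by rewrite (exchange_big_dep xpredT).
apply: ler_sum => b _; apply: ler_sum => a _.
have [t /and3P[bt at_ ab]|none] := pickP (fun t => [&& b \in blk t, a \in blk t & a != b]).
  rewrite (big_pred1 t) // => t' /=; apply/and3P/eqP => [[bt' at' _]|-> //].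
  exact: (blk_lin ab).
by rewrite big_pred0.
Qed.

Lemma sum_block_deg (f : 'I_N -> R) :
  \sum_t \sum_(a in blk t) f a = D%:R * \sum_a f a.
Proof.
rewrite (exchange_big_dep xpredT) //= mulr_sumr; apply: eq_bigr => a _.
rewrite sumr_const mulr_natl -(blk_deg a); congr (_ *+ _).
by rewrite cardsE.
Qed.

Lemma sum_block_rem t b (f : R) : b \in blk t ->
  \sum_(a in blk t | a != b) f = d%:R * f.
Proof.
move=> bt; have dE : #|blk t :\ b| = d.
  by have := cardsD1 b (blk t); rewrite bt blk_card => -[].
rewrite (eq_bigl (mem (blk t :\ b))) => [|a]; last by rewrite !inE andbC.
by rewrite sumr_const dE mulr_natl.
Qed.

Lemma sum_block_neighbours (f : 'I_N -> R) :
  \sum_t \sum_(a in blk t) \sum_(b in blk t | b != a) f b =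
  (d * D)%:R * \sum_b f b.
Proof.
rewrite natrM -mulrA -sum_block_deg mulr_sumr; apply: eq_bigr => t _.
rewrite (exchange_big_dep (mem (blk t))) /=; last by move=> ? ? _ /andP[].
rewrite mulr_sumr; apply: eq_bigr => b bt.
rewrite -(sum_block_rem _ bt); apply: eq_bigl => a.
by rewrite bt eq_sym.
Qed.

Lemma card_blocks_le : (#|T| <= N * D)%N.
Proof.
have -> : (N * D = \sum_(a < N) #|[set t | a \in blk t]%SET|)%N.
  by rewrite (eq_bigr (fun=> D)) // sum_nat_const card_ord.
rewrite -sum1_card (eq_bigr (fun a => \sum_(t | a \in blk t) 1))%N; last first.
  by move=> a _; rewrite sum1_card cardsE.
rewrite (exchange_big_dep xpredT) //=; apply: leq_sum => t _.
by rewrite sum1_card blk_card.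
Qed.

Lemma sum_block_cst t (x : R) : \sum_(c in blk t) x = k * x.
Proof. by rewrite sumr_const blk_card mulr_natl. Qed.

Lemma sum_ord_cst (x : R) : \sum_(a < N) x = N%:R * x.
Proof. by rewrite sumr_const card_ord mulr_natl. Qed.

Section RandomMatrix.
Variables (p s e : R).
Hypotheses (p01 : 0 <= p <= 1) (s0 : 0 < s) (s1 : s <= 1) (e2 : 2 <= e).
(* [s] is the scale at which every row of the random matrix has variance about 1. *)
Hypothesis sE : s ^+ 2 * (p * (1 - p)) * (d * n)%:R = 1.
Hypotheses (Dn : (D <= n)%N) (nD : (n - d <= D)%N).

Local Notation E := (expect p).
Local Notation EC := (expect (p%:C)%C).
Local Notation config := {ffun T -> bool}.

Definition centred_mx (chi : config) : 'M[R]_N :=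
  s *: \sum_t ((chi t)%:R - p) *: Ht t.
Local Notation H := centred_mx.
Local Notation G := (fun chi => resolvent (H chi) e).

Let e0 : 0 < e. Proof. by apply: lt_le_trans e2. Qed.
Let ie0 : 0 <= e^-1. Proof. by rewrite invr_ge0 ltW. Qed.
Let ie_half : e^-1 <= 1 / 2. Proof. by rewrite div1r lef_pV2 ?posrE. Qed.

Let q01 : 0 <= p * (1 - p) <= 1.
Proof.
case/andP: p01 => p0 p1; rewrite mulr_ge0 ?subr_ge0 //=.
by rewrite mulr_ile1 ?subr_ge0 // lerBlDr lerDl.
Qed.

Let dn0 : 0 < (d * n)%:R :> R.
Proof.
rewrite lt0r ler0n andbT; apply/eqP => z.
by move: sE; rewrite z mulr0 => /eqP; rewrite eq_sym oner_eq0.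
Qed.
Let d0 : 0 < d%:R :> R.
Proof. by move: dn0; rewrite !ltr0n muln_gt0 => /andP[]. Qed.
Let n0 : 0 < n%:R :> R.
Proof. by move: dn0; rewrite !ltr0n muln_gt0 => /andP[]. Qed.

Let sq : p * (1 - p) * s ^+ 2 = (d%:R * n%:R)^-1.
Proof.
apply: (mulIf (lt0r_neq0 dn0)); rewrite -natrM mulVf ?gt_eqF //.
by rewrite [_ * s ^+ 2]mulrC.
Qed.

Let inv_n_le : n%:R^-1 <= d%:R * s ^+ 2.
Proof.
rewrite -[leLHS]mulr1 ler_pdivrMl // -[leLHS]sE natrM.
case/andP: q01 => q0 q1.
have -> : n%:R * (d%:R * s ^+ 2) = s ^+ 2 * 1 * (d%:R * n%:R) by ring.
by rewrite ler_wpM2r ?mulr_ge0 ?ler0n // ler_wpM2l ?sqr_ge0.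
Qed.

Lemma centred_mx_sym chi : (H chi)^T = H chi.
Proof.
rewrite /centred_mx linearZ linear_sum /=; congr (_ *: _).
by apply: eq_bigr => t _; rewrite linearZ /= block_mx_sym.
Qed.

Lemma centred_mx_upd chi t b :
  H chi - H (upd chi t b) = (s * ((chi t)%:R - b%:R)) *: Ht t.
Proof.
rewrite /centred_mx -scalerBr -sumrB (bigD1 t) //= big1 ?addr0.
  by rewrite -scalerBl updE -scalerA; congr (_ *: (_ *: _)); ring.
by move=> u ut; rewrite updNE // subrr.
Qed.

Lemma diff_resolvent chi t :
  G (upd chi t true) - G (upd chi t false) =
  - (s%:C)%C *: (G (upd chi t false) *m MtoC (Ht t) *m G (upd chi t true)).
Proof.
rewrite resolvent_identity ?centred_mx_sym //.
have := centred_mx_upd (upd chi t false) t true.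
rewrite upd_upd updE => ->; rewrite sub0r mulrN1 map_mxZ /= rmorphN /=.
by rewrite -scalemxAr -scalemxAl.
Qed.

Lemma resolvent_le1 chi a b : cabs (G chi a b) <= 1.
Proof.
apply: le_trans (resolvent_entry_le (centred_mx_sym chi) e0 a b) _.
by have := ie_half; lra.
Qed.

Lemma resolvent_row_le1 chi a : \sum_b cabs (G chi a b) ^+ 2 <= 1.
Proof.
apply: le_trans (resolvent_row_le (centred_mx_sym chi) e0 a) _.
rewrite expr_le1 //; by have := ie_half; lra.
Qed.

Definition row_mass chi t a : R := \sum_(c in blk t) cabs (G chi a c).

Lemma row_mass_ge0 chi t a : 0 <= row_mass chi t a.
Proof. by apply: sumr_ge0 => c _; exact: cabs_ge0. Qed.

Lemma row_mass_le chi t a : row_mass chi t a <= k.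
Proof.
apply: (@le_trans _ _ (\sum_(c in blk t) 1)).
  by apply: ler_sum => c _; exact: resolvent_le1.
by rewrite sumr_const blk_card.
Qed.

(** Resampling one block is a perturbation of size [s] supported on that block, so
    the resolvent identity gains a factor [row_mass]. *)
Lemma resolvent_upd_le chi t b a c :
  cabs (G (upd chi t b) a c - G chi a c) <= s * (k * row_mass chi t a).
Proof.
have -> : G (upd chi t b) a c - G chi a c =
    ((s * ((chi t)%:R - b%:R))%:C)%C *
    (G chi *m MtoC (Ht t) *m G (upd chi t b)) a c.
  have := resolvent_identity (centred_mx_sym chi) (centred_mx_sym (upd chi t b)) e0.
  rewrite centred_mx_upd map_mxZ -scalemxAr -scalemxAl => /matrixP/(_ a c).
  by rewrite mxE [X in _ + X]mxE [RHS]mxE.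
rewrite cabsM cabs_real normrM (ger0_norm (ltW s0)) -mulrA.
rewrite ler_wpM2l ?(ltW s0) //.
have le1 : `|(chi t)%:R - b%:R : R| <= 1.
  by case: (chi t); case: b; rewrite ?subrr ?normr0 ?sub0r ?subr0 ?normrN ?normr1.
apply: le_trans (ler_wpM2r (cabs_ge0 _) le1) _; rewrite mul1r.
apply: le_trans (cabs_mul_block _ _ _ _ _) _.
rewrite -(blk_card t) mulr_natl -sumr_const; apply: ler_sum => c' _.
rewrite big_mkcondr; apply: ler_sum => x _.
case: ifP => _; last exact: cabs_ge0.
by rewrite ler_piMr ?cabs_ge0 ?resolvent_le1.
Qed.

(** Each of the at most [N D] blocks moves the trace by at most [s k^2]: the
    difference is the trace of [H_t] against a product of two resolvents, whose
    entries are bounded by the Ward identity. The factor [s^2 p (1 - p)] makes up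
    for the degree [D]. *)
Lemma cvar_mxtrace : cvar p (fun chi => \tr (G chi)) <= N%:R * k ^+ 4.
Proof.
apply: le_trans (cvar_le p01 (D := fun _ _ => s ^+ 2 * k ^+ 4) _) _.
  move=> t chi; rewrite -linearB /= diff_resolvent linearZ /= cabsM cabsN.
  rewrite cabs_real ger0_norm ?(ltW s0) // exprMn ler_wpM2l ?sqr_ge0 //.
  rewrite (exprM k 2 2 : k ^+ 4 = _) ler_pXn2r ?nnegrE ?cabs_ge0 ?exprn_ge0 //.
  rewrite -mulmxA mxtrace_mulC -[_ *m G _]mul1mx !mulmxA mul1mx -mulmxA.
  rewrite /mxtrace (eq_bigr (fun i => \sum_j MtoC (Ht t) i j *
     (G (upd chi t true) *m G (upd chi t false)) j i)) => [|i _]; last by rewrite mxE.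
  apply: le_trans (cabs_sum _ _ _) _.
  rewrite expr2 -{1}(blk_card t) mulr_natl -sumr_const [leRHS]big_mkcond /=.
  apply: ler_sum => i _; apply: le_trans (cabs_sum _ _ _) _.
  case: ifPn => it; last first.
    apply: sumr_le0 => j _; rewrite !mxE (negbTE it) mul0r mul0r cabs0 //.
  rewrite -(blk_card t) -sumr_const [leRHS]big_mkcond /=.
  apply: ler_sum => j _; rewrite cabsM; case: ifPn => jt; last first.
    by rewrite !mxE (negbTE jt) andbF mul0r cabs0 mul0r.
  have := resolvent_prod_le j i (centred_mx_sym (upd chi t true))
    (centred_mx_sym (upd chi t false)) e0.
  have : cabs (MtoC (Ht t) i j) <= 1.
    rewrite !mxE it jt mul1r cabs_real; apply: le_trans (h_le _ _) _.
    by case: (_ != _).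
  have : e^-1 ^+ 2 <= 1 by rewrite expr_le1 //; have := ie_half; lra.
  move=> u1 u2 u3; apply: mulr_ile1; rewrite ?cabs_ge0 //.
  exact: le_trans u3 u1.
under eq_bigr do rewrite expect_cst.
rewrite (_ : \sum_(t : T) _ = #|T|%:R * (s ^+ 2 * k ^+ 4)); last first.
  by rewrite sumr_const mulr_natl.
have -> : p * (1 - p) * (#|T|%:R * (s ^+ 2 * k ^+ 4)) =
    #|T|%:R / (d%:R * n%:R) * k ^+ 4 by rewrite -sq; ring.
rewrite ler_wpM2r ?exprn_ge0 // ler_pdivrMr ?mulr_gt0 //.
apply: (@le_trans _ _ (N%:R * n%:R)).
  by rewrite -natrM ler_nat; apply: leq_trans card_blocks_le _; rewrite leq_mul2l Dn orbT.
rewrite ler_wpM2l ?ler0n // ler_peMl ?ler0n //.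
by move: d0; rewrite ltr0n ler1n.
Qed.

(** What is lost, per unit of [row_mass ^+ 2], when both resolvents in
    [G H_t G'] are replaced by the one before resampling. *)
Definition block_err : R := 2 * k ^+ 2 * s + k ^+ 4 * s ^+ 2.
Local Notation kap := block_err.

Let kap_ge0 : 0 <= kap.
Proof. by rewrite addr_ge0 // ?mulr_ge0 ?exprn_ge0 // ltW. Qed.

(** The influence of the block [t] on [G a a] is quadratic in the entries of row [a]
    inside the block. By linearity of the hypergraph the squares of the products of
    distinct entries sum to at most the square of the row sum, which the Ward
    identity bounds by 1. *)
Lemma cvar_resolvent_diag a :
  cvar p (fun chi => G chi a a) <= 2 * k ^+ 2 / n%:R + 2 * k ^+ 2 * kap ^+ 2.
Proof.
pose pairs chi t := \sum_(c' in blk t) \sum_(c in blk t | c != c')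
  cabs (G chi a c) * cabs (G chi a c').
pose F t chi := s ^+ 2 * (2 * pairs chi t ^+ 2
    + 2 * kap ^+ 2 * (row_mass chi t a ^+ 2) ^+ 2).
apply: le_trans (cvar_le p01 (D := F) _) _.
  move=> t chi; have := diff_resolvent chi t => /matrixP/(_ a a).
  rewrite mxE [X in _ + X]mxE [RHS]mxE => ->.
  rewrite cabsM cabsN cabs_real ger0_norm ?(ltW s0) //.
  rewrite exprMn /F ler_wpM2l ?sqr_ge0 //.
  set r := row_mass chi t a; have r0 : 0 <= r := row_mass_ge0 chi t a.
  have sk0 : 0 <= s * (k * r) by rewrite !mulr_ge0 // ltW.
  have entry b c : cabs (G (upd chi t b) a c) <= cabs (G chi a c) + s * (k * r).
    rewrite -[G (upd chi t b) a c](subrK (G chi a c)) addrC.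
    by apply: le_trans (cabsD _ _) _; rewrite lerD2l resolvent_upd_le.
  set L := cabs _.
  have L1 : L <= pairs chi t + kap * r ^+ 2.
    apply: le_trans (cabs_mul_block _ _ _ _ _) _.
    apply: (@le_trans _ _ (pairs chi t + \sum_(c' in blk t) \sum_(c in blk t)
       (s * (k * r) * (cabs (G chi a c) + cabs (G chi a c')) + (s * (k * r)) ^+ 2))).
      rewrite -big_split /=; apply: ler_sum => c' _.
      apply: (@le_trans _ _ (\sum_(c in blk t | c != c')
         cabs (G chi a c) * cabs (G chi a c') + \sum_(c in blk t | c != c')
       (s * (k * r) * (cabs (G chi a c) + cabs (G chi a c')) + (s * (k * r)) ^+ 2))).
        rewrite -big_split /=; apply: ler_sum => c _.
        rewrite (resolvent_symE _ (centred_mx_sym _) c' a).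
        apply: (@le_trans _ _ ((cabs (G chi a c) + s * (k * r)) *
           (cabs (G chi a c') + s * (k * r)))).
          by apply: ler_pM; rewrite ?cabs_ge0.
        by rewrite le_eqVlt; apply/orP; left; apply/eqP; ring.
      rewrite lerD2l [leLHS]big_mkcondr /=; apply: ler_sum => c _.
      by case: ifP => // _; rewrite addr_ge0 ?sqr_ge0 // mulr_ge0 ?addr_ge0 ?cabs_ge0.
    rewrite lerD2l.
    rewrite (eq_bigr (fun c' => s * (k * r) * (r + k * cabs (G chi a c'))
       + k * (s * (k * r)) ^+ 2)); last first.
      move=> c' _; by rewrite big_split /= -mulr_sumr big_split /= !sum_block_cst.
    rewrite big_split /= -mulr_sumr big_split /= -mulr_sumr !sum_block_cst.
    rewrite -/(row_mass chi t a) -/r.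
    by rewrite le_eqVlt; apply/orP; left; apply/eqP; rewrite /block_err; ring.
  have L0 : 0 <= L := cabs_ge0 _.
  have : L ^+ 2 <= (pairs chi t + kap * r ^+ 2) ^+ 2.
    by rewrite ler_pXn2r ?nnegrE // (le_trans L0).
  have := sqr_ge0 (pairs chi t - kap * r ^+ 2); lra.
rewrite -expect_sum; set V := (X in _ <= X).
suff VE : forall chi, \sum_t F t chi <= s ^+ 2 * (2 * k ^+ 2 + 2 * k ^+ 2 * kap ^+ 2 * n%:R).
  have q0 : 0 <= p * (1 - p) by case/andP: q01.
  apply: le_trans (ler_wpM2l q0 (expect_le p01 VE)) _.
  rewrite mulrA sq ler_pdivrMl ?mulr_gt0 // /V.
  rewrite [leRHS]mulrDr.
  have -> : d%:R * n%:R * (2 * k ^+ 2 / n%:R) = d%:R * (2 * k ^+ 2).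
    by field; rewrite gt_eqF.
  have -> : d%:R * n%:R * (2 * k ^+ 2 * kap ^+ 2) = d%:R * (2 * k ^+ 2 * kap ^+ 2 * n%:R).
    by ring.
  have d1 : 1 <= d%:R :> R by move: d0; rewrite ltr0n ler1n.
  by rewrite lerD // ler_peMl ?mulr_ge0 ?exprn_ge0 ?ler0n ?sqr_ge0.
move=> chi; rewrite -mulr_sumr ler_wpM2l ?sqr_ge0 // big_split /= -!mulr_sumr.
have row1 := resolvent_row_le1 chi a.
have sqr_c_ge0 c : 0 <= cabs (G chi a c) ^+ 2 by exact: sqr_ge0.
rewrite lerD //.
  rewrite ler_wpM2l //.
  apply: (@le_trans _ _ (k ^+ 2 * \sum_t \sum_(c' in blk t)
     \sum_(c in blk t | c != c') cabs (G chi a c) ^+ 2 * cabs (G chi a c') ^+ 2)).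
    rewrite mulr_sumr; apply: ler_sum => t _.
    apply: le_trans (sqr_sum_le _ _) _; rewrite blk_card expr2 -mulrA.
    rewrite ler_wpM2l // mulr_sumr; apply: ler_sum => c' _.
    have := sqr_sum_le (blk t :\ c') (fun c => cabs (G chi a c) * cabs (G chi a c')).
    have e1 (f : 'I_N -> R) : \sum_(c in blk t :\ c') f c =
        \sum_(c in blk t | c != c') f c.
      by apply: eq_bigl => c; rewrite !inE andbC.
    rewrite !e1 => le1; apply: le_trans le1 _.
    under eq_bigr do rewrite exprMn.
    rewrite ler_wpM2r ?sumr_ge0 // => [c _|]; first by rewrite mulr_ge0.
    rewrite ler_nat -(blk_card t); apply: subset_leq_card; exact: subD1set.
  rewrite -[leRHS]mulr1 ler_wpM2l ?exprn_ge0 //.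
  apply: le_trans (sum_block_pairs_le _) _; first by move=> *; rewrite mulr_ge0.
  rewrite exchange_big /=.
  under eq_bigr do rewrite -mulr_sumr.
  rewrite -mulr_suml mulr_ile1 ?sumr_ge0 //.
have -> : 2 * k ^+ 2 * kap ^+ 2 * n%:R = 2 * kap ^+ 2 * (k ^+ 2 * n%:R) by ring.
rewrite ler_wpM2l ?mulr_ge0 ?sqr_ge0 //.
apply: (@le_trans _ _ (k ^+ 2 * \sum_t \sum_(c in blk t) cabs (G chi a c) ^+ 2)).
  rewrite mulr_sumr; apply: ler_sum => t _.
  set S := \sum_(c in blk t) _.
  have S0 : 0 <= S by apply: sumr_ge0.
  have S1 : S <= 1.
    apply: le_trans row1; rewrite [leRHS](bigID (mem (blk t))) /= lerDl.
    by apply: sumr_ge0.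
  have rS : row_mass chi t a ^+ 2 <= k * S.
    by apply: le_trans (sqr_sum_le _ _) _; rewrite blk_card.
  apply: (@le_trans _ _ ((k * S) ^+ 2)).
    by rewrite ler_pXn2r ?nnegrE ?sqr_ge0 ?mulr_ge0.
  by rewrite exprMn ler_wpM2l ?exprn_ge0 // expr2 ler_piMr.
rewrite sum_block_deg ler_wpM2l ?exprn_ge0 // -[leRHS]mulr1.
by apply: ler_pM; rewrite ?ler0n ?ler_nat ?sumr_ge0.
Qed.

Lemma resolvent_upd_le2 chi t b a c :
  cabs (G (upd chi t b) a c - G chi a c) <= s * k ^+ 2.
Proof.
apply: le_trans (resolvent_upd_le _ _ _ _ _) _.
by rewrite ler_wpM2l ?(ltW s0) // expr2 ler_wpM2l // row_mass_le.
Qed.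

(** The term that integration by parts produces, in which a block occurs twice. *)
Definition double_block t chi a : R[i] :=
  (MtoC (Ht t) *m (G (upd chi t false) *m MtoC (Ht t) *m G (upd chi t true))) a a.

Definition off_mass t chi : R :=
  \sum_(b in blk t) \sum_(c in blk t | c != b) cabs (G chi c b).

Lemma double_block_out t chi a : a \notin blk t -> double_block t chi a = 0.
Proof.
by move=> ta; rewrite /double_block mxE big1 // => b _;
  rewrite !mxE (negbTE ta) mul0r mul0r.
Qed.

(** In the expansion over paths [a - b - c - c' - a] inside the block the paths with
    [c = b] and [c' = a] carry the weight [h a b ^+ 2 = 1]; all others contain an
    off-diagonal entry of the resolvent. *)
Lemma double_block_approx t chi a : a \in blk t ->
  cabs (double_block t chi a - \sum_(b in blk t | b != a) G chi b b * G chi a a) <=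
  2 * k ^+ 5 * s + k * off_mass t chi +
  k ^+ 2 * \sum_(c in blk t | c != a) cabs (G chi c a).
Proof.
move=> ta.
have -> : double_block t chi a = \sum_(b in blk t) ((h a b)%:C)%C *
    \sum_(c' in blk t) \sum_(c in blk t)
      G (upd chi t false) b c * ((h c c')%:C)%C * G (upd chi t true) c' a.
  rewrite /double_block mxE [RHS]big_mkcond /=; apply: eq_bigr => b _.
  rewrite mul_blockE !mxE ta /=.
  by case: ifP => _; rewrite ?mul1r // !mul0r.
have -> : \sum_(b in blk t | b != a) G chi b b * G chi a a =
    \sum_(b in blk t) ((h a b)%:C)%C * \sum_(c' in blk t) \sum_(c in blk t)
    ((c == b) && (c' == a))%:R * (G chi b c * ((h c c')%:C)%C * G chi c' a).
  rewrite big_mkcondr; apply: eq_bigr => b tb.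
  rewrite (bigD1 a) //= [X in _ + X]big1 ?addr0 => [|c' /andP[_ c'a]]; last first.
    by apply: big1 => c _; rewrite (negbTE c'a) andbF mul0r.
  rewrite (bigD1 b) //= [X in _ + X]big1 ?addr0 => [|c /andP[_ cb]]; last first.
    by rewrite (negbTE cb) mul0r.
  rewrite !eqxx mul1r (h_sym b a).
  transitivity (G chi b b * G chi a a * ((h a b ^+ 2)%:C)%C); last first.
    by rewrite rmorphXn /=; ring.
  case: ifPn => ba; first by rewrite (h_sqr ta tb) 1?eq_sym // mulr1.
  have := h_le a b; rewrite eq_sym (negbTE ba) normr_le0 => /eqP ->.
  by rewrite expr0n mulr0.
rewrite -sumrB.
apply: le_trans (cabs_sum _ _ _) _.
have habs x y : `|h x y| <= 1.
  by apply: le_trans (h_le _ _) _; case: (_ != _).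
apply: (@le_trans _ _ (\sum_(b in blk t) \sum_(c' in blk t) \sum_(c in blk t)
   (2 * k ^+ 2 * s + (c != b)%:R * cabs (G chi c b) +
    (c' != a)%:R * cabs (G chi c' a)))).
  apply: ler_sum => b _; rewrite -mulrBr cabsM cabs_real.
  apply: le_trans (ler_wpM2r (cabs_ge0 _) (habs _ _)) _; rewrite mul1r -sumrB.
  apply: le_trans (cabs_sum _ _ _) _; apply: ler_sum => c' _.
  rewrite -sumrB; apply: le_trans (cabs_sum _ _ _) _; apply: ler_sum => c _.
  set x := G _ b c; set y := G _ c' a; set x0 := G _ b c; set y0 := G _ c' a.
  have -> : x * ((h c c')%:C)%C * y -
      ((c == b) && (c' == a))%:R * (x0 * ((h c c')%:C)%C * y0) =
      ((h c c')%:C)%C * ((x - x0) * y + x0 * (y - y0)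
        + (1 - ((c == b) && (c' == a))%:R) * (x0 * y0)).
    by clearbody x y x0 y0; ring.
  rewrite cabsM cabs_real.
  apply: le_trans (ler_wpM2r (cabs_ge0 _) (habs _ _)) _; rewrite mul1r.
  apply: le_trans (cabsD _ _) _; rewrite -addrA; apply: lerD.
    apply: le_trans (cabsD _ _) _; rewrite !cabsM.
    have -> : 2 * k ^+ 2 * s = s * k ^+ 2 * 1 + 1 * (s * k ^+ 2) by ring.
    by apply: lerD; apply: ler_pM; rewrite ?cabs_ge0 // ?resolvent_le1 //
      resolvent_upd_le2.
  have x1 : cabs x0 <= 1 by exact: resolvent_le1.
  have y1 : cabs y0 <= 1 by exact: resolvent_le1.
  have x0' := cabs_ge0 x0; have y0' := cabs_ge0 y0.
  have -> : cabs (G chi c b) = cabs x0.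
    by rewrite /x0 (resolvent_symE _ (centred_mx_sym _)).
  rewrite -/y0 !cabsM.
  have [_|cb] := eqVneq c b; have [_|ca] := eqVneq c' a;
    rewrite /= ?subrr ?subr0 ?cabs0 ?cabs1 ?mul0r ?mul1r ?add0r ?addr0 //.
  - by rewrite ler_piMl.
  - by rewrite ler_piMr.
  - by apply: (@le_trans _ _ (cabs x0)); [rewrite ler_piMr|rewrite lerDl].
rewrite (eq_bigr (fun b => k * (k * (2 * k ^+ 2 * s)
   + \sum_(c in blk t | c != b) cabs (G chi c b))
   + k * \sum_(c' in blk t | c' != a) cabs (G chi c' a))); last first.
  move=> b _; rewrite (eq_bigr (fun c' => k * (2 * k ^+ 2 * s)
   + \sum_(c in blk t | c != b) cabs (G chi c b)
   + k * ((c' != a)%:R * cabs (G chi c' a)))); last first.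
    move=> c' _; rewrite !big_split /= !sum_block_cst.
    congr (_ + _ + _); rewrite [RHS]big_mkcondr /=; apply: eq_bigr => c _.
    by case: (_ != _); rewrite ?mul1r ?mul0r.
  rewrite !big_split /= -[X in _ + X = _]mulr_sumr !sum_block_cst.
  rewrite [in RHS]mulrDr; congr (_ + _ + k * _).
  rewrite [RHS]big_mkcondr /=; apply: eq_bigr => c _.
  by case: (_ != _); rewrite ?mul1r ?mul0r.
rewrite big_split /= -mulr_sumr big_split /= !sum_block_cst.
rewrite -/(off_mass t chi).
by rewrite le_eqVlt; apply/orP; left; apply/eqP; ring.
Qed.

Let Dn_R : D%:R <= n%:R :> R. Proof. by rewrite ler_nat. Qed.

Let ds2n : 1 <= n%:R * (d%:R * s ^+ 2).
Proof. by rewrite -ler_pdivrMl // mulr1. Qed.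

(** The arithmetic-geometric inequality with weight [s] replaces the entries by their
    squares, to which linearity of the hypergraph and the Ward identity apply. *)
Lemma sum_off_mass chi : \sum_t off_mass t chi <= N%:R * n%:R * d%:R * s.
Proof.
have amgm b c : cabs (G chi c b) <= s / 2 + (2 * s)^-1 * cabs (G chi c b) ^+ 2.
  set x := cabs _; have h1 := sqr_ge0 (s - x).
  rewrite -(ler_pM2l (_ : 0 < 2 * s)) ?mulr_gt0 //.
  have -> : 2 * s * (s / 2 + (2 * s)^-1 * x ^+ 2) = s ^+ 2 + x ^+ 2.
    by field; rewrite gt_eqF.
  lra.
apply: (@le_trans _ _ (\sum_t \sum_(b in blk t) (d%:R * (s / 2) +
   \sum_(c in blk t | c != b) (2 * s)^-1 * cabs (G chi c b) ^+ 2))).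
  apply: ler_sum => t _; apply: ler_sum => b tb.
  rewrite -(sum_block_rem _ tb) -big_split /=.
  by apply: ler_sum => c _; exact: amgm.
under eq_bigr do rewrite big_split.
rewrite big_split /= sum_block_deg sum_ord_cst.
have i2s : 0 <= (2 * s)^-1 by rewrite invr_ge0 mulr_ge0 // ltW.
have h2 : \sum_t \sum_(b in blk t) \sum_(c in blk t | c != b)
    (2 * s)^-1 * cabs (G chi c b) ^+ 2 <= N%:R * (2 * s)^-1.
  apply: le_trans (sum_block_pairs_le _) _.
    by move=> a b; rewrite mulr_ge0 ?sqr_ge0.
  rewrite -sum_ord_cst; apply: ler_sum => b _.
  rewrite -mulr_sumr ler_piMr //; apply: le_trans (resolvent_row_le1 chi b).
  by apply: ler_sum => c _; rewrite (resolvent_symE _ (centred_mx_sym _)).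
apply: le_trans (lerD (lexx _) h2) _.
have h3 : (2 * s)^-1 <= n%:R * d%:R * s / 2.
  rewrite invfM -[leLHS]mulr1 -mulrA [leRHS]mulrC ler_wpM2l ?invr_ge0 //.
  by rewrite ler_pdivrMl //; have := ds2n; lra.
have h4 : N%:R * (2 * s)^-1 <= N%:R * (n%:R * d%:R * s / 2).
  by rewrite ler_wpM2l ?ler0n.
have h5 : D%:R * (N%:R * (d%:R * (s / 2))) <= n%:R * (N%:R * (d%:R * (s / 2))).
  by rewrite ler_wpM2r // !mulr_ge0 ?ler0n ?(ltW s0).
lra.
Qed.

Definition mean_diag a : R[i] := EC (fun chi => G chi a a).
Local Notation adiag := mean_diag.

Definition double_block_err t a chi : R :=
  cabs (double_block t chi a - \sum_(b in blk t | b != a) G chi b b * G chi a a).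

Lemma sum_double_block_err :
  \sum_t \sum_(a in blk t) E (double_block_err t a) <=
  4 * k ^+ 5 * (N%:R * n%:R * s).
Proof.
have -> : \sum_t \sum_(a in blk t) E (double_block_err t a) =
   E (fun chi => \sum_t \sum_(a in blk t) double_block_err t a chi).
  by rewrite expect_sum; apply: eq_bigr => t _; rewrite expect_sum.
apply: expect_le => // chi.
apply: (@le_trans _ _ (\sum_t ((\sum_(a in blk t) (2 * k ^+ 5 * s)) +
    2 * k ^+ 2 * off_mass t chi))).
  apply: ler_sum => t _.
  apply: (@le_trans _ _ (\sum_(a in blk t) (2 * k ^+ 5 * s + k * off_mass t chi +
      k ^+ 2 * \sum_(c in blk t | c != a) cabs (G chi c a)))).
    by apply: ler_sum => a ta; exact: double_block_approx.
  rewrite !big_split /= -addrA lerD2l -[X in _ + X <= _]mulr_sumr -/(off_mass t chi).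
  rewrite sum_block_cst.
  by rewrite le_eqVlt; apply/orP; left; apply/eqP; ring.
rewrite big_split /= sum_block_deg sum_ord_cst -mulr_sumr.
have kk : 0 <= 2 * k ^+ 2 by rewrite mulr_ge0 ?exprn_ge0.
apply: le_trans (lerD (lexx _) (ler_wpM2l kk (sum_off_mass chi))) _.
have h1 : D%:R * (N%:R * (2 * k ^+ 5 * s)) <= n%:R * (N%:R * (2 * k ^+ 5 * s)).
  by rewrite ler_wpM2r // !mulr_ge0 ?ler0n ?exprn_ge0 ?(ltW s0).
have kd : d%:R <= k ^+ 3.
  by apply: (@le_trans _ _ k); [rewrite ler_nat|rewrite ler_eXnr].
have h2 : 2 * k ^+ 2 * (N%:R * n%:R * d%:R * s) <=
    2 * k ^+ 5 * (N%:R * n%:R * s).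
  have -> : 2 * k ^+ 2 * (N%:R * n%:R * d%:R * s) =
    2 * k ^+ 2 * (N%:R * n%:R * s) * d%:R by ring.
  have -> : 2 * k ^+ 5 * (N%:R * n%:R * s) =
    2 * k ^+ 2 * (N%:R * n%:R * s) * k ^+ 3 by ring.
  by rewrite ler_wpM2l // !mulr_ge0 ?ler0n ?exprn_ge0 ?(ltW s0).
lra.
Qed.

(** The defect of the means [adiag a] in the self-consistent equation, in which the
    products range over the neighbours [b] of [a]. *)
Definition equation_err a : R[i] := 1 + (0 +i* e)%C * adiag a +
  (((d * n)%:R^-1)%:C)%C *
    \sum_(t | a \in blk t) \sum_(b in blk t | b != a) adiag b * adiag a.

(** Integration by parts in the diagonal entries of [H G = 1 + i e G]. *)
Lemma diag_by_parts a : 1 + (0 +i* e)%C * adiag a =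
  - (((d * n)%:R^-1)%:C)%C * \sum_(t | a \in blk t) EC (fun chi => double_block t chi a).
Proof.
transitivity (EC (fun chi => (s%:C)%C * \sum_t (((chi t)%:R - (p%:C)%C) *
    (MtoC (Ht t) *m G chi) a a))).
  rewrite /mean_diag -expectZ -[X in X + _](expect_cst T (p%:C)%C) -expectD.
  apply: eq_expect => chi.
  have /matrixP/(_ a a) := mul_map_resolvent (centred_mx_sym chi) e0.
  rewrite [RHS]mxE [X in _ = X + _ -> _]mxE eqxx [X in _ = _ + X -> _]mxE => <-.
  rewrite /centred_mx map_mxZ -scalemxAl mxE map_mx_sum mulmx_suml summxE.
  congr (_ * _); apply: eq_bigr => t _.
  by rewrite map_mxZ -scalemxAl mxE /= rmorphB /= rmorph_nat.
rewrite expectZ expect_sum.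
have -> : (((d * n)%:R^-1)%:C)%C =
    (p%:C)%C * (1 - (p%:C)%C) * ((s%:C)%C * (s%:C)%C).
  by rewrite natrM -sq expr2 !rmorphM rmorphB rmorph1.
rewrite [RHS]mulr_sumr [in RHS]big_mkcond /= mulr_sumr; apply: eq_bigr => t _.
rewrite expect_by_parts.
have -> : EC (fun chi => (MtoC (Ht t) *m G (upd chi t true)) a a -
     (MtoC (Ht t) *m G (upd chi t false)) a a) =
   EC (fun chi => - (s%:C)%C * double_block t chi a).
  apply: eq_expect => chi; rewrite /double_block.
  have := congr1 (fun M => (MtoC (Ht t) *m M) a a) (diff_resolvent chi t).
  by rewrite mulmxBr -scalemxAr [LHS]mxE [X in _ + X]mxE [RHS]mxE.
rewrite expectZ; case: ifPn => ta; first by ring.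
rewrite (eq_expect _ (fun chi => double_block_out chi ta)) expect_cst.
by rewrite !mulr0.
Qed.

(** Each neighbour contributes the error of [double_block_approx] and the covariance of
    two diagonal entries. *)
Lemma sum_equation_err : \sum_a cabs (equation_err a) <= N%:R * (24 * k ^+ 10 * s).
Proof.
set V := 2 * k ^+ 2 / n%:R + 2 * k ^+ 2 * kap ^+ 2.
have dn_ge0 : 0 <= (d * n)%:R^-1 :> R by rewrite invr_ge0 ler0n.
have Q a : cabs (equation_err a) <= (d * n)%:R^-1 * \sum_(t | a \in blk t)
   (E (double_block_err t a) +
    \sum_(b in blk t | b != a) V).
  have -> : equation_err a = - (((d * n)%:R^-1)%:C)%C * \sum_(t | a \in blk t)
     (EC (fun chi => double_block t chi a -
       \sum_(b in blk t | b != a) G chi b b * G chi a a) +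
      \sum_(b in blk t | b != a)
        (EC (fun chi => G chi b b * G chi a a) - adiag b * adiag a)).
    rewrite /equation_err diag_by_parts !mulNr addrC -mulrBr.
    rewrite -mulrN; congr (_ * _); rewrite -sumrB -sumrN; apply: eq_bigr => t _.
    by rewrite expectB expect_sum sumrB; ring.
  rewrite cabsM cabsN cabs_real ger0_norm // ler_wpM2l //.
  apply: le_trans (cabs_sum _ _ _) _; apply: ler_sum => t _.
  apply: le_trans (cabsD _ _) _; apply: lerD; first exact: cabs_expect.
  apply: le_trans (cabs_sum _ _ _) _; apply: ler_sum => b _.
  apply: le_trans (cabs_cov p01 _ _) _.
  have := cvar_resolvent_diag a; have := cvar_resolvent_diag b.
  by rewrite -/V; lra.
apply: le_trans (ler_sum _ (fun a _ => Q a)) _.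
rewrite -mulr_sumr (exchange_big_dep xpredT) //=.
rewrite (eq_bigr (fun t => (\sum_(a in blk t) E (double_block_err t a) +
    \sum_(a in blk t) (d%:R * V)))); last first.
  move=> t _; rewrite big_split /=; congr (_ + _); apply: eq_bigr => a ta.
  exact: sum_block_rem.
rewrite big_split /= sum_block_deg sum_ord_cst.
have s2s : s ^+ 2 <= s by rewrite expr2 ler_piMr // ltW.
have s00 := ltW s0.
have kexp i j : (i <= j)%N -> k ^+ i <= k ^+ j by move=> ij; rewrite ler_weXn2l.
have V1 : V <= 20 * k ^+ 10 * s.
  have v1 : 2 * k ^+ 2 / n%:R <= 2 * k ^+ 10 * s.
    apply: (@le_trans _ _ (2 * k ^+ 2 * (d%:R * s ^+ 2))).
      by rewrite ler_wpM2l ?mulr_ge0 ?exprn_ge0.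
    have -> : 2 * k ^+ 10 * s = 2 * k ^+ 2 * (k ^+ 8 * s) by ring.
    rewrite ler_wpM2l ?mulr_ge0 ?exprn_ge0 // ler_pM ?ler0n ?sqr_ge0 //.
    by apply: (@le_trans _ _ k); [rewrite ler_nat|rewrite ler_eXnr].
  have kap3 : kap <= 3 * k ^+ 4 * s.
    have : 2 * k ^+ 2 * s <= 2 * k ^+ 4 * s.
      by rewrite ler_wpM2r // ler_wpM2l // kexp.
    have : k ^+ 4 * s ^+ 2 <= k ^+ 4 * s by rewrite ler_wpM2l ?exprn_ge0.
    rewrite /block_err; lra.
  have kap9 : kap ^+ 2 <= 9 * k ^+ 8 * s.
    apply: (@le_trans _ _ ((3 * k ^+ 4 * s) ^+ 2)).
      by rewrite ler_pXn2r ?nnegrE // !mulr_ge0 ?exprn_ge0.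
    have -> : (3 * k ^+ 4 * s) ^+ 2 = 9 * k ^+ 8 * s ^+ 2 by ring.
    by rewrite ler_wpM2l // mulr_ge0 ?exprn_ge0.
  have v2 : 2 * k ^+ 2 * kap ^+ 2 <= 18 * k ^+ 10 * s.
    apply: (@le_trans _ _ (2 * k ^+ 2 * (9 * k ^+ 8 * s))).
      by rewrite ler_wpM2l // mulr_ge0 ?exprn_ge0.
    by rewrite le_eqVlt; apply/orP; left; apply/eqP; ring.
  rewrite /V; lra.
have V0 : 0 <= V.
  by rewrite addr_ge0 // !mulr_ge0 ?exprn_ge0 ?invr_ge0 ?ler0n ?sqr_ge0.
rewrite ler_pdivrMl //; apply: le_trans (lerD sum_double_block_err (lexx _)) _.
have d1 : 1 <= d%:R :> R by move: d0; rewrite ltr0n ler1n.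
have h1 : D%:R * (N%:R * (d%:R * V)) <= n%:R * (N%:R * (d%:R * (20 * k ^+ 10 * s))).
  by rewrite ler_pM ?mulr_ge0 ?ler0n // ?ler_wpM2l ?ler0n //.
have h2 : 4 * k ^+ 5 * (N%:R * n%:R * s) <= d%:R * (4 * k ^+ 10 * (N%:R * n%:R * s)).
  have h3 : 4 * k ^+ 5 * (N%:R * n%:R * s) <= 4 * k ^+ 10 * (N%:R * n%:R * s).
    by rewrite ler_wpM2r ?mulr_ge0 ?ler0n // ler_wpM2l // kexp.
  apply: le_trans h3 _; rewrite ler_peMl // !mulr_ge0 ?ler0n ?exprn_ge0 //.
rewrite natrM; lra.
Qed.

Lemma adiag_le a : cabs (adiag a) <= 1 / 2.
Proof.
apply: le_trans (cabs_expect p01 _) _; apply: expect_le => // chi.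
by apply: le_trans ie_half; exact: resolvent_entry_le (centred_mx_sym chi) e0 _ _.
Qed.

(** Stability in l1 norm: subtracting the two equations bounds [e] times the
    deviation at [a] by the defect plus the average of half the deviations at [a] and
    at its neighbours, since both solutions are bounded by [1 / 2]. Summing over [a]
    leaves the factor [e - 1 >= 1]. *)
Lemma sum_adiag_dist m : 1 + (0 +i* e)%C * m + m ^+ 2 = 0 -> cabs m <= 1 / 2 ->
  \sum_a cabs (adiag a - m) <= N%:R * (25 * k ^+ 10 * s).
Proof.
move=> mE m_half; set dl := \sum_a _.
have dn_ge0 : 0 <= (d * n)%:R^-1 :> R by rewrite invr_ge0 ler0n.
have rho : 0 <= 1 - D%:R / n%:R :> R by rewrite subr_ge0 ler_pdivrMr // mul1r.
have ze : cabs (0 +i* e)%C = e.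
  by rewrite /cabs /= expr0n add0r sqrtr_sqr ger0_norm // ltW.
have step a : e * cabs (adiag a - m) <= cabs (equation_err a) +
   (1 - D%:R / n%:R) + (d * n)%:R^-1 * \sum_(t | a \in blk t)
     \sum_(b in blk t | b != a) (cabs (adiag b - m) / 2 + cabs (adiag a - m) / 2).
  have E1 : (0 +i* e)%C * (adiag a - m) = equation_err a +
     ((1 - D%:R / n%:R)%:C)%C * m ^+ 2 +
     (((d * n)%:R^-1)%:C)%C * \sum_(t | a \in blk t)
       \sum_(b in blk t | b != a) (m ^+ 2 - adiag b * adiag a).
    have -> : \sum_(t | a \in blk t) \sum_(b in blk t | b != a)
        (m ^+ 2 - adiag b * adiag a) =
      (((d * D)%:R)%:C)%C * m ^+ 2 - \sum_(t | a \in blk t)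
       \sum_(b in blk t | b != a) adiag b * adiag a.
      under eq_bigr do rewrite sumrB.
      rewrite sumrB; congr (_ - _).
      have cnt t : a \in blk t ->
          \sum_(b in blk t | b != a) m ^+ 2 = ((d%:R)%:C)%C * m ^+ 2.
        move=> ta; have := sum_block_rem 1 ta; rewrite mulr1 => <-.
        by rewrite rmorph_sum mulr_suml; apply: eq_bigr => b _; rewrite rmorph1 mul1r.
      rewrite (eq_bigr _ cnt) sumr_const.
      have -> : #|(fun t => a \in blk t)| = D by rewrite -(blk_deg a) cardsE.
      rewrite -[X in X = _]mulr_natr natrM rmorphM /=.
      by rewrite (rmorph_nat (real_complex R) D); ring.
    have m2 : m ^+ 2 = - 1 - (0 +i* e)%C * m.
      by apply/eqP; rewrite -subr_eq0 -mE; apply/eqP; ring.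
    rewrite /equation_err mulrBr [in RHS]mulrBr addrACA.
    set S := _ * \sum_(t | _) _; set x := _ * adiag a; set y := _ * m.
    have -> : (((d * n)%:R^-1)%:C)%C * ((((d * D)%:R)%:C)%C * m ^+ 2) =
       ((D%:R / n%:R)%:C)%C * m ^+ 2.
      rewrite mulrA -rmorphM; congr ((_%:C)%C * _).
      by rewrite !natrM; field; rewrite !gt_eqF.
    rewrite rmorphB rmorph1 /= mulrBl mul1r m2 -/y.
    set w := _ * _; clearbody w x y S; ring.
  rewrite -{1}ze -cabsM E1.
  apply: le_trans (cabsD _ _) _; apply: lerD.
    apply: le_trans (cabsD _ _) _; rewrite lerD2l cabsM cabs_real ger0_norm //.
    rewrite ler_piMr // expr2 cabsM mulr_ile1 ?cabs_ge0 //; lra.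
  rewrite cabsM cabs_real ger0_norm // ler_wpM2l //.
  apply: le_trans (cabs_sum _ _ _) _; apply: ler_sum => t _.
  apply: le_trans (cabs_sum _ _ _) _; apply: ler_sum => b _.
  have -> : m ^+ 2 - adiag b * adiag a = - ((adiag b - m) * m + adiag b * (adiag a - m)).
    by ring.
  rewrite cabsN; apply: le_trans (cabsD _ _) _; rewrite !cabsM.
  rewrite -[2^-1]div1r; apply: lerD; first by rewrite ler_wpM2l ?cabs_ge0.
  by rewrite mulrC ler_wpM2l ?cabs_ge0 // adiag_le.
have dl0 : 0 <= dl by apply: sumr_ge0 => a _; exact: cabs_ge0.
have := ler_sum (index_enum _) (fun a (_ : xpredT a) => step a).
rewrite -mulr_sumr -/dl !big_split /= sum_ord_cst -mulr_sumr.
rewrite (exchange_big_dep xpredT) //=.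
under [X in _ + _ * X]eq_bigr do under eq_bigr do rewrite big_split.
under [X in _ + _ * X]eq_bigr do rewrite big_split.
rewrite big_split /= sum_block_neighbours.
have -> : \sum_t \sum_(a in blk t) \sum_(b in blk t | b != a) cabs (adiag a - m) / 2 =
   D%:R * \sum_a d%:R * (cabs (adiag a - m) / 2).
  rewrite -sum_block_deg; apply: eq_bigr => t _; apply: eq_bigr => a ta.
  exact: sum_block_rem.
rewrite -mulr_sumr -mulr_suml -/dl => main.
have := sum_equation_err; set Er := \sum_a _ => err.
have e3 : (d * n)%:R^-1 * ((d * D)%:R * (dl / 2) + D%:R * (d%:R * (dl / 2))) <= dl.
  rewrite ler_pdivrMl //.
  have : D%:R * (d%:R * dl) <= n%:R * (d%:R * dl) by rewrite ler_wpM2r // mulr_ge0 ?ler0n.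
  rewrite !natrM; lra.
have e4 : N%:R * (1 - D%:R / n%:R) <= N%:R * (k ^+ 10 * s).
  rewrite ler_wpM2l ?ler0n //.
  apply: (@le_trans _ _ (d%:R / n%:R)).
    rewrite ler_pdivlMr // mulrBl mul1r -mulrA mulVf ?gt_eqF // mulr1.
    by rewrite lerBlDr -natrD ler_nat -leq_subLR.
  apply: (@le_trans _ _ (d%:R * (d%:R * s ^+ 2))); first by rewrite ler_wpM2l ?ler0n.
  have dk : d%:R <= k by rewrite ler_nat.
  have s2s : s ^+ 2 <= s by rewrite expr2 ler_piMr // ltW.
  have ddk : d%:R * d%:R <= k ^+ 10.
    apply: (@le_trans _ _ (k ^+ 2)); last by rewrite ler_weXn2l.
    by rewrite expr2; apply: ler_pM; rewrite ?ler0n.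
  by rewrite mulrA; apply: ler_pM => //; exact: sqr_ge0.
have : (e - 2) * dl >= 0 by rewrite mulr_ge0 // subr_ge0.
move: main; rewrite -/Er sumrN sum_ord_cst; lra.
Qed.

Lemma expect_mxtrace_dist m : 1 + (0 +i* e)%C * m + m ^+ 2 = 0 -> cabs m <= 1 / 2 ->
  cabs (EC (fun chi => \tr (G chi)) - N%:R * m) <= N%:R * (25 * k ^+ 10 * s).
Proof.
move=> mE m_half; apply: le_trans (sum_adiag_dist mE m_half).
have -> : EC (fun chi => \tr (G chi)) - N%:R * m = \sum_a (adiag a - m).
  by rewrite sumrB sumr_const card_ord -[m *+ N]mulr_natl /mean_diag -expect_sum.
exact: cabs_sum.
Qed.

End RandomMatrix.
End LinearHypergraph.

(** * Oriented cells and incidence signs *)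

Section Orientation.
Variable V : finType.
Local Notation ordering m := {ffun 'I_m -> V}.

Definition img m (s : ordering m) : {set V} := [set s i | i in 'I_m]%SET.

Lemma mem_img m (s : ordering m) i : s i \in img s.
Proof. exact: imset_f. Qed.

Lemma card_img m (s : ordering m) : injective s -> #|img s| = m.
Proof. by move=> si; rewrite card_imset // card_ord. Qed.

Lemma img_reorder j (s : ordering j.+1) a : img (reorder s a) = img s.
Proof.
apply/setP => v; apply/imsetP/imsetP => -[i _ ->].
  by exists (a i); rewrite ?ffunE.
by exists (a^-1%g i); rewrite ?ffunE ?permKV.
Qed.

Lemma reorder_inj j (s : ordering j.+1) a : injective s -> injective (reorder s a).
Proof. by move=> si x y; rewrite !ffunE => /si /perm_inj. Qed.

Lemma reorder_of_img j (s s' : ordering j.+1) : injective s -> injective s' ->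
  img s = img s' -> exists a, s' = reorder s a.
Proof.
move=> si si' e.
have ex i : exists k, s k == s' i.
  by have := mem_img s' i; rewrite -e => /imsetP[k _ ->]; exists k.
pose f i := xchoose (ex i).
have fE i : s (f i) = s' i by apply/eqP/(xchooseP (ex i)).
have fi : injective f by move=> x y fxy; apply: si'; rewrite -!fE fxy.
by exists (perm fi); apply/ffunP => i; rewrite ffunE permE fE.
Qed.

Lemma orient_reorder j (s : ordering j.+1) (a : 'S_j.+1) :
  orient (reorder s a) = if odd_perm a then opposite (orient s) else orient s.
Proof.
case: ifPn => oa; first by rewrite (oppositeE s oa).
apply/setP => x; apply/imsetP/imsetP => -[b eb ->].
  exists (b * a)%g; last by rewrite reorderM.
  by move: eb; rewrite !inE odd_permM (negbTE oa) addbF.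
exists (b * a^-1)%g; last by rewrite reorderM mulgKV.
by move: eb; rewrite !inE odd_permM odd_permV (negbTE oa) addbF.
Qed.

Lemma mem_orient j (s : ordering j.+1) : s \in orient s.
Proof.
by apply/imsetP; exists 1%g; rewrite ?inE ?odd_perm1 ?reorder1.
Qed.

Lemma orient_mem j (s s' : ordering j.+1) :
  s' \in orient s -> exists2 a, ~~ odd_perm a & s' = reorder s a.
Proof. by move=> /imsetP[a]; rewrite inE => ea ->; exists a. Qed.

Lemma orient_neq_opposite j (s : ordering j.+1) :
  injective s -> orient s <> opposite (orient s).
Proof.
move=> si e; have := mem_orient s; rewrite e => /imset2P[x b].
move=> /orient_mem[a ea ->]; rewrite inE => ob; rewrite reorderM => /ffunP sE.
have : (b * a = 1)%g.
  by apply/permP => i; apply: si; rewrite perm1 [in RHS]sE ffunE.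
by move=> /(congr1 (@odd_perm _)); rewrite odd_permM ob (negbTE ea) odd_perm1.
Qed.

Lemma orient_cases j (s s' : ordering j.+1) : injective s -> injective s' ->
  img s = img s' -> orient s' = orient s \/ orient s' = opposite (orient s).
Proof.
move=> si si' e; have [a ->] := reorder_of_img si si' e.
by rewrite orient_reorder; case: ifP => _; [right|left].
Qed.

Definition vertices j (c : {set ordering j.+1}) : {set V} :=
  \bigcup_(s in c) img s.

Lemma vertices_orient j (s : ordering j.+1) : vertices (orient s) = img s.
Proof.
apply/setP => v; apply/bigcupP/idP => [[x /orient_mem[a _ ->]]|sv].
  by rewrite img_reorder.
by exists s; rewrite ?mem_orient.
Qed.

Lemma vertices_opposite j (s : ordering j.+1) : (0 < j)%N ->
  vertices (opposite (orient s)) = img s.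
Proof.
move=> /odd_perm_exists[a oa].
by rewrite (oppositeE s oa) vertices_orient img_reorder.
Qed.

Lemma delete_vertex_inj j (t : ordering j.+2) i :
  injective t -> injective (delete_vertex t i).
Proof. by move=> ti x y; rewrite !ffunE => /ti /lift_inj. Qed.

Lemma img_delete_vertex j (t : ordering j.+2) i : injective t ->
  img (delete_vertex t i) = img t :\ t i.
Proof.
move=> ti; apply/setP => v; rewrite finset.in_setD1; apply/imsetP/andP.
  move=> [k _ ->]; rewrite ffunE mem_img; split => //.
  by apply/eqP => /ti /eqP; rewrite eq_sym (negbTE (neq_lift _ _)).
move=> [vti /imsetP[k _ vE]]; move: vti; rewrite vE.
case: (unliftP i k) => [k' ->|->]; last by rewrite eqxx.
by exists k'; rewrite ?ffunE.
Qed.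

Lemma vertices_face j (t : ordering j.+2) i : (0 < j)%N -> injective t ->
  vertices (induced_face t i) = img t :\ t i.
Proof.
move=> j0 ti; rewrite /induced_face -img_delete_vertex //.
by case: ifP => _; rewrite ?vertices_opposite ?vertices_orient.
Qed.

(** The orientation induced on a face depends on the oriented cell only: an even
    permutation carrying [i'] to [i] restricts to a permutation of the other
    vertices of sign [(-1)^(i + i')]. *)
Lemma induced_face_reorder j (t : ordering j.+2) (a : 'S_j.+2) i :
  (0 < j)%N -> injective t -> ~~ odd_perm a ->
  induced_face (reorder t a) i = induced_face t (a i).
Proof.
move=> j0 ti ea.
have ti' : injective (reorder t a) by exact: reorder_inj.
have [|||b bE] := @reorder_of_img _ (delete_vertex t (a i)) (delete_vertex (reorder t a) i).
- exact: delete_vertex_inj.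
- exact: delete_vertex_inj.
- by rewrite !img_delete_vertex // img_reorder ffunE.
have aE : a = lift_perm i (a i) b.
  apply/permP => k; case: (unliftP i k) => [k' ->|->]; last by rewrite lift_perm_id.
  rewrite lift_perm_lift; apply: ti.
  by have /ffunP/(_ k') := bE; rewrite !ffunE.
have ob : odd_perm b = odd i (+) odd (a i).
  move: ea; rewrite aE odd_lift_perm lift_perm_id.
  by case: (odd i); case: (odd (a i)); case: (odd_perm b).
rewrite /induced_face bE orient_reorder ob.
by case: (odd i); case: (odd (a i)); rewrite //= opposite_orientK.
Qed.

Lemma in_boundary_orient j (t : ordering j.+2) c : (0 < j)%N -> injective t ->
  in_boundary c (orient t) <-> exists i, c = induced_face t i.
Proof.
move=> j0 ti; split.
  move=> /existsP[t' /andP[/orient_mem[a ea ->] /existsP[i /eqP->]]].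
  by exists (a i); rewrite induced_face_reorder.
move=> [i ->]; apply/existsP; exists t; rewrite mem_orient.
by apply/existsP; exists i.
Qed.

Definition fcons m (x : V) (f : ordering m) : ordering m.+1 :=
  [ffun i => if unlift ord0 i is Some k then f k else x].

Lemma fcons0 m x (f : ordering m) : fcons x f ord0 = x.
Proof. by rewrite ffunE unlift_none. Qed.

Lemma fconsS m x (f : ordering m) k : fcons x f (lift ord0 k) = f k.
Proof. by rewrite ffunE liftK. Qed.

Lemma img_fcons m x (f : ordering m) : img (fcons x f) = x |: img f.
Proof.
apply/setP => v; rewrite finset.in_setU1; apply/imsetP/orP.
  move=> [i _ ->]; case: (unliftP ord0 i) => [k ->|->]; last by rewrite fcons0 eqxx; left.
  by rewrite fconsS mem_img; right.
move=> [/eqP->|/imsetP[k _ ->]]; first by exists ord0; rewrite ?fcons0.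
by exists (lift ord0 k); rewrite ?fconsS.
Qed.

Lemma fcons_inj m x (f : ordering m) :
  injective f -> x \notin img f -> injective (fcons x f).
Proof.
move=> fi xf i i'.
case: (unliftP ord0 i) => [k ->|->]; case: (unliftP ord0 i') => [k' ->|->];
  rewrite ?fconsS ?fcons0 //.
- by move=> /fi ->.
- by move=> e; move: xf; rewrite -e mem_img.
- by move=> e; move: xf; rewrite e mem_img.
Qed.

Lemma induced_face0 j x (f : ordering j.+1) :
  induced_face (fcons x f) ord0 = orient f.
Proof.
rewrite /induced_face /=; congr orient; apply/ffunP => k.
by rewrite ffunE fconsS.
Qed.

Lemma induced_face1 j x y (f : ordering j) :
  induced_face (fcons x (fcons y f)) (lift ord0 ord0) =
  opposite (orient (fcons x f)).
Proof.
rewrite /induced_face /=; congr (opposite (orient _)); apply/ffunP => k.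
rewrite ffunE; case: (unliftP ord0 k) => [k' ->|->].
  have -> : lift (lift ord0 ord0) (lift ord0 k') = lift ord0 (lift ord0 k').
    by apply: val_inj; rewrite /= /bump.
  by rewrite !fconsS.
have -> : lift (lift ord0 ord0) ord0 = ord0 :> 'I_j.+2 by apply: val_inj.
by rewrite !fcons0.
Qed.

Section Adjacency.
Variables (X : {set {set V}}) (j : nat).
Hypothesis j0 : (0 < j)%N.
Implicit Types c : {set ordering j.+1}.

Definition adjacent_sets c' c :=
  [exists b : oriented_cell X j.+1,
    in_boundary c (val b) && in_boundary (opposite c') (val b)].

Lemma adjacent_setsP c' c : adjacent_sets c' c <->
  exists t : ordering j.+2, [/\ injective t, img t \in X &
    exists i k, c = induced_face t i /\ opposite c' = induced_face t k].
Proof.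
split.
  move=> /existsP[[b /= /existsP[t /and3P[/injectiveP ti tX /eqP->]]]].
  move=> /andP[/(in_boundary_orient _ j0 ti)[i ->]].
  move=> /(in_boundary_orient _ j0 ti)[k c'E].
  by exists t; split => //; exists i, k.
move=> [t [ti tX [i [k [-> c'E]]]]].
have tb : is_oriented_cell X (orient t).
  by apply/existsP; exists t; apply/and3P; split => //; exact/injectiveP.
apply/existsP; exists (Sub (orient t) tb); rewrite SubK c'E.
by apply/andP; split; apply/(in_boundary_orient _ j0 ti); [exists i|exists k].
Qed.

Lemma adjacent_sets_opp s' s :
  adjacent_sets (orient s') (orient s) ->
  adjacent_sets (opposite (orient s')) (opposite (orient s)).
Proof.
move=> /existsP[b /andP[sb s'b]]; apply/existsP.
exists (Sub (opposite (val b)) (opposite_cell (ltn0Sn j) (valP b))).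
by rewrite !SubK !in_boundary_opposite.
Qed.

Lemma adjacent_sets_vertices c' c :
  (exists s', c' = orient s') -> vertices c' != vertices c ->
  adjacent_sets c' c ->
  #|vertices c :|: vertices c'| = j.+2 /\ vertices c :|: vertices c' \in X.
Proof.
move=> [s' ->] ne /adjacent_setsP[t [ti tX [i [k [cE c'E]]]]].
have vc : vertices c = img t :\ t i by rewrite cE vertices_face.
have vc' : vertices (orient s') = img t :\ t k.
  by rewrite vertices_orient -(vertices_opposite s' j0) c'E vertices_face.
have ik : t i != t k by move: ne; rewrite vc vc'; apply: contraNneq => ->.
suff -> : vertices c :|: vertices (orient s') = img t by rewrite card_img.
rewrite vc vc' -finset.setDIr; have -> : [set t i]%SET :&: [set t k]%SET = finset.set0.
  by apply/setP => x; rewrite !inE; apply/andP => -[/eqP-> /eqP e];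
     rewrite e eqxx in ik.
exact: finset.setD0.
Qed.

Section TwoFaces.
Variables (u v : V) (f : ordering j).
Let t0 := fcons v (fcons u f).
Hypotheses (t0i : injective t0) (t0X : img t0 \in X).
Let P := orient (fcons u f).
Let Q := orient (fcons v f).

(** The cell [v, u, f] induces [u, f] on its first face and the opposite of [v, f]
    on its second face. *)
Lemma adjacent_faces : adjacent_sets Q P.
Proof.
apply/adjacent_setsP; exists t0; split => //.
by exists ord0, (lift ord0 ord0); rewrite induced_face0 induced_face1.
Qed.

Let ui : injective (fcons u f).
Proof.
have := delete_vertex_inj (i := ord0) t0i.
suff -> : delete_vertex t0 ord0 = fcons u f by [].
by apply/ffunP => k; rewrite ffunE fconsS.
Qed.

Let uf : u \notin img f.
Proof.
apply/negP => /imsetP[k _ uE]; have := ui.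
move=> /(_ ord0 (lift ord0 k)); rewrite fcons0 fconsS => /(_ uE) /eqP.
by rewrite (negbTE (neq_lift _ _)).
Qed.

Let vuf : v \notin u |: img f.
Proof.
rewrite -img_fcons; apply/negP => /imsetP[k _ vE].
have := @t0i ord0 (lift ord0 k); rewrite fcons0 fconsS => /(_ vE) /eqP.
by rewrite (negbTE (neq_lift _ _)).
Qed.

Let vi : injective (fcons v f).
Proof.
apply: fcons_inj; last by move: vuf; rewrite finset.in_setU1 negb_or => /andP[].
by move=> x y e; apply: (@lift_inj _ ord0); apply: ui; rewrite !fconsS.
Qed.

(** A cell containing both faces has the vertices of [t0], and the orientation it
    induces on one face determines the one it induces on the other. *)
Lemma not_adjacent_faces : ~~ adjacent_sets (opposite Q) P.
Proof.
apply/negP => /adjacent_setsP[t [ti tX [i [k [PE]]]]].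
rewrite (opposite_orientK _ j0) -/Q => QE.
have PT : u |: img f = img t :\ t i.
  by rewrite -img_fcons -vertices_orient -/P PE vertices_face.
have QT : v |: img f = img t :\ t k.
  by rewrite -img_fcons -vertices_orient -/Q QE vertices_face.
have imgt : img t0 = img t.
  apply/eqP; rewrite eqEcard !card_img // leqnn andbT !img_fcons.
  rewrite -finset.setUCA; apply/fintype.subsetP => x; rewrite finset.in_setU => /orP[].
    rewrite finset.in_set1 => /eqP ->.
    by have : u \in u |: img f by [rewrite finset.setU11]; rewrite PT finset.in_setD1 => /andP[].
  by rewrite QT finset.in_setD1 => /andP[].
have imgt0 : img t0 = v |: (u |: img f) by rewrite !img_fcons.
have face_v l : vertices (induced_face t0 l) = u |: img f -> l = ord0.
  rewrite vertices_face // => e; apply: t0i; rewrite fcons0; apply/eqP.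
  apply/negPn/negP => ne; have : v \in img t0 :\ t0 l.
    by rewrite finset.in_setD1 eq_sym ne imgt0 finset.setU11.
  by rewrite e (negbTE vuf).
have face_u l : vertices (induced_face t0 l) = v |: img f -> l = lift ord0 ord0.
  rewrite vertices_face // => e; apply: t0i; rewrite fconsS fcons0; apply/eqP.
  apply/negPn/negP => ne; have : u \in img t0 :\ t0 l.
    by rewrite finset.in_setD1 eq_sym ne imgt0 finset.in_setU1 finset.setU11 orbT.
  rewrite e finset.in_setU1 (negbTE uf) orbF => /eqP uv.
  by move: vuf; rewrite uv finset.setU11.
have [a tE] := reorder_of_img t0i ti imgt.
have Qv : vertices Q = v |: img f by rewrite vertices_orient img_fcons.
have Pv : vertices (opposite P) = u |: img f.
  by rewrite vertices_opposite // img_fcons.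
case oa : (odd_perm a).
  (* the reversed cell induces the reversed orientation on the first face *)
  have : in_boundary (opposite P) (orient t0).
    have := @in_boundary_opposite _ j P (orient t) j0.
    rewrite {2}tE orient_reorder oa opposite_orientK //; apply.
    by apply/(in_boundary_orient _ j0 ti); exists i.
  move=> /(in_boundary_orient _ j0 t0i)[l lE].
  have l0 : l = ord0 by apply: face_v; rewrite -lE.
  by move: lE; rewrite l0 induced_face0 => /esym; exact: orient_neq_opposite.
have : in_boundary Q (orient t).
  by apply/(in_boundary_orient _ j0 ti); exists k.
rewrite tE orient_reorder oa => /(in_boundary_orient _ j0 t0i)[l lE].
have l1 : l = lift ord0 ord0 by apply: face_u; rewrite -lE.
by move: lE; rewrite l1 induced_face1; exact: orient_neq_opposite.
Qed.

End TwoFaces.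
End Adjacency.

Definition subset_of_card m := {sigma : {set V} | #|sigma| == m}.

Lemma subset_of_cardE m (x : subset_of_card m) : #|val x| = m.
Proof. by case: x => s /= /eqP. Qed.

Definition vertex_order m (x : subset_of_card m) : ordering m :=
  [ffun i => enum_val (cast_ord (esym (subset_of_cardE x)) i)].

Lemma vertex_order_inj m (x : subset_of_card m) : injective (vertex_order x).
Proof. by move=> i i'; rewrite !ffunE => /enum_val_inj /cast_ord_inj. Qed.

Lemma img_vertex_order m (x : subset_of_card m) : img (vertex_order x) = val x.
Proof.
apply/eqP; rewrite eqEcard card_img ?subset_of_cardE ?leqnn ?andbT //.
  by apply/fintype.subsetP => v /imsetP[i _ ->]; rewrite ffunE enum_valP.
exact: vertex_order_inj.
Qed.

Section Signs.
Variables (R : realFieldType) (j : nat).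
Implicit Types (x y : subset_of_card j.+1) (r : subset_of_card j).

(** The reference orientation of a set of vertices: that of its enumeration. *)
Definition positive_cell x := orient (vertex_order x).

Lemma vertices_positive x : vertices (positive_cell x) = val x.
Proof. by rewrite vertices_orient img_vertex_order. Qed.

(** The sign of the ordering [u, r] relative to the reference orientation of
    [x = r + u]; a vertex [u] outside [x] never gives that orientation. *)
Definition incidence r x : R :=
  if val r \subset val x then
    (if [exists u, positive_cell x == orient (fcons u (vertex_order r))]
     then 1 else -1)
  else 0.

Lemma incidenceP r x u : u \notin val r -> val x = u |: val r ->
  positive_cell x = orient (fcons u (vertex_order r)) /\ incidence r x = 1 \/
  positive_cell x = opposite (orient (fcons u (vertex_order r))) /\ incidence r x = -1.
Proof.
move=> ur xE; rewrite /incidence xE finset.subsetUr.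
have ui : injective (fcons u (vertex_order r)).
  by apply: fcons_inj; [exact: vertex_order_inj|rewrite img_vertex_order].
have im : img (fcons u (vertex_order r)) = img (vertex_order x).
  by rewrite img_fcons !img_vertex_order xE.
have [xP|xN] := orient_cases ui (@vertex_order_inj _ x) im.
  left; split=> //; rewrite ifT //.
  by apply/existsP; exists u; apply/eqP.
right; split=> //; rewrite ifF //; apply/existsP => -[u' /eqP e].
have : img (vertex_order x) = img (fcons u' (vertex_order r)).
  by rewrite -!vertices_orient -/(positive_cell x) e.
rewrite -im !img_fcons !img_vertex_order => /setP/(_ u).
rewrite finset.setU11 finset.in_setU1 (negbTE ur) orbF => /esym/eqP uu'.
move: e; rewrite /positive_cell xN -uu' => /esym.
exact: orient_neq_opposite.
Qed.

Lemma incidence0 r x : ~~ (val r \subset val x) -> incidence r x = 0.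
Proof. by rewrite /incidence => /negbTE->. Qed.

Lemma incidence_sqr r x : val r \subset val x -> incidence r x ^+ 2 = 1.
Proof.
by move=> rx; rewrite /incidence rx; case: ifP => _; rewrite ?sqrrN expr1n.
Qed.

(** Two distinct sets of [j + 1] vertices have at most one common subset of [j]
    vertices, so at most one term is nonzero; written as a sum, this is visibly an
    entry of a Gram matrix. *)
Definition face_sign x y : R :=
  if x == y then 0 else \sum_r incidence r x * incidence r y.

Lemma face_sign_sym x y : face_sign x y = face_sign y x.
Proof.
by rewrite /face_sign eq_sym; case: ifP => // _; apply: eq_bigr => r _; rewrite mulrC.
Qed.

Let card_meet x y : x != y -> (#|val x :&: val y| <= j)%N.
Proof.
move=> xy; rewrite -ltnS -[ltnRHS](subset_of_cardE x); apply: proper_card.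
rewrite finset.properEneq finset.subsetIl andbT; apply: contra xy => /eqP e.
apply/eqP/val_inj/eqP; rewrite eqEcard !subset_of_cardE leqnn andbT.
by rewrite -e finset.subsetIr.
Qed.

Lemma face_sign_meet x y r : x != y -> val r = val x :&: val y ->
  face_sign x y = incidence r x * incidence r y.
Proof.
move=> xy rE; rewrite /face_sign (negbTE xy) (bigD1 r) //= big1 ?addr0 //.
move=> r' r'r; have [rx|/incidence0->] := boolP (val r' \subset val x); last by rewrite mul0r.
have [ry|/incidence0->] := boolP (val r' \subset val y); last by rewrite mulr0.
case/eqP: r'r; apply/val_inj/eqP; rewrite eqEcard !subset_of_cardE leqnn andbT.
by rewrite rE finset.subsetI rx.
Qed.

Lemma face_sign0 x y : #|val x :|: val y| != j.+2 -> face_sign x y = 0.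
Proof.
move=> xy; rewrite /face_sign; case: ifPn => // ne; apply: big1 => r _.
have [rx|/incidence0->] := boolP (val r \subset val x); last by rewrite mul0r.
have [ry|/incidence0->] := boolP (val r \subset val y); last by rewrite mulr0.
case/eqP: xy; rewrite cardsU !subset_of_cardE.
suff -> : #|val x :&: val y| = j by lia.
apply/eqP; rewrite eqn_leq card_meet //=.
by rewrite -[leqLHS](subset_of_cardE r); apply: subset_leq_card; rewrite finset.subsetI rx.
Qed.

Lemma meet_exists x y : #|val x :|: val y| = j.+2 ->
  exists r : subset_of_card j, val r = val x :&: val y.
Proof.
move=> xy; have m : #|val x :&: val y| == j.
  by have := cardsUI (val x) (val y); rewrite xy !subset_of_cardE; lia.
by exists (Sub (val x :&: val y) m); rewrite SubK.
Qed.

Lemma face_sign_sqr x y : x != y -> #|val x :|: val y| = j.+2 ->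
  face_sign x y ^+ 2 = 1.
Proof.
move=> ne /meet_exists[r rE]; rewrite (face_sign_meet ne rE) exprMn.
by rewrite !incidence_sqr ?mulr1 // rE ?finset.subsetIl ?finset.subsetIr.
Qed.

Lemma face_sign_le x y : `|face_sign x y| <= (x != y)%:R.
Proof.
have [->|ne] := eqVneq x y; first by rewrite /face_sign eqxx normr0.
have [/eqP e|/face_sign0->] := boolP (#|val x :|: val y| == j.+2); last first.
  by rewrite normr0.
have : `|face_sign x y| ^+ 2 = 1 by rewrite -normrX face_sign_sqr ?normr1.
by move=> /eqP; rewrite sqrf_eq1 => /orP[/eqP->|/eqP e1] //;
  have := normr_ge0 (face_sign x y); rewrite e1; lra.
Qed.

Variable X : {set {set V}}.
Hypothesis j0 : (0 < j)%N.

Lemma vertices_opp_positive x : vertices (opposite (positive_cell x)) = val x.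
Proof. by rewrite vertices_opposite // img_vertex_order. Qed.

(** As the functions in [Omega] are odd, the two orientations of [y] contribute with
    opposite signs. *)
Definition adjacency_entry y x : R :=
  (adjacent_sets X (positive_cell y) (positive_cell x))%:R -
  (adjacent_sets X (opposite (positive_cell y)) (positive_cell x))%:R.

Lemma adjacency_entry_le1 y x : `|adjacency_entry y x| <= 1.
Proof.
rewrite /adjacency_entry; case: adjacent_sets; case: adjacent_sets;
  by rewrite ?subrr ?subr0 ?sub0r ?normrN ?normr1 ?normr0.
Qed.

(** With [x = r + u] and [y = r + v], the oriented cells [v, r] and [u, r] are
    adjacent in the cell [v, u, r], and opposite orientations are not; so the entry is
    the product of the signs of [v, r] and [u, r]. *)
Lemma adjacency_entryE y x : x != y -> adjacency_entry y x =
  ((#|val x :|: val y| == j.+2) && (val x :|: val y \in X))%:R * face_sign x y.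
Proof.
move=> ne; have nev : val y != val x by rewrite eq_sym (inj_eq val_inj).
have [/andP[/eqP card2 inX]|notX] :=
  boolP ((#|val x :|: val y| == j.+2) && (val x :|: val y \in X)); last first.
  rewrite mul0r /adjacency_entry.
  have [a oa] := odd_perm_exists j0.
  have h1 : ~~ adjacent_sets X (positive_cell y) (positive_cell x).
    apply: contra notX => /(adjacent_sets_vertices j0) h.
    have [||c1 c2] := h; first by exists (vertex_order y).
      by rewrite !vertices_positive.
    by move: c1 c2; rewrite !vertices_positive => /eqP -> ->.
  have h2 : ~~ adjacent_sets X (opposite (positive_cell y)) (positive_cell x).
    apply: contra notX => /(adjacent_sets_vertices j0) h.
    have [||c1 c2] := h.
    - by exists (reorder (vertex_order y) a); rewrite -oppositeE.
    - by rewrite vertices_opp_positive vertices_positive.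
    by move: c1 c2; rewrite vertices_opp_positive vertices_positive => /eqP -> ->.
  by rewrite (negbTE h1) (negbTE h2) subrr.
have [r rE] := meet_exists card2.
rewrite mul1r (face_sign_meet ne rE).
have rx : val r \subset val x by rewrite rE finset.subsetIl.
have ry : val r \subset val y by rewrite rE finset.subsetIr.
have cD (z : subset_of_card j.+1) : val r \subset val z ->
    exists u, u \notin val r /\ val z = u |: val r.
  move=> rz; have /cards1P[u uE] : #|val z :\: val r| == 1%N.
    by rewrite cardsD (finset.setIidPr rz) !subset_of_cardE subSnn.
  exists u; split.
    by have : u \in val z :\: val r; [rewrite uE set11|rewrite finset.in_setD => /andP[]].
  by rewrite -uE finset.setUC -[LHS](finset.setID _ (val r)) (finset.setIidPr rz).
have [u [ur xE]] := cD x rx; have [v [vr yE]] := cD y ry.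
have uv : v != u.
  by apply: contraNneq nev => vu; rewrite xE yE vu.
have t0i : injective (fcons v (fcons u (vertex_order r))).
  apply: fcons_inj; last by rewrite img_fcons img_vertex_order finset.in_setU1 negb_or uv.
  apply: fcons_inj; last by rewrite img_vertex_order.
  exact: vertex_order_inj.
have t0X : img (fcons v (fcons u (vertex_order r))) \in X.
  rewrite !img_fcons img_vertex_order -xE.
  suff <- : val x :|: val y = v |: val x by [].
  by rewrite {1}yE finset.setUCA (finset.setUidPl rx).
have adj := adjacent_faces j0 t0i t0X.
have nadj := not_adjacent_faces X j0 t0i.
have adj' := adjacent_sets_opp j0 adj.
have nadj' : ~~ adjacent_sets X (orient (fcons v (vertex_order r)))
    (opposite (orient (fcons u (vertex_order r)))).
  have [a oa] := odd_perm_exists j0.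
  apply: contra nadj; rewrite (oppositeE _ oa) => /(adjacent_sets_opp j0).
  by rewrite -(oppositeE _ oa) opposite_orientK.
rewrite /adjacency_entry.
by case: (incidenceP ur xE) => -[-> ->]; case: (incidenceP vr yE) => -[-> ->];
  rewrite ?opposite_orientK // ?adj ?adj' ?(negbTE nadj) ?(negbTE nadj')
    ?mulr1 ?mul1r ?mulrNN ?mulr1 ?subr0 ?sub0r.
Qed.

End Signs.
End Orientation.

(** * Characteristic polynomials and eigenvalues *)

Section CharPoly.
Import passmx.

Lemma char_poly_similar (K : fieldType) m n (P : 'M[K]_(m, n)) (Q : 'M[K]_(n, m))
    (A : 'M[K]_m) (B : 'M[K]_n) :
  P *m Q = 1%:M -> Q *m P = 1%:M -> A *m P = P *m B -> char_poly A = char_poly B.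
Proof.
move=> PQ QP AP.
have mn : m = n by apply/eqP; rewrite eqn_leq (mulmx1_min PQ) (mulmx1_min QP).
subst n.
have e : char_poly_mx A *m map_mx polyC P = map_mx polyC P *m char_poly_mx B.
  rewrite /char_poly_mx mulmxBl mulmxBr -!map_mxM AP; congr (_ - _).
  by rewrite scalar_mxC.
have := congr1 (fun M => \det M) e; rewrite !det_mulmx [RHS]mulrC.
apply: mulIf; have : \det (map_mx polyC P) * \det (map_mx polyC Q) = 1.
  by rewrite -det_mulmx -map_mxM PQ map_mx1 det1.
by apply: contra_eq_neq => ->; rewrite mul0r eq_sym oner_eq0.
Qed.

Lemma char_poly_coordinates (K : fieldType) (vT : vectType K) N
    (phi : {linear vT -> 'rV[K]_N}) (psi : 'rV[K]_N -> vT)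
    (B : 'End(vT)) (M : 'M[K]_N) :
  cancel phi psi -> cancel psi phi -> (forall v, phi (B v) = phi v *m M) ->
  \dim {:vT} = N /\
  char_poly (passmx.mxof (vbasis {:vT}) (vbasis {:vT}) B) = char_poly M.
Proof.
move=> phiK psiK phiB; set e := vbasis {:vT}.
have eb : basis_of {:vT} e := vbasisP _.
pose psiL : {linear 'rV[K]_N -> vT} :=
  HB.pack psi (GRing.isLinear.Build _ _ _ _ psi (can2_linear phiK psiK)).
pose P := lin1_mx (phi \o passmx.vecof e).
pose Q := lin1_mx (passmx.rVof e \o psiL).
have uP u : u *m P = phi (passmx.vecof e u) by rewrite /P mul_rV_lin1.
have uQ u : u *m Q = passmx.rVof e (psi u) by rewrite /Q mul_rV_lin1.
have PQ : P *m Q = 1%:M.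
  apply/row_matrixP => i; rewrite !rowE mulmxA uP uQ phiK.
  by rewrite passmx.vecofK // mulmx1.
have QP : Q *m P = 1%:M.
  apply/row_matrixP => i; rewrite !rowE mulmxA uQ uP.
  by rewrite passmx.rVofK // psiK mulmx1.
split; first by apply/eqP; rewrite eqn_leq (mulmx1_min PQ) (mulmx1_min QP).
apply: (char_poly_similar PQ QP).
apply/row_matrixP => i; rewrite !rowE !mulmxA !uP -phiB.
by rewrite passmx.mul_mxof passmx.rVofK.
Qed.

End CharPoly.

Section SpectralTheorem.
Variables (R : rcfType) (N : nat).
Local Notation MtoC := (map_mx (real_complex R)).

(** Diagonalisation of the complexified matrix by a unitary one. *)
Lemma sym_spectrum (A : 'M[R]_N) : A^T = A -> exists r : seq R,
  char_poly A = \prod_(a <- r) ('X - a%:P) /\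
  forall e, 0 < e ->
    \tr (resolvent A e) = \sum_(a <- r) ((a%:C)%C - (0 +i* e)%C)^-1.
Proof.
move=> symA; set B := MtoC A.
have hB : B \is hermsymmx.
  apply: realsym_hermsym.
    apply/is_hermitianmxP; rewrite expr0 scale1r map_mx_id //.
    by rewrite map_trmx symA.
  apply/mxOverP => i j; rewrite mxE; apply/complex_realP; by exists (A i j).
have [BE] := orthomx_spectralP (hermitian_normalmx hB).
set P := spectralmx B in BE; set dg := spectral_diag B in BE.
have uP : P \in unitmx by exact: spectral_unit.
have dgr i : dg 0 i = ((complex.Re (dg 0 i))%:C)%C.
  have /mxOverP/(_ 0 i) := hermitian_spectral_diag_real hB.
  by move=> /complex_realP[x e]; rewrite -/dg in e; rewrite e.
exists [seq complex.Re (dg 0 i) | i <- index_enum 'I_N]; split.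
  apply: (@map_inj_poly _ _ (real_complex R)); [by move=> x y []|by []|].
  rewrite map_char_poly big_map rmorph_prod /=.
  have -> : char_poly (MtoC A) = char_poly (diag_mx dg).
    apply: (@char_poly_similar _ _ _ (invmx P) P); rewrite ?mulVmx ?mulmxV //.
    by rewrite -/B BE -!mulmxA mulmxV // mulmx1.
  rewrite char_poly_trig ?diag_mx_is_trig //; apply: eq_bigr => i _.
  by rewrite mxE eqxx mulr1n rmorphB /= map_polyX map_polyC /= -dgr.
move=> e e0; rewrite big_map.
pose D := diag_mx (\row_i (dg 0 i - (0 +i* e)%C)^-1).
have nz i : dg 0 i - (0 +i* e)%C != 0.
  rewrite dgr; apply/eqP => /(congr1 (@complex.Im _)) /=.
  by rewrite add0r => /eqP; rewrite oppr_eq0 gt_eqF.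
have SE : shifted A e = invmx P *m (diag_mx dg - (0 +i* e)%C%:M) *m P.
  rewrite mulmxBr mulmxBl /shifted -/B {1}BE; congr (_ - _).
  by rewrite mul_mx_scalar -scalemxAl mulVmx // scalemx1.
have GE : resolvent A e = invmx P *m D *m P.
  rewrite -[RHS]mul1mx -(resolvent_mul symA e0) -mulmxA SE.
  rewrite !mulmxA (mulmxK uP) -(mulmxA (resolvent A e *m invmx P)).
  have -> : (diag_mx dg - (0 +i* e)%C%:M) *m D = 1%:M.
    rewrite -diag_const_mx -linearB mulmx_diag -diag_const_mx; congr diag_mx.
    by apply/rowP => i; rewrite !mxE divff.
  by rewrite mulmx1 (mulmxKV uP).
rewrite GE mxtrace_mulC mulmxA mulmxV // mul1mx mxtrace_diag.
by apply: eq_bigr => i _; rewrite mxE -dgr.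
Qed.

End SpectralTheorem.

(** The defining property of [eigenvalues] can be met, since the characteristic
    polynomial splits, and it determines the multiset of roots. *)
Lemma eigenvalues_resolvent (R : realType) (vT : vectType R) (B : 'End(vT)) N
    (A : 'M[R]_N) : A^T = A -> \dim {:vT} = N ->
  char_poly (passmx.mxof (vbasis {:vT}) (vbasis {:vT}) B) = char_poly A ->
  size (eigenvalues B) = N /\
  forall e, 0 < e -> \tr (resolvent A e) =
    \sum_(a <- eigenvalues B) ((a%:C)%C - (0 +i* e)%C)^-1.
Proof.
move=> symA dimN charE.
have [r [rE rtr]] := sym_spectrum symA.
have [s_sorted sE] : sorted <=%R (eigenvalues B) /\
    char_poly A = \prod_(a <- eigenvalues B) ('X - a%:P).
  rewrite -charE; apply: (@xgetPex _ [::] [set s : seq R | sorted <=%R s /\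
    char_poly (passmx.mxof (vbasis {:vT}) (vbasis {:vT}) B) =
      \prod_(a <- s) ('X - a%:P)]%classic).
  exists (sort <=%R r); split; first exact: sort_le_sorted.
  rewrite charE rE; apply/esym/perm_big; exact: permEl (perm_sort _ _).
have pe : perm_eq (eigenvalues B) r by apply: prod_XsubC_eq; rewrite -sE.
split; last by move=> e e0; rewrite rtr //; apply/esym/perm_big.
apply/eqP; rewrite -eqSS -(size_char_poly A) sE size_prod_XsubC //.
Qed.

(** * The matrix of the adjacency operator *)

Section AdjacencyMatrix.
Variables (R : rcfType) (V : finType) (X : {set {set V}}) (j : nat).
Hypothesis j0 : (0 < j)%N.
Hypothesis skeleton : forall s : {set V}, #|s| = j.+1 -> s \in X.
Local Notation S := (subset_of_card V j.+1).
Local Notation C := (oriented_cell X j).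
Local Notation N := #|{: S}|.
Implicit Types (x y : S) (c : C).

Lemma positive_is_cell x : is_oriented_cell X (positive_cell x).
Proof.
apply/existsP; exists (vertex_order x); apply/and3P; split => //.
  apply/injectiveP; exact: vertex_order_inj.
rewrite -/(img (vertex_order x)) img_vertex_order.
by apply: skeleton; exact: subset_of_cardE.
Qed.

Definition poscell x : C := Sub (positive_cell x) (positive_is_cell x).
Definition negcell x : C :=
  Sub (opposite (positive_cell x)) (opposite_cell j0 (positive_is_cell x)).

Lemma card_vertices c : #|vertices (val c)| == j.+1.
Proof.
case: c => c /= /existsP[s /and3P[/injectiveP si _ /eqP->]].
by rewrite vertices_orient card_img.
Qed.

(** The unoriented cell; an oriented cell is one of the two orientations of it. *)
Definition support c : S := Sub (vertices (val c)) (card_vertices c).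

Lemma support_pos x : support (poscell x) = x.
Proof. by apply: val_inj; rewrite /= vertices_positive. Qed.

Lemma support_neg x : support (negcell x) = x.
Proof. by apply: val_inj; rewrite /= vertices_opp_positive. Qed.

Lemma pos_neq_neg x y : poscell x != negcell y.
Proof.
apply/eqP => e; have xy : x = y by rewrite -(support_pos x) e support_neg.
move: e; rewrite xy => /(congr1 val) /=; apply: orient_neq_opposite.
exact: vertex_order_inj.
Qed.

Lemma cell_cases c : c = poscell (support c) \/ c = negcell (support c).
Proof.
case: c => c cP; have /existsP[s /and3P[/injectiveP si _ /eqP cE]] := cP.
set x := support _.
have im : img (vertex_order x) = img s.
  by rewrite img_vertex_order /x /= cE vertices_orient.
have [h|h] := orient_cases (@vertex_order_inj _ _ x) si im.
  by left; apply: val_inj; rewrite /= /positive_cell -h cE.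
by right; apply: val_inj; rewrite /= /positive_cell -h cE.
Qed.

Lemma sum_cells (F : C -> R) : \sum_c F c = \sum_x (F (poscell x) + F (negcell x)).
Proof.
rewrite (partition_big support xpredT) //=; apply: eq_bigr => x _.
rewrite (bigD1 (poscell x)) /=; last by rewrite support_pos.
rewrite (bigD1 (negcell x)) /=; last by rewrite support_neg eqxx eq_sym pos_neq_neg.
rewrite big1 ?addr0 // => c /andP[/andP[/eqP cx cp] cn].
by have [e|e] := cell_cases c; move: cp cn; rewrite e cx eqxx.
Qed.

Lemma Omega_neg (f : subvs_of (Omega R X j)) x :
  vsval f (negcell x) = - vsval f (poscell x).
Proof. by apply: (OmegaP _).1; [exact: valP|]. Qed.

Lemma adjacency_pos (f : subvs_of (Omega R X j)) x :
  vsval (adjacency R X j f) (poscell x) =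
  \sum_y vsval f (poscell y) * adjacency_entry R X y x.
Proof.
rewrite adjacencyE // big_mkcond /= sum_cells; apply: eq_bigr => y _.
rewrite Omega_neg /adjacency_entry mulrBr.
rewrite -[adjacent (poscell y) _]/(adjacent_sets X (positive_cell y) (positive_cell x)).
rewrite -[adjacent (negcell y) _]/(adjacent_sets X (opposite (positive_cell y)) (positive_cell x)).
by case: adjacent_sets; case: adjacent_sets; rewrite ?mulr1 ?mulr0 ?subr0 ?addr0.
Qed.

Definition coordinates (f : subvs_of (Omega R X j)) : 'rV[R]_N :=
  \row_i vsval f (poscell (enum_val i)).

Fact coordinates_is_linear : linear coordinates.
Proof.
by move=> a f g; apply/rowP => i; rewrite !mxE linearP !ffunE.
Qed.
HB.instance Definition _ :=
  GRing.isLinear.Build R (subvs_of (Omega R X j)) 'rV[R]_N _ coordinates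
    coordinates_is_linear.

Definition of_coordinates (g : 'rV[R]_N) : subvs_of (Omega R X j) :=
  vsproj (Omega R X j) [ffun c : C =>
    (if c == poscell (support c) then g 0 (enum_rank (support c))
     else - g 0 (enum_rank (support c))) : R^o].

Lemma of_coordinatesE g : vsval (of_coordinates g) = [ffun c : C =>
    (if c == poscell (support c) then g 0 (enum_rank (support c))
     else - g 0 (enum_rank (support c))) : R^o].
Proof.
rewrite vsprojK //; apply/OmegaP => c c' cc'; rewrite !ffunE.
have sE : support c' = support c.
  have /existsP[s /and3P[_ _ /eqP cE]] := valP c; apply: val_inj.
  rewrite -[LHS]/(vertices (val c')) -[RHS]/(vertices (val c)) cc' cE.
  by rewrite vertices_opposite // vertices_orient.
have cK : val c = opposite (val c') by rewrite cc' oppositeK.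
rewrite sE; have [e|e] := cell_cases c; set x := support c in e *.
  have -> : c' = negcell x by apply: val_inj; rewrite cc' e.
  by rewrite e eqxx eq_sym (negbTE (pos_neq_neg _ _)).
have -> : c' = poscell x.
  by apply: val_inj; rewrite cc' e /= opposite_orientK.
by rewrite e eqxx eq_sym (negbTE (pos_neq_neg _ _)) opprK.
Qed.

Lemma coordinatesK : cancel coordinates of_coordinates.
Proof.
move=> f; apply: val_inj; rewrite [LHS]of_coordinatesE; apply/ffunP => c.
rewrite ffunE !mxE enum_rankK; have [->|->] := cell_cases c.
  by rewrite support_pos eqxx.
by rewrite support_neg eq_sym (negbTE (pos_neq_neg _ _)) -Omega_neg.
Qed.

Lemma of_coordinatesK : cancel of_coordinates coordinates.
Proof.
move=> g; apply/rowP => i; rewrite mxE of_coordinatesE ffunE support_pos eqxx.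
by rewrite enum_valK.
Qed.

Definition adjacency_mx : 'M[R]_N :=
  \matrix_(i, k) adjacency_entry R X (enum_val i) (enum_val k).

(** Vectors are rows here, so that the entry for [f (poscell y)] in the value at
    [poscell x] stands in row [y] and column [x]. *)
Lemma coordinates_adjacency f :
  coordinates (adjacency R X j f) = coordinates f *m adjacency_mx.
Proof.
apply/rowP => k; rewrite !mxE adjacency_pos.
rewrite (reindex (@enum_val _ {: S})) /=; last first.
  by apply: onW_bij; exists enum_rank; [exact: enum_valK|exact: enum_rankK].
by apply: eq_bigr => i _; rewrite !mxE.
Qed.

Lemma char_poly_adjacency (a : R) :
  \dim {:subvs_of (Omega R X j)} = N /\
  char_poly (passmx.mxof (vbasis {:subvs_of (Omega R X j)})
     (vbasis {:subvs_of (Omega R X j)}) (a *: adjacency R X j)) =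
  char_poly (a *: adjacency_mx).
Proof.
apply: (char_poly_coordinates (phi := coordinates) coordinatesK of_coordinatesK).
by move=> f; rewrite lfunE /= linearZ /= coordinates_adjacency scalemxAr.
Qed.

End AdjacencyMatrix.

(** * Counting subsets *)

Section CountingSubsets.
Variable V : finType.

Lemma card_subset_of_card m : #|{: subset_of_card V m}| = 'C(#|V|, m).
Proof. by rewrite card_sig -card_draws cardsE. Qed.

Lemma card_subtype_set m (Q : pred {set V}) :
  #|[set x : subset_of_card V m | Q (val x)]%SET| =
  #|[set s : {set V} | (#|s| == m) && Q s]%SET|.
Proof.
rewrite -(card_imset _ val_inj); apply: eq_card => s; rewrite inE.
apply/imsetP/andP => [[x]|[sm Qs]].
  by rewrite inE => Qx ->; split=> //; rewrite subset_of_cardE.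
by exists (Sub s sm); rewrite ?inE SubK.
Qed.

Lemma card_enum_set m (Q : pred {set V}) :
  #|[set i : 'I_#|{: subset_of_card V m}| | Q (val (enum_val i))]%SET| =
  #|[set s : {set V} | (#|s| == m) && Q s]%SET|.
Proof.
rewrite -card_subtype_set -(card_imset _ enum_val_inj).
apply: eq_card => x; rewrite inE; apply/imsetP/idP => [[k]|Qx].
  by rewrite inE => Qk ->.
by exists (enum_rank x); rewrite ?inE enum_rankK.
Qed.

Lemma card_subsets_of m (t : {set V}) :
  #|[set s : {set V} | (#|s| == m) && (s \subset t)]%SET| = 'C(#|t|, m).
Proof.
rewrite -cards_draws; apply: eq_card => s; rewrite !inE.
by rewrite andbC.
Qed.

Lemma card_supersets_of m (s : {set V}) : #|s| = m ->
  #|[set t : {set V} | (#|t| == m.+1) && (s \subset t)]%SET| = (#|V| - m)%N.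
Proof.
move=> sm; have -> : (#|V| - m)%N = #|~: s| by rewrite -sm -(cardsC s) addKn.
rewrite -[RHS](card_in_imset (f := fun x => x |: s)).
  apply: eq_card => t; rewrite inE; apply/andP/imsetP => [[/eqP tm st]|[x]].
    have /cards1P[x xE] : #|t :\: s| == 1%N.
      by rewrite cardsD (finset.setIidPr st) tm sm subSnn.
    exists x.
      have : x \in t :\: s by rewrite xE set11.
      by rewrite !inE => /andP[].
    by rewrite -xE finset.setUC -[LHS](finset.setID _ s) (finset.setIidPr st).
  rewrite inE => xs ->; rewrite cardsU1 xs sm eqxx; split=> //.
  exact: finset.subsetUr.
move=> x y; rewrite !inE => xs ys /setP/(_ x).
by rewrite !inE eqxx (negbTE xs) !orbF => /esym/eqP.
Qed.

End CountingSubsets.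

(** * The adjacency matrix as a perturbed hypergraph matrix *)

Section Model.
Variables (R : rcfType) (V : finType) (j : nat).
Hypothesis j0 : (0 < j)%N.
Local Notation S := (subset_of_card V j.+1).
Local Notation T := (subset_of_card V j.+2).
Local Notation N := #|{: S}|.
Local Notation MtoC := (map_mx (real_complex R)).

(** The blocks are indexed by the possible top cells; their points are the facets. *)
Definition facet_block (t : T) : {set 'I_N} :=
  [set i : 'I_N | val (enum_val i) \subset val t]%SET.

Definition cell_sign (a b : 'I_N) : R := face_sign R (enum_val a) (enum_val b).

Lemma cell_sign_sym a b : cell_sign a b = cell_sign b a.
Proof. exact: face_sign_sym. Qed.

Lemma cell_sign_le a b : `|cell_sign a b| <= (a != b)%:R.
Proof.
by apply: le_trans (face_sign_le _ _ _) _; rewrite (inj_eq enum_val_inj).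
Qed.

(** Two distinct facets determine the cell: the reason why the hypergraph is linear. *)
Lemma facet_union (t : T) a b : a != b ->
  a \in facet_block t -> b \in facet_block t ->
  val (enum_val a) :|: val (enum_val b) = val t.
Proof.
rewrite !inE => ab ta tb; apply/eqP; rewrite eqEcard finset.subUset ta tb /=.
rewrite subset_of_cardE ltnNge; apply/negP => le_j.
have ne : enum_val a != enum_val b :> S by rewrite (inj_eq enum_val_inj).
case/eqP: ne; apply/val_inj/eqP; rewrite eqEcard !subset_of_cardE leqnn andbT.
have : val (enum_val a) :|: val (enum_val b) == val (enum_val b).
  by rewrite eq_sym eqEcard finset.subsetUr subset_of_cardE.
by move=> /eqP <-; exact: finset.subsetUl.
Qed.

Lemma cell_sign_sqr t a b : a \in facet_block t -> b \in facet_block t ->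
  a != b -> cell_sign a b ^+ 2 = 1.
Proof.
move=> ta tb ab; apply: face_sign_sqr; first by rewrite (inj_eq enum_val_inj).
by rewrite (facet_union ab ta tb) subset_of_cardE.
Qed.

Lemma card_facet_block t : #|facet_block t| = j.+2.
Proof.
rewrite /facet_block (card_enum_set _ (fun s => s \subset val t)).
by rewrite card_subsets_of subset_of_cardE binSn.
Qed.

Lemma degree_facet a : #|[set t | a \in facet_block t]%SET| = (#|V| - j.+1)%N.
Proof.
rewrite -(card_supersets_of (subset_of_cardE (enum_val a))).
rewrite -(card_subtype_set _ (fun t => val (enum_val a) \subset t)).
by apply: eq_card => t; rewrite !inE.
Qed.

Lemma facet_linear t t' a b : a != b ->
  a \in facet_block t -> b \in facet_block t ->
  a \in facet_block t' -> b \in facet_block t' -> t = t'.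
Proof.
move=> ab ta tb ta' tb'; apply: val_inj.
by rewrite -(facet_union ab ta tb) (facet_union ab ta' tb').
Qed.

Variable X : {set {set V}}.

Definition facets_in : {ffun T -> bool} := [ffun t : T => val t \in X].

Definition incidence_row (r : subset_of_card V j) : 'rV[R]_N :=
  \row_i incidence R r (enum_val i).

Lemma sum_facets (F : T -> R) a b : a != b ->
  \sum_t F t * block_mx_of facet_block cell_sign t a b =
  (if insub (val (enum_val a) :|: val (enum_val b)) is Some t then F t else 0)
    * cell_sign a b.
Proof.
move=> ab; case: insubP => [t _ tE|card_ne]; last first.
  rewrite mul0r; apply: big1 => t _.
  by rewrite mxE /cell_sign face_sign0 ?mulr0.
rewrite (bigD1 t) //= big1 ?addr0.
  rewrite mxE !inE tE finset.subsetUl finset.subsetUr mul1r //.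
move=> t' t't; rewrite mxE.
have [/andP[ta tb]|_] := boolP ((a \in facet_block t') && _); last by rewrite mul0r mulr0.
by case/eqP: t't; apply: val_inj; rewrite tE (facet_union ab ta tb).
Qed.

(** Off the diagonal, subtracting the mean [p K] from the adjacency matrix leaves
    the centred matrix, and [K] is the Gram matrix of the incidence rows, which
    has rank at most the number of [(d-2)]-cells. *)
Lemma adjacency_mx_decomp (p s : R) a b : a != b ->
  (s *: adjacency_mx R X j) a b =
  (centred_mx facet_block cell_sign p s facets_in +
   (s * p) *: \sum_r ((incidence_row r)^T *m incidence_row r)) a b.
Proof.
move=> ab; have nev : enum_val a != enum_val b :> S by rewrite (inj_eq enum_val_inj).
rewrite !mxE !summxE adjacency_entryE //; last by rewrite eq_sym.
rewrite (eq_bigr (fun t => ((facets_in t)%:R - p) *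
  block_mx_of facet_block cell_sign t a b)); last by move=> t _; rewrite mxE.
rewrite sum_facets // -mulrA -mulrDr; congr (_ * _).
have -> : \sum_r ((incidence_row r)^T *m incidence_row r) a b = cell_sign a b.
  rewrite /cell_sign /face_sign (negbTE nev); apply: eq_bigr => r _.
  by rewrite !mxE big_ord1 !mxE.
rewrite -[face_sign _ _ _]cell_sign_sym (finset.setUC (val (enum_val b))).
case: insubP => [t tc tE|card_ne].
  by rewrite tc ffunE tE /=; ring.
by rewrite /cell_sign face_sign0 // !mulr0 addr0.
Qed.

Lemma sum_incidence_sqr_le (a : 'I_N) :
  \sum_r incidence R r (enum_val a) ^+ 2 <= j.+1%:R.
Proof.
apply: (@le_trans _ _ (\sum_(r in [set r : subset_of_card V j |
    val r \subset val (enum_val a)]%SET) 1)).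
  rewrite [leRHS]big_mkcond; apply: ler_sum => r _; rewrite inE; case: ifPn => ra.
    by rewrite incidence_sqr.
  by rewrite incidence0 // expr0n.
rewrite sumr_const (card_subtype_set _ (fun s => s \subset val (enum_val a))).
by rewrite card_subsets_of subset_of_cardE binSn.
Qed.

(** The diagonals differ by at most [s (j + 2)], which costs that much for each of
    the [N] diagonal entries, and the Gram matrix is a sum of [C(|V|, j)] rank one
    matrices, each costing at most 1. *)
Lemma mxtrace_adjacency_dist (p s e : R) : 0 <= p <= 1 -> 0 <= s -> 1 <= e ->
  (adjacency_mx R X j)^T = adjacency_mx R X j ->
  cabs (\tr (resolvent (s *: adjacency_mx R X j) e) -
        \tr (resolvent (centred_mx facet_block cell_sign p s facets_in) e)) <=
  N%:R * (s * j.+2%:R) + 'C(#|V|, j)%:R.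
Proof.
move=> /andP[p0 p1] s0 e1 symA.
have e0 : 0 < e by apply: lt_le_trans e1.
set H := centred_mx _ _ _ _ _.
have symH : H^T = H by apply: centred_mx_sym; exact: cell_sign_sym.
set B := H + (s * p) *: \sum_r ((incidence_row r)^T *m incidence_row r).
have symB : B^T = B.
  rewrite /B [LHS]linearD [X in _ + X]linearZ /= linear_sum /=.
  rewrite [H^T]symH; congr (_ + _ *: _).
  by apply: eq_bigr => r _; rewrite trmx_mul trmxK.
have symA' : (s *: adjacency_mx R X j)^T = s *: adjacency_mx R X j.
  by rewrite linearZ /= symA.
rewrite -[X in cabs (X - _)](subrK (\tr (resolvent B e))) -addrA.
apply: le_trans (cabsD _ _) _; apply: lerD.
  apply: (@le_trans _ _ (N%:R * (s * j.+2%:R / e ^+ 2))); last first.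
    rewrite ler_wpM2l ?ler0n // ler_piMr ?mulr_ge0 ?ler0n //.
    by rewrite invf_le1 ?exprn_gt0 // exprn_ege1.
  apply: mxtrace_resolvent_diag => //.
    by move=> a b ab; rewrite (adjacency_mx_decomp p s ab).
  move=> a; set z := \sum_r incidence R r (enum_val a) ^+ 2.
  set y := adjacency_entry R X (enum_val a) (enum_val a).
  have -> : (s *: adjacency_mx R X j) a a = s * y by rewrite mxE [X in _ * X]mxE.
  have Haa : H a a = 0.
    rewrite mxE summxE big1 ?mulr0 // => t _; rewrite !mxE.
    have := cell_sign_le a a; rewrite eqxx normr_le0 => /eqP ->.
    by rewrite !mulr0.
  have -> : B a a = s * p * z.
    rewrite /B mxE Haa add0r mxE summxE; congr (_ * _).
    by apply: eq_bigr => r _; rewrite mxE big_ord1 !mxE expr2.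
  have y1 : `|y| <= 1 by exact: adjacency_entry_le1.
  have z1 : z <= j.+1%:R by exact: sum_incidence_sqr_le.
  have z0 : 0 <= z by apply: sumr_ge0 => r _; exact: sqr_ge0.
  rewrite -mulrA -mulrBr normrM ger0_norm // ler_wpM2l //.
  apply: le_trans (ler_normB _ _) _; rewrite addrC -[j.+2]add1n natrD lerD //.
  by rewrite ger0_norm ?mulr_ge0 //; apply: le_trans z1; rewrite ler_piMl.
have sp0 : 0 <= s * p by rewrite mulr_ge0.
apply: le_trans (mxtrace_resolvent_low_rank symH e0 sp0 (erefl _)) _.
by rewrite card_subset_of_card ler_piMr ?ler0n // invf_le1.
Qed.

Lemma adjacency_mx_sym : (adjacency_mx R X j)^T = adjacency_mx R X j.
Proof.
apply/matrixP => a b; rewrite mxE.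
have [->//|ab] := eqVneq a b.
have := adjacency_mx_decomp 0 1 ab.
have := adjacency_mx_decomp 0 1 (b := a) (a := b); rewrite eq_sym => /(_ ab).
rewrite !scale1r mulr0 scale0r !addr0 => -> ->.
set H := centred_mx _ _ _ _ _.
have symH : H^T = H by apply: centred_mx_sym; exact: cell_sign_sym.
by rewrite -[in LHS]symH [LHS]mxE.
Qed.

End Model.

(** * Growth of binomial coefficients *)

Section BinomialBounds.

Lemma bin_ge m j : (0 < j)%N -> (j <= m)%N -> (m - j < 'C(m, j))%N.
Proof.
move=> j0; elim: m => [|m IH]; first by rewrite leqn0 => /eqP j1; rewrite j1 in j0.
rewrite leq_eqVlt => /orP[/eqP->|]; first by rewrite subnn binn.
rewrite ltnS => jm; case: j j0 jm IH => // j _ jm IH.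
have := IH jm; have : (0 < 'C(m, j))%N by rewrite bin_gt0 ltnW.
by rewrite binS; lia.
Qed.

(** For [j > 0] the number of cells grows at least quadratically, which will make the
    probabilities of deviations summable. *)
Lemma bin_ge_sqr n j : (0 < j)%N -> (j.*2 <= n)%N ->
  (n ^ 2 <= j.+1.*2 * 'C(n, j.+1))%N.
Proof.
move=> j0 jn; have n0 : (0 < n)%N by lia.
have h1 : (n.-1 - j < 'C(n.-1, j))%N by apply: bin_ge => //; lia.
have h2 := mul_bin_diag n j.
have h3 : (n <= 'C(n.-1, j).*2)%N by lia.
rewrite -doubleMl -h2 -mulnn doubleMr leq_mul2l h3 orbT //.
Qed.

Lemma bin_prev_le (R : realFieldType) n j : (j.*2 <= n)%N -> (0 < n)%N ->
  'C(n, j)%:R <= 'C(n, j.+1)%:R * (j.+1.*2%:R / n%:R) :> R.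
Proof.
move=> jn n0; rewrite mulrA ler_pdivlMr ?ltr0n // -!natrM ler_nat.
have := mul_bin_left n j.
by move: ('C(n, j)) ('C(n, j.+1)) => a b h; nia.
Qed.

End BinomialBounds.

(** * The law of the random complex *)

Section UniformProbabilities.
Variable R : realType.
Local Notation mu := (@lebesgue_measure R).

Lemma uniform_prob_sub (B : set R) (a b : R) (bl br : bool) : 
  measurable B -> B `&` `[0, 1] = [set` Interval (BSide bl a) (BSide br b)] ->
  a <= b -> uniform_prob (@ltr01 R) B = (b - a)%:E.
Proof.
move=> mB Bab ab; rewrite /uniform_prob integral_uniform_pdf.
rewrite (eq_integral (fun=> 1%:E)); last first.
  move=> x; rewrite inE => -[_]; rewrite /= in_itv /= => x01.
  by rewrite /uniform_pdf x01 subr0 invr1.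
rewrite integral_cst /=; last by apply: measurableI.
rewrite mul1e Bab lebesgue_measure_itv /= lte_fin.
move: ab; rewrite le_eqVlt => /orP[/eqP->|->]; last by rewrite EFinB.
by rewrite ltxx subrr.
Qed.

Lemma uniform_prob_le (x : R) : 0 <= x <= 1 ->
  uniform_prob (@ltr01 R) `]-oo, x]%classic = x%:E.
Proof.
move=> /andP[x0 x1].
rewrite (@uniform_prob_sub _ 0 x true false) ?subr0 //.
apply/seteqP; split=> y /=; rewrite !in_itv /=.
  by move=> [yx /andP[y0 _]]; rewrite y0.
by move=> /andP[y0 yx]; rewrite y0 yx (le_trans yx).
Qed.

Lemma uniform_prob_gt (x : R) : 0 <= x <= 1 ->
  uniform_prob (@ltr01 R) `]x, +oo[%classic = (1 - x)%:E.
Proof.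
move=> /andP[x0 x1].
rewrite (@uniform_prob_sub _ x 1 false false) //.
apply/seteqP; split=> y /=; rewrite !in_itv /= ?andbT.
  by move=> [xy /andP[_ y1]]; rewrite xy.
by move=> /andP[xy y1]; rewrite xy y1 (le_trans x0) // ltW.
Qed.

End UniformProbabilities.

Section Coupling.
Variables (R : realType) (disp : measure_display) (Om : measurableType disp).
Variables (P : probability Om R) (d : nat) (U : {fset nat} -> {RV P >-> R}).
Hypothesis U_indep :
  mutually_independent [set tau : {fset nat} | #|` tau| = d.+1] U.
Hypothesis U_unif : forall tau : {fset nat}, #|` tau| = d.+1 ->
  forall B : set R, measurable B ->
    distribution P (U tau) B = uniform_prob (@ltr01 R) B.

Definition fset_of_set n (s : {set 'I_n}) : {fset nat} :=
  [fset nat_of_ord i | i in s]%fset.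

Lemma card_fset_of_set n (s : {set 'I_n}) : #|` fset_of_set s| = #|s|.
Proof. by rewrite card_imfset //=; [rewrite -cardE|exact: val_inj]. Qed.

Lemma fset_of_set_inj n : injective (@fset_of_set n).
Proof.
move=> s s' e; apply/setP => i.
have mem (t : {set 'I_n}) : (nat_of_ord i \in fset_of_set t) = (i \in t).
  apply/imfsetP/idP => [[k /= kt /val_inj ->] //|it].
  by exists i.
by rewrite -!mem e.
Qed.

Section FixedSize.
Variables (n : nat) (p : R).
Hypothesis p01 : 0 <= p <= 1.
Local Notation T := (subset_of_card 'I_n d.+1).
Local Notation config := {ffun T -> bool}.

Definition config_of (w : Om) : config :=
  [ffun t : T => U (fset_of_set (val t)) w <= p].

(* The half-line that [U tau] has to hit for the configuration to be [c]. *)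
Let B (c : config) (tau : {fset nat}) : set R :=
  if [exists t : T, (fset_of_set (val t) == tau) && c t]
  then `]-oo, p]%classic else `]p, +oo[%classic.

Let BE c t : B c (fset_of_set (val t)) = if c t then `]-oo, p]%classic else `]p, +oo[%classic.
Proof.
rewrite /B; congr (if _ then _ else _); apply/existsP/idP => [[t' /andP[/eqP e]]|ct].
  by have /val_inj -> := fset_of_set_inj e.
by exists t; rewrite eqxx.
Qed.

Let mB c tau : measurable (B c tau).
Proof. by rewrite /B; case: ifP => _; exact: measurable_itv. Qed.

Let J : {fset {fset nat}} := [fset fset_of_set (val t) | t in {: T}]%fset.

Let atomE c : [set w | config_of w = c] =
  \bigcap_(tau in [set` J]) (U tau @^-1` B c tau).
Proof.
apply/seteqP; split=> w /=.
  move=> <- tau /= /imfsetP[t _ ->]; rewrite /= BE ffunE.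
  case: ifPn => /= h; rewrite in_itv /= ?h //.
  by rewrite andbT ltNge.
move=> h; apply/ffunP => t; rewrite ffunE.
have /h : [set` J] (fset_of_set (val t)) by apply/imfsetP; exists t.
rewrite /= BE; case: (c t); rewrite /= in_itv /=; first by [].
by rewrite andbT ltNge => /negbTE.
Qed.

Lemma measurable_config c : measurable [set w | config_of w = c].
Proof.
rewrite atomE; apply: fin_bigcap_measurable => [|tau _].
  exact: finite_fset.
rewrite -[X in measurable X]setTI; exact: measurable_funP.
Qed.

(** The event is an intersection of half-line events for distinct [tau], so that
    independence applies and the uniform law gives the factors [p] and [1 - p]. *)
Lemma prob_config c : P [set w | config_of w = c] = (weight p c)%:E.
Proof.
rewrite atomE U_indep; last 2 first.
- by move=> tau /imfsetP[t _ ->] /=; rewrite card_fset_of_set subset_of_cardE.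
- by move=> tau _; exact: mB.
rewrite big_imfset /=; last by move=> t t' _ _ /fset_of_set_inj /val_inj.
rewrite /weight big_enum /= -prodEFin; apply: eq_bigr => t _.
have card_t : #|` fset_of_set (val t)| = d.+1.
  by rewrite card_fset_of_set subset_of_cardE.
have -> : P (U (fset_of_set (val t)) @^-1` B c (fset_of_set (val t))) =
    distribution P (U (fset_of_set (val t))) (B c (fset_of_set (val t))) by [].
rewrite U_unif // BE; case: (c t); first by rewrite uniform_prob_le.
by rewrite uniform_prob_gt.
Qed.

Let config_eventE (Q : pred config) :
  [set w | Q (config_of w)] = \bigcup_(c in [set` Q]) [set w | config_of w = c].
Proof.
apply/seteqP; split=> w /=; first by move=> h; exists (config_of w).
by move=> [c Qc /= ->].
Qed.

Lemma measurable_config_event (Q : pred config) :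
  measurable [set w | Q (config_of w)].
Proof.
rewrite config_eventE; apply: fin_bigcup_measurable => [|c _].
  exact: finite_finset.
exact: measurable_config.
Qed.

Lemma prob_config_event (Q : pred config) :
  P [set w | Q (config_of w)] = (\sum_(c | Q c) weight p c)%:E.
Proof.
rewrite config_eventE measure_fin_bigcup //=.
- rewrite -sumEFin [RHS]bigfs ?index_enum_uniq //=.
    by apply: eq_fsbigr => c _; exact: prob_config.
  by move=> c _; rewrite mem_index_enum.
- by move=> c c' _ _ [w [/= <- <-]].
- by move=> c _; exact: measurable_config.
Qed.

End FixedSize.
End Coupling.
Arguments config_of {R disp Om P} d U n p w.

(** * Almost sure convergence of the Stieltjes transforms *)

(** The Borel-Cantelli lemma; the majorant is of order [1 / n^2] and telescopes, so that
    its sum needs no further argument. *)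
Lemma ae_eventually_not (R : realType) (disp : measure_display)
    (Om : measurableType disp) (P : probability Om R) (F : (set Om)^nat) (K : R) :
  0 <= K -> (forall n, measurable (F n)) ->
  (forall n, P (F n) <= (K * (n.+1%:R^-1 - n.+2%:R^-1))%:E)%E ->
  {ae P, forall w, \forall n \near \oo, ~ F n w}.
Proof.
move=> K0 mF PF.
have : P (lim_sup_set F) = 0%E.
  apply: lim_sup_set_cvg0 => //.
  apply: (@le_lt_trans _ _ K%:E); last exact: ltry.
  apply: lime_le; first by apply: is_cvg_nneseries => n _ _; exact: measure_ge0.
  apply: nearW => m; rewrite big_mkord.
  apply: (@le_trans _ _ (\sum_(n < m) (K * (n.+1%:R^-1 - n.+2%:R^-1))%:E)%E).
    by apply: lee_sum => n _; exact: PF.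
  rewrite sumEFin lee_fin -mulr_sumr ler_piMr //.
  have -> : \sum_(i < m) (i.+1%:R^-1 - i.+2%:R^-1) = 1 - m.+1%:R^-1 :> R.
    elim: m => [|m IH]; first by rewrite big_ord0 invr1 subrr.
    by rewrite big_ord_recr /= IH addrA subrK.
  by rewrite gerBl invr_ge0.
move=> P0; exists (lim_sup_set F); split => //.
  apply: bigcap_measurable => // k _.
  by apply: bigcup_measurable => i /= _; exact: mF.
move=> w /= notev k _ /=; apply: contrapT => h; apply: notev.
by exists k => // n /= kn Fw; apply: h; exists n.
Qed.

Section StieltjesConvergence.
Variables (R : realType) (disp : measure_display) (Om : measurableType disp).
Variables (P : probability Om R) (j : nat) (U : {fset nat} -> {RV P >-> R}).
Variable p : nat -> R.
Hypothesis j0 : (0 < j)%N.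
Hypothesis p01 : forall n : nat, 0 <= p n <= 1.
Hypothesis U_indep :
  mutually_independent [set tau : {fset nat} | #|` tau| = j.+2] U.
Hypothesis U_unif : forall tau : {fset nat}, #|` tau| = j.+2 ->
  forall B : set R, measurable B ->
    distribution P (U tau) B = uniform_prob (@ltr01 R) B.
Let q n := p n * (1 - p n).
Hypothesis nq_oo : n%:R * q n @[n --> \oo] --> +oo.

Definition edge_scale n : R := (Num.sqrt (j.+1%:R * n%:R * q n))^-1.
Local Notation s := edge_scale.
Local Notation X w n := (LM_complex j.+1 (fun tau => U tau w <= p n) n).
Local Notation N n := #|{: subset_of_card 'I_n j.+1}|.
Local Notation k := (j.+2%:R : R).

Lemma cards_cells n : N n = 'C(n, j.+1).
Proof. by rewrite card_subset_of_card card_ord. Qed.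

Definition trace_res e n (c : {ffun subset_of_card 'I_n j.+2 -> bool}) : R[i] :=
  \tr (resolvent (centred_mx (@facet_block _ j) (@cell_sign R _ j) (p n) (s n) c) e).

Definition fluctuation e n (c : {ffun subset_of_card 'I_n j.+2 -> bool}) : R :=
  cabs (trace_res e c - expect ((p n)%:C)%C (@trace_res e n)).

Lemma facets_in_config w n : facets_in j (X w n) = config_of j.+1 U n (p n) w.
Proof.
apply/ffunP => t; rewrite !ffunE inE subset_of_cardE ltnn eqxx /=.
by [].
Qed.

(* For such [n] the scale is at most 1 and the binomial estimates hold. *)
Let good n := (1 <= n%:R * q n) && (j.+1.*2 <= n)%N.

Let good_near : \forall n \near \oo, good n.
Proof.
near=> n; apply/andP; split; near: n; last exact: nbhs_infty_ge.
by move/cvgryPge: nq_oo; apply.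
Unshelve. all: by end_near. Qed.

Section Good.
Variable n : nat.
Hypothesis gn : good n.

Let n0 : (0 < n)%N. Proof. by case/andP: gn => _; lia. Qed.

Let dnq1 : 1 <= j.+1%:R * n%:R * q n.
Proof.
have /andP[nq _] := gn; rewrite -mulrA; apply: (le_trans nq).
by rewrite ler_peMl ?ler1n // (le_trans ler01 nq).
Qed.

Lemma edge_scale_gt0 : 0 < s n.
Proof. by rewrite invr_gt0 sqrtr_gt0 (lt_le_trans ltr01 dnq1). Qed.

Lemma edge_scale_le1 : s n <= 1.
Proof.
rewrite invf_le1 ?sqrtr_gt0 ?(lt_le_trans ltr01 dnq1) //.
by rewrite -[leLHS]sqrtr1 ler_sqrt // (le_trans ler01 dnq1).
Qed.

Lemma edge_scaleE : s n ^+ 2 * (p n * (1 - p n)) * (j.+1 * n)%:R = 1.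
Proof.
rewrite /edge_scale exprVn sqr_sqrtr ?(le_trans ler01 dnq1) // -/(q n) natrM.
rewrite -mulrA [q n * _]mulrC mulVf //.
by rewrite gt_eqF // (lt_le_trans ltr01 dnq1).
Qed.

Let N0 : 0 < (N n)%:R :> R.
Proof.
rewrite ltr0n cards_cells bin_gt0; case/andP: gn => _; lia.
Qed.

Variable e : R.
Hypothesis e2 : 2 <= e.

Let dist_mean m : 1 + (0 +i* e)%C * m + m ^+ 2 = 0 -> cabs m <= 1 / 2 ->
  cabs (expect ((p n)%:C)%C (@trace_res e n) - (N n)%:R * m) <=
  (N n)%:R * (25 * k ^+ 10 * s n).
Proof.
move=> mE m2; apply: (expect_mxtrace_dist (n := n) (D := (n - j.+1)%N)) => //.
- exact: cell_sign_sym.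
- exact: cell_sign_le.
- exact: cell_sign_sqr.
- exact: card_facet_block.
- by move=> a; rewrite degree_facet card_ord.
- exact: facet_linear.
- exact: edge_scale_gt0.
- exact: edge_scale_le1.
- exact: edge_scaleE.
- exact: leq_subr.
Qed.

Let var_trace : cvar (p n) (@trace_res e n) <= (N n)%:R * k ^+ 4.
Proof.
apply: (cvar_mxtrace (n := n) (D := (n - j.+1)%N)) => //.
- exact: cell_sign_sym.
- exact: cell_sign_le.
- exact: card_facet_block.
- by move=> a; rewrite degree_facet card_ord.
- exact: edge_scale_gt0.
- exact: edge_scaleE.
- exact: leq_subr.
Qed.

(** Chebyshev with variance [O(N)] leaves a probability [O(1 / N)], and [N] is at
    least of order [n^2]. *)
Lemma prob_deviation eps : 0 < eps ->
  (P [set w | (eps * (N n)%:R <= fluctuation e (config_of j.+1 U n (p n) w))%R] <=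
   (k ^+ 4 / eps ^+ 2 * (12 * j.+1%:R) * (n.+1%:R^-1 - n.+2%:R^-1))%:E)%E.
Proof.
move=> eps0.
rewrite (prob_config_event U_indep U_unif (p01 n)
  (fun c => (eps * (N n)%:R <= fluctuation e c)%R)) lee_fin.
apply: le_trans (expect_chebyshev (p01 n) _ _) _; first by rewrite mulr_gt0.
apply: (@le_trans _ _ ((N n)%:R * k ^+ 4 / (eps * (N n)%:R) ^+ 2)).
  by rewrite ler_wpM2r // invr_ge0 sqr_ge0.
have -> : (N n)%:R * k ^+ 4 / (eps * (N n)%:R) ^+ 2 =
    k ^+ 4 / eps ^+ 2 * (N n)%:R^-1.
  by field; rewrite !gt_eqF.
rewrite -[leRHS]mulrA ler_wpM2l ?mulr_ge0 ?exprn_ge0 ?invr_ge0 ?exprn_ge0 ?(ltW eps0) //.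
have nn0 : 0 < n%:R :> R by rewrite ltr0n.
have n1 : 1 <= n%:R :> R by rewrite ler1n.
have Nn : n%:R ^+ 2 <= 2 * j.+1%:R * (N n)%:R :> R.
  have jn : (j.*2 <= n)%N by case/andP: gn => _; lia.
  have := bin_ge_sqr j0 jn; rewrite -(ler_nat R) -muln2 -mulnn !natrM cards_cells expr2.
  by rewrite [j.+1%:R * _]mulrC.
apply: (@le_trans _ _ (2 * j.+1%:R / n%:R ^+ 2)).
  by rewrite ler_pdivlMr ?exprn_gt0 // mulrC ler_pdivrMr.
rewrite -[12](_ : 2 * 6 = _); last by ring.
rewrite [2 * 6 * _]mulrAC -[leRHS]mulrA ler_wpM2l ?mulr_ge0 //.
have -> : n.+1%:R^-1 - n.+2%:R^-1 = (n.+1%:R * n.+2%:R)^-1 :> R.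
  have -> : n.+2%:R = n.+1%:R + 1 :> R by rewrite natr1.
  have a0 : n.+1%:R != 0 :> R by rewrite pnatr_eq0.
  have b0 : n.+1%:R + 1 != 0 :> R by rewrite natr1 pnatr_eq0.
  by move: (n.+1%:R : R) a0 b0 => a a0 b0; field; apply/andP; split.
rewrite ler_pdivlMr ?mulr_gt0 ?ltr0n // mulrC ler_pdivrMr ?exprn_gt0 //.
have -> : n.+2%:R = n%:R + 2 :> R by rewrite -natrD addn2.
by rewrite -natr1; nra.
Qed.

(** The three sources of error: the perturbation that makes the matrix centred, the
    fluctuation of the trace, and the bias of its mean. *)
Lemma dist_trace w m eps : 1 + (0 +i* e)%C * m + m ^+ 2 = 0 -> cabs m <= 1 / 2 ->
  fluctuation e (config_of j.+1 U n (p n) w) <= eps * (N n)%:R ->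
  cabs (\tr (resolvent (s n *: adjacency_mx R (X w n) j) e) / (N n)%:R - m) <=
  eps + 26 * k ^+ 10 * s n + 2 * j.+1%:R / n%:R.
Proof.
move=> mE m2; rewrite /fluctuation => hw; rewrite -(ler_pM2l N0).
set t := \tr _; have -> : (N n)%:R * cabs (t / (N n)%:R - m) = cabs (t - (N n)%:R * m).
  have NC : (N n)%:R != 0 :> R[i] by rewrite pnatr_eq0 -lt0n -(ltr0n R).
  have -> : t - (N n)%:R * m = (((N n)%:R : R)%:C)%C * (t / (N n)%:R - m).
    rewrite (rmorph_nat (real_complex R)) mulrBr; congr (_ - _).
    by rewrite mulrCA divff ?mulr1.
  by rewrite cabsM cabs_real ger0_norm // ltW.
have e1 : 1 <= e by apply: le_trans e2; rewrite ler1n.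
have h1 := mxtrace_adjacency_dist j0 (X := X w n) (p01 n) (ltW edge_scale_gt0) e1
  (adjacency_mx_sym R j0 (X w n)).
rewrite facets_in_config -/t -/(trace_res e _) card_ord in h1.
have h2 := dist_mean mE m2.
set u := trace_res e _ in h1 hw; set v := expect _ _ in h2 hw.
have h3 : ('C(n, j))%:R <= (N n)%:R * (2 * j.+1%:R / n%:R) :> R.
  rewrite cards_cells; have := @bin_prev_le R n j.
  rewrite -(mul2n j.+1) natrM; apply => //.
  by case/andP: gn => _; lia.
have -> : t - (N n)%:R * m = (t - u) + ((u - v) + (v - (N n)%:R * m)).
  by rewrite !addrA !subrK.
apply: le_trans (cabsD _ _) _.
have := cabsD (u - v) (v - (N n)%:R * m).
have kk : k <= k ^+ 10 by rewrite ler_eXnr // ler1n.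
have : (N n)%:R * (s n * k) <= (N n)%:R * (s n * k ^+ 10).
  by rewrite ler_wpM2l ?ler0n // ler_wpM2l // ltW // edge_scale_gt0.
lra.
Qed.

End Good.

Let edge_scale_cvg0 eps : 0 < eps -> \forall n \near \oo, s n <= eps.
Proof.
move=> eps0; near=> n.
have h : eps^-1 ^+ 2 <= n%:R * q n.
  by near: n; move/cvgryPge: nq_oo; apply.
have h' : eps^-1 ^+ 2 <= j.+1%:R * n%:R * q n.
  apply: (le_trans h); rewrite -mulrA ler_peMl ?ler1n //.
  exact: (le_trans (sqr_ge0 _) h).
rewrite /edge_scale -[eps]invrK lef_pV2 ?posrE ?invr_gt0 ?sqrtr_gt0 //; last first.
  by apply: lt_le_trans h'; rewrite exprn_gt0 ?invr_gt0.
rewrite -[leLHS]ger0_norm ?invr_ge0 ?(ltW eps0) // -sqrtr_sqr ler_sqrt //.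
by apply: le_trans h'; exact: sqr_ge0.
Unshelve. all: by end_near. Qed.

(** For each of the thresholds [1 / (i + 1)] the deviations from the mean exceed it
    finitely often only, and the other errors vanish deterministically. *)
Lemma ae_stieltjes e m : 2 <= e ->
  1 + (0 +i* e)%C * m + m ^+ 2 = 0 -> cabs m <= 1 / 2 ->
  {ae P, forall w,
    cabs (\tr (resolvent (s n *: adjacency_mx R (X w n) j) e) / (N n)%:R - m)
      @[n --> \oo] --> (0 : R)}.
Proof.
move=> e2 mE m2.
pose dev (i n : nat) := [set w : Om | good n /\
  i.+1%:R^-1 * (N n)%:R <= fluctuation e (config_of j.+1 U n (p n) w)].
have dev_good i n : good n -> dev i n =
    [set w | (i.+1%:R^-1 * (N n)%:R <= fluctuation e (config_of j.+1 U n (p n) w))%R].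
  by move=> gn; apply/seteqP; split=> w /=; [case|].
have dev_bad i n : ~~ good n -> dev i n = set0.
  by move=> ngn; apply/seteqP; split=> w //= -[gn]; rewrite gn in ngn.
have ae_dev i : {ae P, forall w, \forall n \near \oo, ~ dev i n w}.
  have i0 : 0 < i.+1%:R^-1 :> R by rewrite invr_gt0.
  apply: (ae_eventually_not (K := k ^+ 4 / i.+1%:R^-1 ^+ 2 * (12 * j.+1%:R))).
  - by rewrite !mulr_ge0 ?exprn_ge0 ?invr_ge0 ?exprn_ge0 ?(ltW i0) ?ler0n.
  - move=> n; have [gn|/dev_bad->//] := boolP (good n); rewrite dev_good //.
    exact: (measurable_config_event U (p n)
      (fun c => (i.+1%:R^-1 * (N n)%:R <= fluctuation e c)%R)).
  - move=> n; have [gn|/dev_bad->] := boolP (good n).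
      by rewrite dev_good //; exact: prob_deviation.
    rewrite measure0 lee_fin !mulr_ge0 ?exprn_ge0 ?invr_ge0 ?exprn_ge0 ?(ltW i0) ?ler0n //.
    by rewrite subr_ge0 lef_pV2 ?posrE ?ltr0n // ler_nat.
have := ae_foralln ae_dev; apply: filterS => w hw.
apply/cvgr0Pnorm_le => eps eps0.
have eps3 : 0 < eps / 3 by rewrite divr_gt0.
have [i i_eps] : exists i : nat, i.+1%:R^-1 <= eps / 3 :> R.
  exists (Num.truncn (eps / 3)^-1); rewrite -[leRHS]invrK lef_pV2 ?posrE ?invr_gt0 ?ltr0n //.
  by apply/ltW/truncnS_gt.
have K0 : 0 < 26 * k ^+ 10 by rewrite mulr_gt0 // exprn_gt0.
near=> n.
rewrite ger0_norm ?cabs_ge0 //.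
have gn : good n by near: n; exact: good_near.
have ndev : ~ dev i n w by near: n; exact: hw.
have s_small : s n <= eps / 3 / (26 * k ^+ 10).
  by near: n; apply: edge_scale_cvg0; rewrite divr_gt0.
have n_big : 2 * j.+1%:R / (eps / 3) <= n%:R.
  by near: n; exact: nbhs_infty_ger.
apply: le_trans (dist_trace (eps := i.+1%:R^-1) gn e2 mE m2 _) _.
  by rewrite leNgt; apply/negP => /ltW h; apply: ndev.
have n0 : 0 < n%:R :> R.
  by apply: lt_le_trans n_big; rewrite divr_gt0 // mulr_gt0.
rewrite ler_pdivlMr // in s_small.
rewrite ler_pdivrMr // in n_big.
have n_small : 2 * j.+1%:R / n%:R <= eps / 3.
  by rewrite ler_pdivrMr // [leRHS]mulrC.
have -> : eps = eps / 3 + eps / 3 + eps / 3 by field.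
by apply: lerD n_small; apply: lerD; rewrite // mulrC.
Unshelve. all: by end_near. Qed.

End StieltjesConvergence.

(** * Weierstrass approximation *)

Section Weierstrass.
Variable R : realType.

(** By compactness of [[0, 1]]; the second point may lie outside the interval. *)
Lemma heine_cantor01 (phi : R -> R) (eps : R) : continuous phi -> 0 < eps ->
  exists2 del, 0 < del & forall x y, 0 <= x <= 1 -> `|x - y| < del ->
    `|phi x - phi y| <= eps.
Proof.
move=> cphi eps0.
have cK : compact `[0, 1 : R] by exact: segment_compact.
have /compact_near_coveringP nc := cK.
have := nc R ((0 : R)^'+) (fun del x => forall y, `|x - y| < del ->
  `|phi x - phi y| <= eps) _.
case.
  move=> x _; have e2 : 0 < eps / 2 by rewrite divr_gt0.
  have /cvgrPdist_le/(_ _ e2) := cphi x; move=> /nbhs_ballP[r /= r0 phi_r].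
  have r2 : 0 < r / 2 by rewrite divr_gt0.
  exists (ball x (r / 2), [set del | 0 < del < r / 2]).
    split; first by exact: nbhsx_ballx.
    by near=> del; apply/andP; split; near: del; [exact: nbhs_right_gt|exact: nbhs_right_lt].
  move=> [x' del] /= [xx' /andP[_ delr]] y x'y.
  move: xx'; rewrite /ball /= => xx'.
  have h1 : `|phi x - phi x'| <= eps / 2.
    apply: phi_r; rewrite /ball /=; lra.
  have h2 : `|phi x - phi y| <= eps / 2.
    apply: phi_r; rewrite /ball /= -[x - y](subrKA x').
    apply: le_lt_trans (ler_normD _ _) _; lra.
  rewrite -[phi x' - phi y](subrKA (phi x)); apply: le_trans (ler_normD _ _) _.
  by rewrite distrC; lra.
move=> del /= del0 h; exists (del / 2); first by rewrite divr_gt0.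
have del2 : 0 < del / 2 by rewrite divr_gt0.
have := h (del / 2); rewrite /= sub0r normrN gtr0_norm // => h'.
by move=> x y x01 xy; apply: h' => //; lra.
Unshelve. all: by end_near. Qed.

(** Bernstein's proof: the polynomial is the mean of [phi] at the empirical
    frequency of [n] independent trials of success probability [v], which
    concentrates at [v] by the Efron-Stein inequality. *)
Lemma weierstrass (phi : R -> R) (M eps : R) : continuous phi ->
  (forall x, `|phi x| <= M) -> 0 < eps ->
  exists P : {poly R}, forall v, 0 <= v <= 1 -> `|phi v - P.[v]| <= eps.
Proof.
move=> cphi phiM eps0.
have e2 : 0 < eps / 2 by rewrite divr_gt0.
have [del del0 unif] := heine_cantor01 cphi e2.
have M0 : 0 <= M by apply: le_trans (phiM 0).
pose n := (Num.truncn (2 * M / del ^+ 2 / (eps / 2))).+1.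
have n0 : 0 < n%:R :> R by rewrite ltr0n.
have n_big : 2 * M / del ^+ 2 / n%:R <= eps / 2.
  rewrite ler_pdivrMr // [leRHS]mulrC -ler_pdivrMr //.
  by rewrite /n; apply/ltW/truncnS_gt.
pose freq (c : {ffun 'I_n -> bool}) : R := n%:R^-1 * \sum_t (c t)%:R.
exists (\sum_c (phi (freq c))%:P * \prod_(t < n) (if c t then 'X else 1 - 'X)).
move=> v v01.
have -> : (\sum_c (phi (freq c))%:P * \prod_(t < n) (if c t then 'X else 1 - 'X)).[v] =
    expect v (fun c => phi (freq c)).
  rewrite horner_sum; apply: eq_bigr => c _.
  rewrite hornerM hornerC mulrC horner_prod; congr (_ * _).
  by apply: eq_bigr => t _; case: ifP => _; rewrite ?hornerE.
have meanE : expect v freq = v.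
  rewrite /freq expectZ expect_sum (eq_bigr (fun=> v)) => [|t _].
    by rewrite sumr_const card_ord -[v *+ n]mulr_natl mulKf // gt_eqF.
  have := expect_by_parts v t (fun=> 1); rewrite subrr expect_cst mulr0.
  rewrite (eq_expect _ (F' := fun c => (c t)%:R - v)) => [|c]; last by rewrite mulr1.
  by rewrite expectB expect_cst => /eqP; rewrite subr_eq0 => /eqP.
have varE : expect v (fun c => (freq c - v) ^+ 2) <= n%:R^-1.
  have -> : expect v (fun c => (freq c - v) ^+ 2) =
      expect v (fun c => freq c ^+ 2) - expect v freq ^+ 2.
    rewrite meanE (eq_expect _ (F' := fun c => freq c ^+ 2 - (2 * v * freq c - v ^+ 2))).
      rewrite (expectB _ (fun c => freq c ^+ 2) (fun c => 2 * v * freq c - v ^+ 2)).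
      rewrite (expectB _ (fun c => 2 * v * freq c) (fun=> v ^+ 2)).
      by rewrite expectZ expect_cst meanE; ring.
    by move=> c; ring.
  apply: le_trans (efron_stein v01 _) _.
  have dE t : sqr_diff v freq t = n%:R^-1 ^+ 2.
    rewrite /sqr_diff (eq_expect _ (F' := fun=> n%:R^-1 ^+ 2)) ?expect_cst // => c.
    rewrite /freq -mulrBr -sumrB (bigD1 t) //= !updE big1 ?addr0 ?subr0 ?mulr1 //.
    by move=> u ut; rewrite !updNE // subrr.
  rewrite (eq_bigr _ (fun t _ => dE t)) sumr_const card_ord -[_ *+ n]mulr_natl.
  rewrite expr2 mulVKf ?gt_eqF // ler_piMl ?invr_ge0 ?(ltW n0) //.
  by case/andP: v01 => v0 v1; rewrite mulr_ile1 ?subr_ge0 // gerBl.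
have -> : phi v - expect v (fun c => phi (freq c)) =
    expect v (fun c => phi v - phi (freq c)).
  by rewrite (expectB v (fun=> phi v)) expect_cst.
have pt c : `|phi v - phi (freq c)| <=
    eps / 2 + 2 * M / del ^+ 2 * (freq c - v) ^+ 2.
  have K0 : 0 <= 2 * M / del ^+ 2 by rewrite divr_ge0 ?mulr_ge0 ?exprn_ge0 // ltW.
  have [close|far] := ltrP `|v - freq c| del.
    by apply: le_trans (unif _ _ v01 close) _; rewrite lerDl mulr_ge0 ?sqr_ge0.
  have h1 : 1 <= (freq c - v) ^+ 2 / del ^+ 2.
    rewrite ler_pdivlMr ?exprn_gt0 // mul1r -[leRHS]real_normK ?num_real //.
    by rewrite distrC ler_pXn2r ?nnegrE // ltW.
  have h2 : `|phi v - phi (freq c)| <= 2 * M.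
    apply: le_trans (ler_normB _ _) _; have := phiM v; have := phiM (freq c); lra.
  have : 2 * M * 1 <= 2 * M * ((freq c - v) ^+ 2 / del ^+ 2).
    by rewrite ler_wpM2l // mulr_ge0.
  rewrite mulr1 mulrCA mulrA => h3; lra.
have h : expect v (fun c => `|phi v - phi (freq c)|) <= eps.
  apply: le_trans (le_expect v01 pt) _.
  rewrite (expectD _ (fun=> eps / 2) (fun c => 2 * M / del ^+ 2 * (freq c - v) ^+ 2)).
  rewrite expect_cst expectZ.
  have : 2 * M / del ^+ 2 * expect v (fun c => (freq c - v) ^+ 2) <=
      2 * M / del ^+ 2 * n%:R^-1.
    by rewrite ler_wpM2l // divr_ge0 ?mulr_ge0 ?exprn_ge0 // ltW.
  lra.
apply: le_trans h; rewrite ler_norml; apply/andP; split.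
  rewrite lerNl -[- expect _ _]mulN1r -expectZ; apply: le_expect => // c.
  by rewrite mulN1r; apply: le_trans (ler_norm _) _; rewrite normrN.
by apply: le_expect => // c; exact: ler_norm.
Qed.

End Weierstrass.

(** * From resolvent kernels to weak convergence *)

Section Means.
Variable R : realType.
Implicit Types f g : R -> R.

Definition bounded_continuous f := continuous f /\ exists M, forall x, `|f x| <= M.

Lemma bounded_continuous_cst (a : R) : bounded_continuous (fun=> a).
Proof. by split; [move=> x; exact: cvg_cst|exists `|a|]. Qed.

Lemma bounded_continuousD f g : bounded_continuous f -> bounded_continuous g ->
  bounded_continuous (fun x => f x + g x).
Proof.
move=> [cf [M fM]] [cg [M' gM]]; split; first by move=> x; apply: cvgD; [exact: cf|exact: cg].
by exists (M + M') => x; apply: le_trans (ler_normD _ _) _; rewrite lerD.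
Qed.

Lemma bounded_continuousM f g : bounded_continuous f -> bounded_continuous g ->
  bounded_continuous (fun x => f x * g x).
Proof.
move=> [cf [M fM]] [cg [M' gM]]; split; first by move=> x; apply: cvgM; [exact: cf|exact: cg].
by exists (M * M') => x; rewrite normrM ler_pM.
Qed.

Lemma bounded_continuousB f g : bounded_continuous f -> bounded_continuous g ->
  bounded_continuous (fun x => f x - g x).
Proof.
move=> bf bg; have -> : (fun x => f x - g x) = (fun x => f x + (-1) * g x).
  by apply/funext => x; rewrite mulN1r.
exact: bounded_continuousD (bounded_continuousM (bounded_continuous_cst _) bg).
Qed.

(** Integration against a measure of mass at most one, as far as bounded
    continuous functions are concerned. *)
Record mean (L : (R -> R) -> R) : Prop := Mean {
  meanD : forall f g, bounded_continuous f -> bounded_continuous g ->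
    L (fun x => f x + g x) = L f + L g;
  meanZ : forall a f, bounded_continuous f -> L (fun x => a * f x) = a * L f;
  mean_le : forall f g, bounded_continuous f -> bounded_continuous g ->
    (forall x, f x <= g x) -> L f <= L g;
  mean1 : L (fun=> 1) <= 1 }.

Lemma meanB L : mean L -> forall f g, bounded_continuous f ->
  bounded_continuous g -> L (fun x => f x - g x) = L f - L g.
Proof.
move=> mL f g bf bg; have -> : (fun x => f x - g x) = (fun x => f x + (-1) * g x).
  by apply/funext => x; rewrite mulN1r.
rewrite (meanD mL) // ?(meanZ mL) ?mulN1r //.
exact: bounded_continuousM (bounded_continuous_cst _) bg.
Qed.

Lemma mean_norm_le L : mean L -> forall f M, bounded_continuous f ->
  (forall x, `|f x| <= M) -> `|L f| <= M.
Proof.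
move=> mL f M bf fM; have M0 : 0 <= M by apply: le_trans (fM 0).
have b1 := bounded_continuous_cst 1.
have bM a : bounded_continuous (fun=> a * 1).
  exact: (bounded_continuousM (bounded_continuous_cst a) b1).
have LM : L (fun=> M * 1) <= M by rewrite (meanZ mL) // ler_piMr // (mean1 mL).
rewrite ler_norml; apply/andP; split; last first.
  apply: le_trans LM; apply: (mean_le mL) => // x; rewrite mulr1.
  exact: le_trans (ler_norm _) (fM x).
apply: (@le_trans _ _ (L (fun=> (- M) * 1))).
  by rewrite (meanZ mL) // mulNr lerN2 ler_piMr // (mean1 mL).
apply: (mean_le mL) => // x; rewrite mulr1 lerNl.
by apply: le_trans (fM x); rewrite -normrN; exact: ler_norm.
Qed.

Lemma mean_dominated L : mean L -> forall f g, bounded_continuous f ->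
  bounded_continuous g -> (forall x, `|f x| <= g x) -> `|L f| <= L g.
Proof.
move=> mL f g bf bg fg; rewrite ler_norml; apply/andP; split; last first.
  by apply: (mean_le mL) => // x; apply: le_trans (fg x); exact: ler_norm.
rewrite -[- L g]mulN1r -(meanZ mL) //; apply: (mean_le mL) => //.
  exact: bounded_continuousM (bounded_continuous_cst _) bg.
move=> x; rewrite mulN1r lerNl; apply: le_trans (fg x).
by rewrite -normrN; exact: ler_norm.
Qed.

Lemma bounded_kernel_even (t : R) : 0 < t ->
  bounded_continuous (fun x : R => (x ^+ 2 + t)^-1).
Proof.
move=> t0; have den (x : R) : 0 < x ^+ 2 + t by rewrite ltr_wpDl ?sqr_ge0.
split.
  move=> x; apply: cvgV; first by rewrite gt_eqF.
  by apply: cvgD; [exact: exprn_continuous|exact: cvg_cst].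
exists t^-1 => x; rewrite ger0_norm ?invr_ge0 ?(ltW (den x)) //.
by rewrite lef_pV2 ?posrE // lerDr sqr_ge0.
Qed.

Lemma bounded_kernel_odd (t : R) : 0 < t ->
  bounded_continuous (fun x : R => x * (x ^+ 2 + t)^-1).
Proof.
move=> t0; have den (x : R) : 0 < x ^+ 2 + t by rewrite ltr_wpDl ?sqr_ge0.
split.
  by move=> x; apply: cvgM; [exact: cvg_id|exact: (bounded_kernel_even t0).1].
(* [2 t |x| <= x^2 + t^2 <= (1 + t) (x^2 + t)] *)
exists ((1 + t) / (2 * t)) => x.
rewrite normrM [ `|_^-1| ]ger0_norm ?invr_ge0 ?(ltW (den x)) //.
rewrite ler_pdivrMr // mulrAC ler_pdivlMr ?mulr_gt0 //.
rewrite -[x ^+ 2]real_normK ?num_real //.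
by have := sqr_ge0 (`|x| - t); have := sqr_ge0 (`|x| - 1); have := normr_ge0 x; nra.
Qed.

Section Convergence.
Variables (L : nat -> (R -> R) -> R) (L0 : (R -> R) -> R).
Hypotheses (mL : forall n, mean (L n)) (mL0 : mean L0).

Definition converges f := bounded_continuous f /\ (L n f @[n --> \oo] --> L0 f).

Lemma convergesD f g : converges f -> converges g -> converges (fun x => f x + g x).
Proof.
move=> [bf cf] [bg cg]; split; first exact: bounded_continuousD.
rewrite (meanD mL0) //; under eq_fun do rewrite (meanD (mL _)) //.
exact: cvgD.
Qed.

Lemma convergesZ a f : converges f -> converges (fun x => a * f x).
Proof.
move=> [bf cf]; split; first exact: bounded_continuousM (bounded_continuous_cst _) bf.
rewrite (meanZ mL0) //; under eq_fun do rewrite (meanZ (mL _)) //.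
exact: cvgMr.
Qed.

Lemma converges_uniform f : bounded_continuous f ->
  (forall eps, 0 < eps -> exists2 g, converges g & forall x, `|f x - g x| <= eps) ->
  converges f.
Proof.
move=> bf happrox; split => //; apply/cvgrPdist_le => eps eps0.
have eps3 : 0 < eps / 3 by rewrite divr_gt0.
have [g [bg cg] fg] := happrox _ eps3.
have bfg := bounded_continuousB bf bg.
have h0 := mean_norm_le mL0 bfg fg; rewrite (meanB mL0) // in h0.
move/cvgrPdist_le: cg => /(_ _ eps3); apply: filterS => n hn.
have hn' := mean_norm_le (mL n) bfg fg; rewrite (meanB (mL n)) // in hn'.
have -> : L0 f - L n f = (L0 f - L0 g) + ((L0 g - L n g) - (L n f - L n g)) by ring.
apply: le_trans (ler_normD _ _) _.
have := ler_normB (L0 g - L n g) (L n f - L n g); lra.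
Qed.

Variable t : nat -> R.
Hypotheses (t_ge4 : forall i, 4 <= t i) (t_inj : injective t).
Hypothesis t_cvg : forall del, 0 < del -> exists m, forall i, (m <= i)%N -> t i - 4 <= del.
Hypothesis kernel_even : forall i, converges (fun x => (x ^+ 2 + t i)^-1).
Hypothesis kernel_odd : forall i, converges (fun x => x * (x ^+ 2 + t i)^-1).

Definition kernels (s : seq nat) (x : R) : R := \prod_(i <- s) (x ^+ 2 + t i)^-1.

Let den_gt0 i x : 0 < x ^+ 2 + t i.
Proof. by have := sqr_ge0 x; have := t_ge4 i; lra. Qed.

(** Partial fractions: the difference of two kernels is a multiple of their
    product. *)
Let kernels_converge (w : R -> R) s :
  (forall i, converges (fun x => w x * (x ^+ 2 + t i)^-1)) ->
  s != [::] -> uniq s -> converges (fun x => w x * kernels s x).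
Proof.
move=> cw; move: {2}(size s) (leqnn (size s)) => k; elim: k s => [|k IH] s.
  by rewrite leqn0 size_eq0 => ->.
case: s => // i [_ _ _|l r].
  by have := cw i; congr converges; apply/funext => x; rewrite /kernels big_seq1.
rewrite ltnS => sk _ us.
have til : t i != t l.
  by apply/eqP => /t_inj il; move: us; rewrite /= il inE eqxx.
have c1 : converges (fun x => w x * kernels (i :: r) x).
  apply: IH => //; move: us; rewrite /= inE negb_or.
  by move=> /andP[/andP[_ ->] /andP[_ ->]].
have c2 : converges (fun x => w x * kernels (l :: r) x).
  by apply: IH => //; move: us => /= /andP[_].
have := convergesZ (t l - t i)^-1 (convergesD c1 (convergesZ (-1) c2)).
congr converges; apply/funext => x; rewrite /kernels !big_cons.
have di := lt0r_neq0 (den_gt0 i x); have dl := lt0r_neq0 (den_gt0 l x).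
by field; rewrite dl di subr_eq0 eq_sym til.
Qed.

Definition base_kernel (x : R) : R := (x ^+ 2 + 4)^-1.
Local Notation u := base_kernel.

Let base_den (x : R) : 0 < x ^+ 2 + 4. Proof. by have := sqr_ge0 x; lra. Qed.

Lemma base_kernel01 x : 0 <= u x <= 1.
Proof.
rewrite invr_ge0 ltW //= invf_le1 //; have := sqr_ge0 x; lra.
Qed.

Lemma base_kernel_odd_le x : `|x * u x| <= 1.
Proof.
rewrite normrM [ `|u x| ]ger0_norm; last by case/andP: (base_kernel01 x).
rewrite ler_pdivrMr // mul1r -[x ^+ 2]real_normK ?num_real //.
have := sqr_ge0 (`|x| - 1); have := sqr_ge0 `|x|; lra.
Qed.

Lemma continuous_base_kernel : continuous u.
Proof. exact: (bounded_kernel_even (ltr0n _ 4)).1. Qed.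

Let kernel01 i x : 0 <= (x ^+ 2 + t i)^-1 <= 1.
Proof.
rewrite invr_ge0 ltW //= invf_le1 //; have := sqr_ge0 x; have := t_ge4 i; lra.
Qed.

Let kernel_odd_le i x : `|x * (x ^+ 2 + t i)^-1| <= 1.
Proof.
rewrite normrM [ `|_^-1| ]ger0_norm; last by case/andP: (kernel01 i x).
rewrite ler_pdivrMr // mul1r -[x ^+ 2]real_normK ?num_real //.
have := sqr_ge0 (`|x| - 1); have := sqr_ge0 `|x|; have := t_ge4 i; lra.
Qed.

Let kernels_approx (c : R) (s : seq nat) del x : 0 <= del ->
  (forall i, `|c * (x ^+ 2 + t i)^-1| <= 1) ->
  (forall i, i \in s -> t i - 4 <= del) ->
  s != [::] -> `|c * kernels s x - c * u x ^+ size s| <= (size s)%:R * del.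
Proof.
move=> del0.
have step b i s' : `|b * (x ^+ 2 + t i)^-1| <= 1 -> t i - 4 <= del ->
   `|kernels s' x - u x ^+ size s'| <= (size s')%:R * del ->
   `|b * kernels (i :: s') x - b * u x ^+ (size s').+1| <= (size s').+1%:R * del.
  move=> b1 ti IH; rewrite /kernels big_cons -/(kernels s' x).
  have -> : b * ((x ^+ 2 + t i)^-1 * kernels s' x) - b * u x ^+ (size s').+1 =
    (b * (x ^+ 2 + t i)^-1) * ((kernels s' x - u x ^+ size s') -
      (t i - 4) * u x ^+ (size s').+1).
    rewrite (exprS (u x)); set y := kernels _ _; set z := u x ^+ _.
    have -> : u x = (x ^+ 2 + 4)^-1 by [].
    by field; rewrite !gt_eqF.
  rewrite normrM; apply: le_trans (ler_wpM2r (normr_ge0 _) b1) _.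
  rewrite mul1r -[(size s').+1%:R]natr1 [in leRHS]mulrDl mul1r.
  apply: le_trans (ler_normB _ _) _.
  apply: lerD => //; rewrite normrM ger0_norm ?subr_ge0 //.
  apply: le_trans ti; rewrite ler_piMr ?subr_ge0 //.
  have /andP[u0 u1] := base_kernel01 x.
  by rewrite ger0_norm ?exprn_ge0 // exprn_ile1.
have plain s' : (forall i, i \in s' -> t i - 4 <= del) ->
    `|kernels s' x - u x ^+ size s'| <= (size s')%:R * del.
  elim: s' => [|i s' IH] hs; first by rewrite /kernels big_nil subrr normr0 mul0r.
  have := step 1 i s'; rewrite !mul1r; apply.
  - by case/andP: (kernel01 i x) => k0 k1; rewrite ger0_norm.
  - by apply: hs; rewrite inE eqxx.
  - by apply: IH => l ls; apply: hs; rewrite inE ls orbT.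
case: s => // i s c1 hs _; apply: step => //; first by apply: hs; rewrite inE eqxx.
by apply: plain => l ls; apply: hs; rewrite inE ls orbT.
Qed.

(** The power is the uniform limit of the products of [k + 1] consecutive kernels whose
    parameters approach 4. *)
Let power_converges (w : R -> R) k : continuous w ->
  (forall x i, `|w x * (x ^+ 2 + t i)^-1| <= 1) ->
  (forall x, `|w x * u x| <= 1) ->
  (forall i, converges (fun x => w x * (x ^+ 2 + t i)^-1)) ->
  converges (fun x => w x * u x ^+ k.+1).
Proof.
move=> cw w1 wu1 cvw; apply: converges_uniform.
  split.
    move=> x; apply: cvgM; first exact: cw.
    apply: (@continuous_comp _ _ _ u (fun y => y ^+ k.+1)).
      exact: continuous_base_kernel.
    exact: exprn_continuous.
  exists 1 => x; rewrite exprS mulrA normrM mulr_ile1 //.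
  have /andP[u0 u1] := base_kernel01 x.
  by rewrite ger0_norm ?exprn_ge0 // exprn_ile1.
move=> eps eps0; have del0 : 0 < eps / k.+1%:R by rewrite divr_gt0.
have [m hm] := t_cvg del0.
exists (fun x => w x * kernels (iota m k.+1) x).
  by apply: kernels_converge => //; exact: iota_uniq.
move=> x; rewrite distrC.
have := @kernels_approx (w x) (iota m k.+1) (eps / k.+1%:R) x (ltW del0) (w1 x).
rewrite size_iota [_ * (eps / _)]mulrC divfK ?pnatr_eq0 //; apply => //.
by move=> i; rewrite mem_iota => /andP[mi _]; exact: hm.
Qed.

Hypothesis mass : L n (fun=> 1) @[n --> \oo] --> L0 (fun=> 1).

Lemma even_poly_converges (Q : {poly R}) : converges (fun x => Q.[u x]).
Proof.
have cu k : converges (fun x => u x ^+ k).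
  case: k => [|k]; first by split => //; exact: bounded_continuous_cst.
  have := @power_converges (fun=> 1) k; set f := fun x => 1 * _.
  have -> : f = (fun x => u x ^+ k.+1) by apply/funext => x; rewrite /f mul1r.
  apply.
  - by move=> x; exact: cvg_cst.
  - by move=> x i; rewrite mul1r ger0_norm; case/andP: (kernel01 i x).
  - by move=> x; rewrite mul1r ger0_norm; case/andP: (base_kernel01 x).
  - move=> i; have := kernel_even i; congr converges.
    by apply/funext => x; rewrite mul1r.

have -> : (fun x => Q.[u x]) = (fun x => \sum_(i < size Q) Q`_i * u x ^+ i).
  by apply/funext => x; rewrite horner_coef.
elim: (size Q) => [|k IH].
  have := convergesZ 0 (cu 0%N); congr converges; apply/funext => x.
  by rewrite mul0r big_ord0.
have := convergesD IH (convergesZ Q`_k (cu k)); congr converges.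
by apply/funext => x; rewrite big_ord_recr.
Qed.

Lemma odd_poly_converges (Q : {poly R}) : converges (fun x => x * u x * Q.[u x]).
Proof.
have cu k : converges (fun x => x * u x ^+ k.+1).
  apply: power_converges => //; first by move=> x; exact: cvg_id.
  exact: base_kernel_odd_le.
have -> : (fun x => x * u x * Q.[u x]) =
    (fun x => \sum_(i < size Q) Q`_i * (x * u x ^+ i.+1)).
  apply/funext => x; rewrite horner_coef mulr_sumr; apply: eq_bigr => i _.
  by rewrite exprS; ring.
elim: (size Q) => [|k IH].
  have := convergesZ 0 (cu 0%N); congr converges; apply/funext => x.
  by rewrite mul0r big_ord0.
have := convergesD IH (convergesZ Q`_k (cu k)); congr converges.
by apply/funext => x; rewrite big_ord_recr.
Qed.

(** An even function [g] supported in [-3, 3] is a continuous function of [u], namely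
    [even_profile g]; truncating at [1 / 20 = u 4] keeps it continuous at 0. *)
Let even_profile (g : R -> R) (v : R) : R :=
  g (Num.sqrt ((Num.max v 20^-1)^-1 - 4)).

Let even_profileE g x : (forall y, g (- y) = g y) ->
  (forall y, 3 <= `|y| -> g y = 0) -> even_profile g (u x) = g x.
Proof.
move=> geven g0; have gabs y : g `|y| = g y.
  by case: (ger0P y) => // _; rewrite geven.
rewrite /even_profile; have [ux|ux] := leP (20^-1) (u x).
  by rewrite /base_kernel invrK addrK sqrtr_sqr gabs.
rewrite invrK.
have -> : (20 - 4 : R) = 4 ^+ 2 by ring.
rewrite sqrtr_sqr ger0_norm // g0 ?ger0_norm ?ler_nat //.
rewrite g0 //; move: ux; rewrite /base_kernel ltf_pV2 ?posrE // => h.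
rewrite leNgt; apply/negP => x3; have : `|x| ^+ 2 <= 3 ^+ 2.
  by rewrite ler_pXn2r ?nnegrE // ltW.
rewrite real_normK ?num_real //; lra.
Qed.

Let even_profile_cont g : continuous g -> continuous (even_profile g).
Proof.
move=> cg v.
rewrite -[even_profile g]/(g \o (Num.sqrt \o (fun v => (Num.max v 20^-1)^-1 - 4))).
apply: continuous_comp; last exact: cg.
apply: continuous_comp; last exact: sqrt_continuous.
apply: cvgB; last exact: cvg_cst.
apply: cvgV; first by rewrite gt_eqF // lt_max invr_gt0 ltr0n orbT.
by apply: (@continuous_max R R id (fun=> 20^-1) v); [exact: cvg_id|exact: cvg_cst].
Qed.

Lemma even_converges g : bounded_continuous g -> (forall y, g (- y) = g y) ->
  (forall y, 3 <= `|y| -> g y = 0) -> converges g.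
Proof.
move=> bg geven g0; apply: converges_uniform => // eps eps0.
case: (bg) => cg [M gM].
have [Q hQ] := weierstrass (even_profile_cont cg) (fun v => gM _) eps0.
exists (fun x => Q.[u x]); first exact: even_poly_converges.
by move=> x; rewrite -{1}(even_profileE x geven g0); apply: hQ; exact: base_kernel01.
Qed.

(** An odd function [g] is uniformly close to [g x^2 / (x^2 + del)], whose quotient
    [h] by [x u] is even and continuous. *)
Lemma odd_converges g : bounded_continuous g -> (forall y, g (- y) = - g y) ->
  (forall y, 3 <= `|y| -> g y = 0) -> converges g.
Proof.
move=> bg godd g0; apply: converges_uniform => // eps eps0.
case: (bg) => cg [M gM].
have e2 : 0 < eps / 2 by rewrite divr_gt0.
have g00 : g 0 = 0 by have := godd 0; rewrite oppr0; lra.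
have /cvgrPdist_le/(_ _ e2)/nbhs_ballP[r /= r0 hr] := cg 0.
have M1 : 0 < M + 1 by apply: ltr_wpDl => //; apply: le_trans (gM 0).
pose del := eps / 2 * r ^+ 2 / (M + 1).
have del0 : 0 < del by rewrite divr_gt0 // mulr_gt0 // exprn_gt0.
have xd x : 0 < x ^+ 2 + del by have := sqr_ge0 x; lra.
pose h x := g x * x / (x ^+ 2 + del) * (x ^+ 2 + 4).
have ch : continuous h.
  move=> x; apply: cvgM; last first.
    by apply: cvgD; [exact: exprn_continuous|exact: cvg_cst].
  apply: cvgM; first by apply: cvgM; [exact: cg|exact: cvg_id].
  apply: cvgV; first by rewrite gt_eqF.
  by apply: cvgD; [exact: exprn_continuous|exact: cvg_cst].
have heven y : h (- y) = h y by rewrite /h godd sqrrN; ring.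
have h0 y : 3 <= `|y| -> h y = 0 by move=> y3; rewrite /h g0 // !mul0r.
have hM v : `|even_profile h v| <= M * (3 / del * 13).
  have K0 : 0 <= M * (3 / del * 13).
    have := gM 0; have := normr_ge0 (g 0) => ? ?.
    by rewrite !mulr_ge0 ?invr_ge0 ?(ltW del0) //; lra.
  rewrite /even_profile; set y := Num.sqrt _.
  have [y3|y3] := leP 3 `|y|; first by rewrite h0 ?normr0.
  have y9 : y ^+ 2 <= 9.
    rewrite -[y ^+ 2]real_normK ?num_real //.
    have : `|y| ^+ 2 <= 3 ^+ 2 by rewrite ler_pXn2r ?nnegrE // ltW.
    lra.
  have inv_le : `|(y ^+ 2 + del)^-1| <= del^-1.
    rewrite ger0_norm ?invr_ge0 ?(ltW (xd y)) // lef_pV2 ?posrE //.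
    by rewrite lerDr sqr_ge0.
  have y13 : `|y ^+ 2 + 4| <= 13 by rewrite ger0_norm ?(ltW (base_den y)) //; lra.
  have -> : h y = g y * (y * (y ^+ 2 + del)^-1 * (y ^+ 2 + 4)) by rewrite /h !mulrA.
  by rewrite !normrM !ler_pM ?mulr_ge0 ?normr_ge0 // ltW.
have [Q hQ] := weierstrass (even_profile_cont ch) hM e2.
exists (fun x => x * u x * Q.[u x]); first exact: odd_poly_converges.
move=> x.
have -> : g x - x * u x * Q.[u x] =
    g x * (del / (x ^+ 2 + del)) + (x * u x) * (h x - Q.[u x]).
  rewrite /h mulrBr addrA; congr (_ - _).
  have -> : u x = (x ^+ 2 + 4)^-1 by [].
  by field; rewrite !gt_eqF.
apply: le_trans (ler_normD _ _) _.
have -> : eps = eps / 2 + eps / 2 by field.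
apply: lerD; last first.
  rewrite normrM; apply: le_trans (ler_wpM2r (normr_ge0 _) (base_kernel_odd_le x)) _.
  rewrite mul1r -(even_profileE x heven h0); apply: hQ; exact: base_kernel01.
have frac0 : 0 <= del / (x ^+ 2 + del) by rewrite divr_ge0 ?ltW.
rewrite normrM (ger0_norm frac0).
have [xr|xr] := ltP `|x| r.
  have gx : `|g x| <= eps / 2.
    have := hr x; rewrite /ball /= sub0r normrN g00 sub0r normrN; exact.
  apply: le_trans (ler_wpM2r frac0 gx) _; rewrite ler_piMr ?(ltW e2) //.
  by rewrite ler_pdivrMr // mul1r lerDr sqr_ge0.
have gM1 : `|g x| <= M + 1 by have := gM x; lra.
apply: le_trans (ler_wpM2r frac0 gM1) _.
rewrite mulrA ler_pdivrMr //.
have -> : (M + 1) * del = eps / 2 * r ^+ 2.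
  by rewrite /del; field; rewrite gt_eqF.
rewrite ler_wpM2l ?(ltW e2) //.
have : r ^+ 2 <= x ^+ 2.
  by rewrite -[x ^+ 2]real_normK ?num_real // ler_pXn2r ?nnegrE // ltW.
lra.
Qed.

Lemma compact_support_converges g : bounded_continuous g ->
  (forall y, 3 <= `|y| -> g y = 0) -> converges g.
Proof.
move=> bg g0; case: (bg) => cg [M gM].
have cgN : continuous (fun x => g (- x)).
  move=> x; apply: (@continuous_comp _ _ _ -%R g); first exact: opp_continuous.
  exact: cg.
have bgN : bounded_continuous (fun x => g (- x)) by split=> //; exists M.
have b2 := bounded_continuous_cst (2^-1).
have ce : converges (fun x => 2^-1 * (g x + g (- x))).
  apply: even_converges; first exact: bounded_continuousM b2 (bounded_continuousD bg bgN).
    by move=> y; rewrite opprK addrC.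
  by move=> y y3; rewrite !g0 ?normrN // addr0 mulr0.
have co : converges (fun x => 2^-1 * (g x - g (- x))).
  apply: odd_converges; first exact: bounded_continuousM b2 (bounded_continuousB bg bgN).
    by move=> y; rewrite opprK -mulrN opprB.
  by move=> y y3; rewrite !g0 ?normrN // subr0 mulr0.
have := convergesD ce co; congr converges; apply/funext => x.
by field.
Qed.

Definition cutoff (x : R) : R := Num.min 1 (Num.max 0 (3 - `|x|)).

Let cutoff01 x : 0 <= cutoff x <= 1.
Proof.
by rewrite /cutoff le_min ler01 le_max lexx /= ge_min lexx.
Qed.

Let cutoff_bc : bounded_continuous cutoff.
Proof.
split.
  move=> x; apply: (@continuous_min R R (fun=> 1) (fun x => Num.max 0 (3 - `|x|)) x).
    exact: cvg_cst.
  apply: (@continuous_max R R (fun=> 0) (fun x => 3 - `|x|) x); first exact: cvg_cst.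
  by apply: cvgB; [exact: cvg_cst|exact: norm_continuous].
by exists 1 => x; case/andP: (cutoff01 x) => c0 c1; rewrite ger0_norm.
Qed.

Hypothesis support2 : forall f, bounded_continuous f ->
  (forall x, `|x| <= 2 -> f x = 0) -> L0 f = 0.

(** The limit vanishes on functions that vanish on [-2, 2], so that the mean of a cutoff
    tends to the total mass, and the mass of [L n] outside [-3, 3] tends to 0. *)
Theorem means_converge f : bounded_continuous f -> L n f @[n --> \oo] --> L0 f.
Proof.
move=> bf; case: (bf) => cf [M fM].
have b1 := bounded_continuous_cst 1.
have bc := bounded_continuousB b1 cutoff_bc.
have bfc := bounded_continuousM bf cutoff_bc.
have cut0 y : 3 <= `|y| -> cutoff y = 0.
  by move=> y3; rewrite /cutoff max_l ?subr_le0 // min_r.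
have cut1 y : `|y| <= 2 -> cutoff y = 1.
  by move=> y2; rewrite /cutoff min_l // le_max; apply/orP; right; lra.
have [_ c1] : converges (fun x => f x * cutoff x).
  by apply: compact_support_converges => // y y3; rewrite cut0 // mulr0.
have [_ c2] : converges cutoff by exact: compact_support_converges.
have tail0 : L0 (fun x => 1 - cutoff x) = 0.
  by apply: support2 => // x x2; rewrite cut1 // subrr.
have tailf : L0 f = L0 (fun x => f x * cutoff x).
  apply/eqP; rewrite -subr_eq0 -(meanB mL0) //; apply/eqP; apply: support2.
    exact: bounded_continuousB.
  by move=> x x2; rewrite cut1 // mulr1 subrr.
rewrite tailf.
have tail_cvg : M * (L n (fun=> 1) - L n cutoff) @[n --> \oo] --> (0 : R).
  rewrite -[X in _ --> X](mulr0 M) -tail0 (meanB mL0) //.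
  by apply: cvgMr; exact: cvgB.
apply/cvgrPdist_le => eps eps0; have e2 : 0 < eps / 2 by rewrite divr_gt0.
near=> n.
have h1 : `|L0 (fun x => f x * cutoff x) - L n (fun x => f x * cutoff x)| <= eps / 2.
  by near: n; move/cvgrPdist_le: c1; apply.
have h2 : M * (L n (fun=> 1) - L n cutoff) <= eps / 2.
  apply: le_trans (ler_norm _) _; near: n.
  by move/cvgr0Pnorm_le: tail_cvg; apply.
have h3 : `|L n (fun x => f x - f x * cutoff x)| <= M * (L n (fun=> 1) - L n cutoff).
  rewrite -(meanB (mL n)) // -(meanZ (mL n)) //.
  apply: (mean_dominated (mL n)); first exact: bounded_continuousB.
    exact: bounded_continuousM (bounded_continuous_cst _) bc.
  move=> x; rewrite -[f x in X in X - _]mulr1 -mulrBr normrM.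
  case/andP: (cutoff01 x) => c0 c1'.
  by rewrite [ `|1 - _| ]ger0_norm ?subr_ge0 // ler_wpM2r // subr_ge0.
rewrite (meanB (mL n)) // in h3.
set a := L0 _ in h1 *; set b := L n (fun x => f x * cutoff x) in h1 h3.
have -> : a - L n f = (a - b) - (L n f - b) by ring.
apply: le_trans (ler_normB _ _) _; lra.
Unshelve. all: by end_near. Qed.

End Convergence.
End Means.

(** * Integrals against the semicircle density *)

Section SemicircleIntegrals.
Variable R : realType.
Local Notation mu := (@lebesgue_measure R).
Implicit Types g K : R -> R.

Lemma semicircle_pdf_out (x : R) : x \notin `[-2, 2] -> semicircle_pdf x = 0.
Proof.
rewrite in_itv /= => xout; rewrite /semicircle_pdf max_r ?sqrtr0 ?mul0r //.
rewrite subr_le0; have [x2|x2] := ltP x (-2); first by nra.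
by move: xout; rewrite x2 /= -ltNge => xout; nra.
Qed.

Lemma continuous_semicircle_pdf : continuous (@semicircle_pdf R).
Proof.
move=> x; apply: cvgM; last exact: cvg_cst.
apply: (@continuous_comp _ _ _ (fun y : R => Num.max (4 - y ^+ 2) 0) Num.sqrt); last first.
  exact: sqrt_continuous.
apply: (@continuous_max R R (fun y => 4 - y ^+ 2) (fun=> 0) x); last exact: cvg_cst.
by apply: cvgB; [exact: cvg_cst|exact: exprn_continuous].
Qed.

Lemma integral_pdf_itv g : measurable_fun setT g ->
  (\int[mu]_x (g x * semicircle_pdf x)%:E =
   \int[mu]_(x in `[(-2)%R, 2%R]) (g x * semicircle_pdf x)%:E)%E.
Proof.
move=> mg; rewrite [RHS]integral_mkcond /=; apply: eq_integral => x _.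
rewrite patchE; case: ifPn => // /negP xout.
rewrite semicircle_pdf_out ?mulr0 //; apply/negP => xin; apply: xout.
by rewrite inE.
Qed.

Lemma cos_ge0 (x : R) : - (pi / 2) <= x <= pi / 2 -> 0 <= cos x.
Proof.
move=> /andP[x1 x2]; move: x1; rewrite le_eqVlt => /orP[/eqP <-|x1].
  by rewrite cosN cos_pihalf.
move: x2; rewrite le_eqVlt => /orP[/eqP ->|x2]; first by rewrite cos_pihalf.
by apply/ltW/cos_gt0_pihalf; rewrite x1.
Qed.

(** The substitution [x = 2 sin a] turns an integral against the semicircle
    density into one of a smooth function. *)
Lemma semicircle_integral g K : continuous g ->
  (forall a : R, is_derive a 1 K (g (2 * sin a) * (4 * cos a ^+ 2))) ->
  (\int[mu]_x (g x * semicircle_pdf x)%:E =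
   ((K (pi / 2) - K (- (pi / 2))) / (2 * pi))%:E)%E.
Proof.
move=> cg dK.
have mg : measurable_fun setT g by exact: continuous_measurable_fun.
rewrite integral_pdf_itv //.
have pi0 := pi_gt0 R.
pose F (a : R) : R := 2 * sin a.
have dF (a : R) : is_derive a 1 F (2 * cos a).
  by rewrite /F; apply: is_derive_eq; rewrite /GRing.scale /=; ring.
have F'E : derive1 F = (fun a => 2 * cos a).
  by apply/funext => a; rewrite derive1E; apply: derive_val.
have cF : continuous F.
  by move=> a; apply: differentiable_continuous; apply/derivable1_diffP; apply: ex_derive.
have c2cos : continuous (fun a : R => 2 * cos a).
  by move=> a; apply: cvgM; [exact: cvg_cst|exact: continuous_cos].
have Fp : F (pi / 2) = 2 by rewrite /F sin_pihalf mulr1.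
have Fm : F (- (pi / 2)) = -2 by rewrite /F sinN sin_pihalf mulrN1.
have cG : continuous (fun x => g x * semicircle_pdf x).
  by move=> x; apply: cvgM; [exact: cg|exact: continuous_semicircle_pdf].
have := @integration_by_substitution_increasing R F
  (fun x => g x * semicircle_pdf x) (- (pi / 2)) (pi / 2).
rewrite Fm Fp => -> //; last 7 first.
- by lra.
- move=> x y; rewrite !in_itv /= => /andP[x1 x2] /andP[y1 y2] xy.
  by rewrite /F ltr_pM2l // ltr_sin // in_itv /= ?x1 ?y1.
- by move=> a _; rewrite F'E; exact: c2cos.
- rewrite F'E; apply/cvg_ex; exists (2 * cos (- (pi / 2))).
  by apply: cvg_at_right_filter; exact: c2cos.
- rewrite F'E; apply/cvg_ex; exists (2 * cos (pi / 2)).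
  by apply: cvg_at_left_filter; exact: c2cos.
- split.
  + by move=> a _; apply: ex_derive.
  + by apply: cvg_at_right_filter; exact: cF.
  + by apply: cvg_at_left_filter; exact: cF.
- by apply: continuous_subspaceT.
pose f (a : R) : R := g (2 * sin a) * (4 * cos a ^+ 2) * (2 * pi)^-1.
transitivity (\int[mu]_(a in `[(- (pi / 2))%R, (pi / 2)%R]) (f a)%:E)%E.
  apply: eq_integral => a; rewrite inE /= in_itv /= => a_in; congr EFin.
  rewrite !fctE F'E /f /F /semicircle_pdf.
  have -> : 4 - (2 * sin a) ^+ 2 = (2 * cos a) ^+ 2.
    by have := cos2Dsin2 a; rewrite !exprMn => h; lra.
  rewrite max_l ?sqr_ge0 // sqrtr_sqr ger0_norm; last first.
    by rewrite mulr_ge0 // cos_ge0.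
  by ring.
pose K1 (a : R) : R := K a * (2 * pi)^-1.
have dK1 (a : R) : is_derive a 1 K1 (f a).
  have := dK a => dKa; rewrite /K1 /f.
  by apply: is_derive_eq; rewrite /GRing.scale /=; ring.
have cK1 : continuous K1.
  by move=> a; apply: differentiable_continuous; apply/derivable1_diffP; apply: ex_derive.
rewrite (@continuous_FTC2 R f K1); first by rewrite /K1 -EFinB -mulrBl.
- by lra.
- apply: continuous_subspaceT => a; apply: cvgM; last exact: cvg_cst.
  apply: cvgM; first by apply: (@continuous_comp _ _ _ F g); [exact: cF|exact: cg].
  apply: cvgM; first exact: cvg_cst.
  apply: (@continuous_comp _ _ _ (@cos R) (fun y => y ^+ 2)).
    exact: continuous_cos.
  exact: exprn_continuous.
- split.
  + by move=> a _; apply: ex_derive.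
  + by apply: cvg_at_right_filter; exact: cK1.
  + by apply: cvg_at_left_filter; exact: cK1.
- by move=> a _; rewrite derive1E; apply: derive_val.
Qed.

(** Here [4 cos^2 a = 2 + 2 cos (2 a)] is to be integrated. *)
Lemma semicircle_mass : (\int[mu]_x (semicircle_pdf x)%:E = 1)%E.
Proof.
pose K (a : R) : R := 2 * a + 2 * (sin a * cos a).
have dK (a : R) : is_derive a 1 K ((fun=> 1) (2 * sin a) * (4 * cos a ^+ 2)).
  apply: is_derive_eq; rewrite /GRing.scale /=.
  transitivity (2 * (cos a ^+ 2 + sin a ^+ 2) +
      2 * (cos a ^+ 2 - sin a ^+ 2)); last by ring.
  by rewrite cos2Dsin2; ring.
have := semicircle_integral (@cst_continuous _ _ (1 : R)) dK.
under eq_integral do rewrite mul1r.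
move=> ->; have pi0 := pi_gt0 R.
rewrite /K cosN cos_pihalf !mulr0 !addr0; congr EFin.
rewrite mulrN opprK (_ : _ + _ = 2 * pi) ?divff ?mulf_neq0 ?gt_eqF //.
by field.
Qed.

(** The antiderivative is [c arctan (c tan a) - a], written in a form without
    poles at [- pi / 2] and [pi / 2]. *)
Lemma semicircle_kernel (e : R) : 0 < e ->
  (\int[mu]_x ((x ^+ 2 + e ^+ 2)^-1 * semicircle_pdf x)%:E =
   ((Num.sqrt (e ^+ 2 + 4) - e) / (2 * e))%:E)%E.
Proof.
move=> e0; set y := Num.sqrt _; pose c := y / e.
have y2 : y ^+ 2 = e ^+ 2 + 4 by rewrite sqr_sqrtr // addr_ge0 ?sqr_ge0.
have y0 : 0 < y by rewrite sqrtr_gt0 ltr_wpDl ?sqr_ge0.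
have c0 : 0 < c by rewrite divr_gt0.
have c2 : c ^+ 2 = (e ^+ 2 + 4) / e ^+ 2 by rewrite expr_div_n y2.
have e20 : 0 < e ^+ 2 by rewrite exprn_gt0.
pose D (a : R) : R := cos a ^+ 2 + c * sin a ^+ 2.
have cos2 (a : R) : cos a ^+ 2 = 1 - sin a ^+ 2.
  by rewrite -(cos2Dsin2 a) addrK.
have D0 a : 0 < D a.
  have := sqr_ge0 (sin a); rewrite /D le_eqVlt => /orP[/eqP s0|s0].
    by rewrite cos2 -s0 mulr0 addr0 subr0.
  by apply: ltr_wpDl; [exact: sqr_ge0|exact: mulr_gt0].
pose G (a : R) : R := (c - 1) * (sin a * cos a) * (D a)^-1.
pose K (a : R) : R := - a + c * (a + atan (G a)).
have [cg _] := bounded_kernel_even e20.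
have dK (a : R) : is_derive a 1 K
    ((fun x : R => (x ^+ 2 + e ^+ 2)^-1) (2 * sin a) * (4 * cos a ^+ 2)).
  have dD : is_derive a (1 : R) D (2 * (c - 1) * (sin a * cos a)).
    by apply: is_derive_eq; rewrite /GRing.scale /=; ring.
  have dDV := is_deriveV (lt0r_neq0 (D0 a)) dD.
  have dSC : is_derive a (1 : R) (fun a : R => (c - 1) * (sin a * cos a))
      ((c - 1) * (cos a ^+ 2 - sin a ^+ 2)).
    by apply: is_derive_eq; rewrite /GRing.scale /=; ring.
  pose P := sin a ^+ 2.
  have DP : D a = 1 + (c - 1) * P by rewrite /D cos2 -/P; ring.
  have scP : (sin a * cos a) ^+ 2 = P * (1 - P) by rewrite exprMn cos2.
  have DP0 : D a != 0 by exact: lt0r_neq0.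
  have dG : is_derive a (1 : R) G ((c - 1) * (1 - P - c * P) / D a ^+ 2).
    apply: is_derive_eq; rewrite /GRing.scale /=.
    transitivity ((c - 1) * ((cos a ^+ 2 - sin a ^+ 2) * D a -
        2 * (c - 1) * (sin a * cos a) ^+ 2) / D a ^+ 2); first by field.
    by rewrite scP cos2 -/P DP; congr (_ / _); ring.
  have datan := @is_derive1_comp R atan G a _ _ (is_derive1_atan (G a)) dG.
  have P01 : 0 <= P by exact: sqr_ge0.
  have Q0 : 0 < 1 + (c ^+ 2 - 1) * P.
    rewrite c2; have -> : 1 + ((e ^+ 2 + 4) / e ^+ 2 - 1) * P = 1 + 4 * P / e ^+ 2.
      by field; rewrite gt_eqF.
    by apply: ltr_pwDl => //; apply: divr_ge0; [exact: mulr_ge0|exact: ltW].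
  have GE : 1 + G a ^+ 2 = (1 + (c ^+ 2 - 1) * P) / D a ^+ 2.
    rewrite /G.
    transitivity ((D a ^+ 2 + (c - 1) ^+ 2 * (sin a * cos a) ^+ 2) / D a ^+ 2).
      by field.
    by rewrite scP; congr (_ / _); rewrite DP; ring.
  have -> : K = (fun a => - a + c * (a + (atan \o G) a)) by [].
  apply: is_derive_eq; rewrite /GRing.scale /=.
  rewrite GE [(2 * sin a) ^+ 2]exprMn cos2 -/P.
  transitivity (-1 + c ^+ 2 / (1 + (c ^+ 2 - 1) * P)).
    by field; rewrite DP0 gt_eqF.
  rewrite c2; have h : 0 < 4 * P + e ^+ 2 by apply: ltr_wpDl => //; exact: mulr_ge0.
  by field; rewrite !gt_eqF //= addrC.
rewrite (semicircle_integral cg dK).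
have pi0 := pi_gt0 R.
rewrite /K /G cosN cos_pihalf !mulr0 !mul0r atan0 !addr0; congr EFin.
rewrite /c; move: (pi : R) pi0 => z z0.
by field; rewrite !gt_eqF.
Qed.

(** The integrand is odd. *)
Lemma semicircle_kernel_odd (e : R) : 0 < e ->
  (\int[mu]_x (x * (x ^+ 2 + e ^+ 2)^-1 * semicircle_pdf x)%:E = 0)%E.
Proof.
move=> e0; pose g (x : R) : R := x * (x ^+ 2 + e ^+ 2)^-1.
have e20 : 0 < e ^+ 2 by rewrite exprn_gt0.
have [cg _] : bounded_continuous g := bounded_kernel_odd e20.
rewrite -/(g _) (integral_pdf_itv (g := g)); last exact: continuous_measurable_fun.
set G := fun x => g x * semicircle_pdf x.
have cG : continuous G.
  by move=> x; apply: cvgM; [exact: cg|exact: continuous_semicircle_pdf].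
have iG : mu.-integrable `[(-2)%R, 2%R] (EFin \o G).
  apply: continuous_compact_integrable; first exact: segment_compact.
  exact: continuous_subspaceT.
have fI := integrable_fin_num _ iG.
have : (\int[mu]_(x in `[(-2)%R, 2%R]) (G x)%:E = - \int[mu]_(x in `[(-2)%R, 2%R]) (G x)%:E)%E.
  rewrite -integralN; last first.
    exact: integrable_add_def.
  have := @integration_by_substitution_oppr R G (-2) 2.
  rewrite opprK => -> //; last 2 first.
  - by lra.
  - exact: continuous_subspaceT.
  apply: eq_integral => x _; transitivity ((- G x)%:E) => //; congr EFin.
  by rewrite fctE /G /g /semicircle_pdf sqrrN; ring.
suff zero (I : \bar R) : I \is a fin_num -> I = (- I)%E -> I = 0%E.
  by apply: zero; apply: fI; exact: measurable_itv.
by case: I => // r _ [h]; congr EFin; lra.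
Qed.

HB.instance Definition _ :=
  Measure_isProbability.Build _ _ _ (semicircle R) semicircle_mass.

(** The Lebesgue measure lives on a copy of the reals whose measurable structure
    has the same sets as that of the reals, but is another record. *)
Definition to_lebesgue (x : R) : measurableTypeR R := x.

Lemma measurable_to_lebesgue : measurable_fun setT to_lebesgue.
Proof. by move=> _ A mA; rewrite setTI. Qed.
HB.instance Definition _ :=
  isMeasurableFun.Build _ _ R (measurableTypeR R) to_lebesgue measurable_to_lebesgue.

Definition semicircle_prob : probability (measurableTypeR R) R :=
  distribution (semicircle R) to_lebesgue.

Lemma semicircle_dominated : semicircle_prob `<< mu.
Proof.
apply/null_content_dominatesP => A mA A0; rewrite /= /distribution /pushforward.
apply: null_set_integral => //; apply/measurable_EFinP; apply: measurable_funTS.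
exact: measurable_semicircle_pdf.
Qed.

(** A measure given by a density is integrated against by multiplying with that
    density: the density is the Radon-Nikodym derivative. *)
Lemma integral_semicircle (f : R -> R) : bounded_continuous f ->
  (\int[semicircle R]_x (f x)%:E = \int[mu]_x (f x * semicircle_pdf x)%:E)%E.
Proof.
move=> [cf [M fM]]; have mf := continuous_measurable_fun cf.
have mpdf : measurable_fun setT (EFin \o @semicircle_pdf R).
  by apply/measurable_EFinP; exact: measurable_semicircle_pdf.
have mEf : measurable_fun setT (EFin \o f) by apply/measurable_EFinP.
have bf : [bounded f x | x in [set: R]].
  by exists M; split; [exact: num_real|move=> x Mx y _; apply: (le_trans (fM y)); exact: ltW].
have fi : (semicircle R).-integrable setT (EFin \o f).
  apply: measurable_bounded_integrable => //.
  by rewrite (le_lt_trans (probability_le1 _ _)) // ltry.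
have fi' : semicircle_prob.-integrable setT (EFin \o f).
  apply: measurable_bounded_integrable => //.
  by rewrite (le_lt_trans (probability_le1 _ _)) // ltry.
transitivity (\int[semicircle_prob]_x (f x)%:E)%E.
  by symmetry; exact: (@integral_distribution _ _ _ _ R (semicircle R) to_lebesgue (EFin \o f)).
rewrite -(Radon_Nikodym_change_of_variables semicircle_dominated) //=.
apply: ae_eq_integral => //.
- by apply: emeasurable_funM => //; apply: (measurable_int mu);
    apply: Radon_Nikodym_integrable; exact: semicircle_dominated.
- apply/measurable_EFinP; apply: measurable_funM => //.
  exact: measurable_semicircle_pdf.
under [X in ae_eq _ _ _ X]eq_fun do rewrite EFinM.
apply: ae_eqe_mul2l => /=.
rewrite Radon_NikodymE //=; first exact: semicircle_dominated.
move=> dom; case: cid => /= h [h1 h2 h3].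
by apply: integral_ae_eq => //= E _ mE; rewrite -h3.
Qed.

End SemicircleIntegrals.

(** * Integrals against spectral measures *)

Section MeasureMeans.
Variables (R : realType) (nu : {measure set R -> \bar R}).
Hypothesis nu1 : (nu setT <= 1)%E.
Implicit Types f g : R -> R.

Lemma bounded_continuous_integrable f : bounded_continuous f ->
  nu.-integrable setT (EFin \o f).
Proof.
move=> [cf [M fM]]; apply: measurable_bounded_integrable => //.
- by rewrite (le_lt_trans nu1) // ltry.
- exact: continuous_measurable_fun.
- exists M; split; first exact: num_real.
  by move=> x Mx y _; apply: (le_trans (fM y)); exact: ltW.
Qed.

Definition integral_mean f : R := fine (\int[nu]_x (f x)%:E)%E.

Lemma integral_meanE f : bounded_continuous f ->
  (\int[nu]_x (f x)%:E = (integral_mean f)%:E)%E.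
Proof.
move=> bf; rewrite /integral_mean fineK //.
by apply: integrable_fin_num => //; exact: bounded_continuous_integrable.
Qed.

Lemma mean_integral : mean integral_mean.
Proof.
have EFin_inj' (a b : R) : a%:E = b%:E -> a = b by case.
split.
- move=> f g bf bg; apply: EFin_inj'.
  rewrite EFinD -!integral_meanE //; last exact: bounded_continuousD.
  under eq_integral do rewrite EFinD.
  by apply: integralD => //; exact: bounded_continuous_integrable.
- move=> a f bf; apply: EFin_inj'.
  rewrite EFinM -!integral_meanE //; last first.
    exact: bounded_continuousM (bounded_continuous_cst _) bf.
  under eq_integral do rewrite EFinM.
  by apply: integralZl => //; exact: bounded_continuous_integrable.
- move=> f g bf bg fg; rewrite -lee_fin -!integral_meanE //.
  apply: le_integral => //.
  + exact: bounded_continuous_integrable.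
  + exact: bounded_continuous_integrable.
  + by move=> x _; rewrite lee_fin.
- rewrite -lee_fin -integral_meanE; last exact: bounded_continuous_cst.
  by rewrite integral_cst //= mul1e.
Qed.

End MeasureMeans.

Section SpectralIntegral.
Variables (R : realType) (vT : vectType R) (B : 'End(vT)).
Local Notation N := (\dim {:vT}).
Hypothesis sizeB : size (eigenvalues B) = N.
Implicit Types f : R -> R.

Lemma ge0_integral_spectral_measure f : bounded_continuous f ->
  (forall x, 0 <= f x) ->
  (\int[spectral_measure B]_x (f x)%:E =
   (N%:R^-1 * \sum_(a <- eigenvalues B) f a)%:E)%E.
Proof.
move=> [cf _] f0.
have mf : measurable_fun setT (EFin \o f).
  by apply/measurable_EFinP; exact: continuous_measurable_fun.
have f0' (x : R) : setT x -> (0 <= (f x)%:E)%E by rewrite lee_fin.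
rewrite ge0_integral_mscale // ge0_integral_measure_sum //.
rewrite EFinM; congr (_ * _)%E.
rewrite (big_nth 0) sizeB big_mkord -sumEFin; apply: eq_bigr => i _.
by rewrite integral_dirac // diracT mul1e.
Qed.

Lemma spectral_measure_le1 : (spectral_measure B setT <= 1)%E.
Proof.
have := @ge0_integral_spectral_measure (fun=> 1) (bounded_continuous_cst _) (fun=> ler01).
rewrite integral_cst // mul1e => ->.
rewrite big_const_seq count_predT sizeB iter_addr_0 lee_fin.
by case: N => [|n]; rewrite ?mulr0 // mulVf // pnatr_eq0.
Qed.

(** Adding a constant reduces this to nonnegative functions. *)
Lemma spectral_mean f : bounded_continuous f ->
  integral_mean (spectral_measure B) f = N%:R^-1 * \sum_(a <- eigenvalues B) f a.
Proof.
move=> bf; case: (bf) => _ [M fM]; have m := mean_integral spectral_measure_le1.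
have bM := bounded_continuous_cst M.
have b := bounded_continuousD bf bM.
have ge0_mean g : bounded_continuous g -> (forall x, 0 <= g x) ->
    integral_mean (spectral_measure B) g = N%:R^-1 * \sum_(a <- eigenvalues B) g a.
  by move=> bg g0; rewrite /integral_mean ge0_integral_spectral_measure.
have M0 : 0 <= M := le_trans (normr_ge0 _) (fM 0).
have fM0 x : 0 <= f x + M.
  by have := fM x; rewrite ler_norml => /andP[+ _]; rewrite -subr_ge0 opprK.
have := meanD m bf bM; rewrite (ge0_mean _ b fM0) (ge0_mean _ bM (fun=> M0)).
by rewrite big_split /= mulrDr => /addIr ->.
Qed.

End SpectralIntegral.

Lemma inv_real_minus_imag (R : rcfType) (a e : R) : 0 < e ->
  ((a%:C)%C - (0 +i* e)%C)^-1 =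
  (a * (a ^+ 2 + e ^+ 2)^-1 +i* (e * (a ^+ 2 + e ^+ 2)^-1))%C.
Proof.
move=> e0; have h : a ^+ 2 + e ^+ 2 != 0.
  by rewrite gt_eqF // ltr_wpDl ?sqr_ge0 // exprn_gt0.
apply: (mulfI (x := (a%:C)%C - (0 +i* e)%C)).
  by apply/negP => /eqP[_ /eqP]; rewrite sub0r oppr_eq0 gt_eqF.
rewrite divff; last by apply/negP => /eqP[_ /eqP]; rewrite sub0r oppr_eq0 gt_eqF.
by apply/eqP; rewrite eq_complex /= subr0 sub0r; apply/andP; split; apply/eqP; field.
Qed.

Section Kernels.
Variables (R : realType) (e : R).
Hypothesis e0 : 0 < e.

Let e20 : 0 < e ^+ 2. Proof. by rewrite exprn_gt0. Qed.

Variables (vT : vectType R) (B : 'End(vT)).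
Hypothesis sizeB : size (eigenvalues B) = \dim {:vT}.

Lemma spectral_stieltjes :
  (\sum_(a <- eigenvalues B) ((a%:C)%C - (0 +i* e)%C)^-1) / (\dim {:vT})%:R =
  (integral_mean (spectral_measure B) (fun x => x * (x ^+ 2 + e ^+ 2)^-1) +i*
   (e * integral_mean (spectral_measure B) (fun x => (x ^+ 2 + e ^+ 2)^-1)))%C.
Proof.
rewrite !spectral_mean //; [|exact: bounded_kernel_even|exact: bounded_kernel_odd].
set N := \dim _.
have -> : \sum_(a <- eigenvalues B) ((a%:C)%C - (0 +i* e)%C)^-1 =
   ((\sum_(a <- eigenvalues B) a * (a ^+ 2 + e ^+ 2)^-1) +i*
   (e * \sum_(a <- eigenvalues B) (a ^+ 2 + e ^+ 2)^-1))%C.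
  elim: (eigenvalues B) => [|a s IH].
    by rewrite big_nil; apply/eqP; rewrite eq_complex /= !(@big_nil R) mulr0 eqxx.
  rewrite big_cons IH inv_real_minus_imag //.
  by apply/eqP; rewrite eq_complex /= !(@big_cons R) mulrDr !eqxx.
have -> : (N%:R : R[i])^-1 = ((N%:R^-1 : R)%:C)%C by rewrite fmorphV rmorph_nat.
apply/eqP; rewrite eq_complex /=; apply/andP; split; apply/eqP; ring.
Qed.

End Kernels.

(** * Convergence to the semicircle law *)

Section SemicircleLimit.
Variable R : realType.

(** The Stieltjes transform of the semicircle law at [i e] is [i] times this number,
    the root [y] of [y^2 + e y = 1] that is positive. *)
Definition stieltjes_limit (e : R) : R := (Num.sqrt (e ^+ 2 + 4) - e) / 2.

Lemma stieltjes_limit_eq (e : R) :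
  1 + (0 +i* e)%C * (0 +i* stieltjes_limit e)%C + (0 +i* stieltjes_limit e)%C ^+ 2 = 0.
Proof.
have : Num.sqrt (e ^+ 2 + 4) ^+ 2 = e ^+ 2 + 4 by rewrite sqr_sqrtr // addr_ge0 ?sqr_ge0.
rewrite /stieltjes_limit; set y := Num.sqrt _ => yE.
apply/eqP; rewrite expr2 eq_complex /=; apply/andP; split; apply/eqP; last by ring.
by transitivity (1 - (y ^+ 2 - e ^+ 2) / 4); [field|rewrite yE; field].
Qed.

Lemma stieltjes_limit_le (e : R) : 2 <= e -> cabs (0 +i* stieltjes_limit e)%C <= 1 / 2.
Proof.
move=> e2; rewrite /cabs /= expr0n add0r sqrtr_sqr.
have e0 : 0 <= e by lra.
have : Num.sqrt (e ^+ 2 + 4) <= e + 1.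
  rewrite -[leRHS]ger0_norm ?addr_ge0 // -sqrtr_sqr ler_wsqrtr //; nra.
have : e <= Num.sqrt (e ^+ 2 + 4).
  by rewrite -[leLHS]ger0_norm // -sqrtr_sqr ler_wsqrtr // lerDl.
rewrite /stieltjes_limit => h1 h2; rewrite ger0_norm; lra.
Qed.

Local Notation L0 := (integral_mean (semicircle R)).

Lemma semicircle_mean_support f : bounded_continuous f ->
  (forall x : R, `|x| <= 2 -> f x = 0) -> L0 f = 0.
Proof.
move=> bf f0; rewrite /integral_mean integral_semicircle //.
rewrite integral0_eq // => x _.
have [x2|x2] := leP `|x| 2; first by rewrite f0 // mul0r.
rewrite semicircle_pdf_out ?mulr0 // in_itv /= -ler_norml -ltNge //.
Qed.

Lemma semicircle_mean_even e : 0 < e ->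
  L0 (fun x => (x ^+ 2 + e ^+ 2)^-1) = stieltjes_limit e / e.
Proof.
move=> e0; rewrite /integral_mean integral_semicircle; last first.
  by apply: bounded_kernel_even; rewrite exprn_gt0.
by rewrite semicircle_kernel //= /stieltjes_limit; field; rewrite gt_eqF.
Qed.

Lemma semicircle_mean_odd e : 0 < e ->
  L0 (fun x => x * (x ^+ 2 + e ^+ 2)^-1) = 0.
Proof.
move=> e0; rewrite /integral_mean integral_semicircle; last first.
  by apply: bounded_kernel_odd; rewrite exprn_gt0.
by rewrite semicircle_kernel_odd.
Qed.

(** Distinct points that accumulate at 2, so that partial fractions apply and lead to
    powers of [1 / (x^2 + 4)]. *)
Definition height (i : nat) : R := 2 + i.+1%:R^-1.

Lemma height_ge2 i : 2 <= height i.
Proof. by rewrite lerDl invr_ge0. Qed.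

(** At [i e] the imaginary part of the Stieltjes transform is [e] times the mean of
    [1 / (x^2 + e^2)] and its real part is the mean of [x / (x^2 + e^2)], the two
    kernels from which [means_converge] recovers all test functions. *)
Theorem semicircle_limit (vT : nat -> vectType R) (B : forall n, 'End(vT n)) :
  (forall n, size (eigenvalues (B n)) = \dim {:vT n}) ->
  (\forall n \near \oo, (0 < \dim {:vT n})%N) ->
  (forall i, cabs ((\sum_(a <- eigenvalues (B n))
       ((a%:C)%C - (0 +i* height i)%C)^-1) / (\dim {:vT n})%:R -
       (0 +i* stieltjes_limit (height i))%C) @[n --> \oo] --> (0 : R)) ->
  weak_cvg (fun n => spectral_measure (B n)) (semicircle R).
Proof.
move=> sizeB dimB cvgB f cf bf.
have bcf : bounded_continuous f.
  by split=> //; case: bf => M [_ hM]; exists (M + 1) => x; apply: hM; rewrite ?ltrDl.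
have semi1 : (semicircle R setT <= 1)%E := probability_le1 _ measurableT.
have spec1 n := spectral_measure_le1 (sizeB n).
pose L n := integral_mean (spectral_measure (B n)).
rewrite (integral_meanE semi1) //.
under eq_fun do rewrite (integral_meanE (spec1 _)) //.
apply: cvg_EFin; first exact: nearW.
have h0 i : 0 < height i by apply: lt_le_trans (height_ge2 i).
apply: (@means_converge R L L0 _ _ (fun i => height i ^+ 2)) => //.
- by move=> n; exact: mean_integral.
- exact: mean_integral.
- by move=> i; have := height_ge2 i; nra.
- move=> i k /eqP; rewrite eqrXn2 ?(ltW (h0 _)) // => /eqP /addrI /invr_inj /eqP.
  by rewrite eqr_nat eqSS => /eqP.
- move=> del del0.
  exists (Num.truncn (5 / del)) => i im.
  have : 5 / del < i.+1%:R.
    apply: lt_le_trans (truncnS_gt _) _; by rewrite ler_nat ltnS.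
  rewrite ltr_pdivrMr // => h.
  have v1 : i.+1%:R^-1 <= 1 :> R by rewrite invf_le1 ?ler1n // ltr0n.
  have v0 : 0 < i.+1%:R^-1 :> R by rewrite invr_gt0.
  have : 5 * i.+1%:R^-1 < del by rewrite -ltr_pdivlMr ?invr_gt0 // invrK mulrC.
  by rewrite /height; move: (i.+1%:R^-1 : R) v0 v1 => v; nra.
- move=> i; split; first by apply: bounded_kernel_even; rewrite exprn_gt0.
  rewrite (semicircle_mean_even (h0 i)).
  apply/cvgrPdist_le => eps eps0.
  have := cvgB i => /cvgr0Pnorm_le /(_ (eps * height i)); rewrite mulr_gt0 // => /(_ isT).
  apply: filterS => n; rewrite (spectral_stieltjes (h0 i) (sizeB n)).
  set z := (X in cabs X) => /(le_trans (ler_norm _)) zle.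
  have := le_trans (abs_Im_le z) zle; rewrite /z /= -/(L n) => h.
  rewrite distrC -(ler_pM2r (h0 i)) -[X in _ * X <= _]ger0_norm ?(ltW (h0 i)) // -normrM.
  by rewrite mulrBl divfK ?gt_eqF // mulrC.
- move=> i; split; first by apply: bounded_kernel_odd; rewrite exprn_gt0.
  rewrite (semicircle_mean_odd (h0 i)).
  apply/cvgr0Pnorm_le => eps eps0.
  have := cvgB i => /cvgr0Pnorm_le /(_ eps eps0).
  apply: filterS => n; rewrite (spectral_stieltjes (h0 i) (sizeB n)).
  set z := (X in cabs X) => /(le_trans (ler_norm _)) zle.
  by have := le_trans (abs_Re_le z) zle; rewrite /z /= subr0.
- have -> : L0 (fun=> 1) = 1.
    by rewrite /integral_mean integral_cst //= mul1e probability_setT.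
  apply: cvg_near_cst; apply: filterS dimB => n dn.
  rewrite /L spectral_mean //; last exact: bounded_continuous_cst.
  by rewrite big_const_seq count_predT sizeB iter_addr_0 mulVf // pnatr_eq0 -lt0n.
- exact: semicircle_mean_support.
Qed.

End SemicircleLimit.

Theorem theorem2p5 (R : realType) (disp : measure_display)
    (T : measurableType disp) (P : probability T R)
    (d : nat) (p : nat -> R) (U : {fset nat} -> {RV P >-> R})
    (d_ge2 : (2 <= d)%N)
    (p01 : forall n : nat, 0 <= p n <= 1)
    (U_indep : mutually_independent [set tau : {fset nat} | #|` tau| = d.+1] U)
    (U_unif : forall tau : {fset nat}, #|` tau| = d.+1 ->
       forall B : set R, measurable B ->
         distribution P (U tau) B = uniform_prob (@ltr01 R) B) :
  let q n := p n * (1 - p n) in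
  let X w n := LM_complex d (fun tau => U tau w <= p n) n in
  n%:R * q n @[n --> \oo] --> +oo ->
  {ae P, forall w,
    weak_cvg
      (fun n => spectral_measure
         ((Num.sqrt (d%:R * n%:R * q n))^-1 *: adjacency R (X w n) d.-1))
      (semicircle R)}.
Proof.
case: d d_ge2 U_indep U_unif => [//|j] j0 U_indep U_unif q X nq_oo /=.
have ae_heights : {ae P, forall w, forall i, cabs
    (\tr (resolvent (edge_scale j p n *: adjacency_mx R (X w n) j) (height R i))
       / #|{: subset_of_card 'I_n j.+1}|%:R -
     (0 +i* stieltjes_limit (height R i))%C) @[n --> \oo] --> (0 : R)}.
  apply: ae_foralln => i; apply: (ae_stieltjes j0 p01 U_indep U_unif nq_oo).
  - exact: height_ge2.
  - exact: stieltjes_limit_eq.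
  - exact/stieltjes_limit_le/height_ge2.
apply: filterS ae_heights => w cvg_w.
have skeleton n (s : {set 'I_n}) : #|s| = j.+1 -> s \in X w n.
  by move=> sE; rewrite inE sE leqnn.
pose sym n := adjacency_mx_sym R j0 (X w n).
have spec n : [/\ \dim {:subvs_of (Omega R (X w n) j)} = 'C(n, j.+1),
    size (eigenvalues (edge_scale j p n *: adjacency R (X w n) j)) = 'C(n, j.+1) &
    forall e, 0 < e ->
      \tr (resolvent (edge_scale j p n *: adjacency_mx R (X w n) j) e) =
      \sum_(a <- eigenvalues (edge_scale j p n *: adjacency R (X w n) j))
         ((a%:C)%C - (0 +i* e)%C)^-1].
  have [dimE charE] := char_poly_adjacency j0 (@skeleton n) (edge_scale j p n).
  have symA : (edge_scale j p n *: adjacency_mx R (X w n) j)^T =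
      edge_scale j p n *: adjacency_mx R (X w n) j by rewrite linearZ /= sym.
  have [sizeE trE] := eigenvalues_resolvent symA dimE charE.
  by split=> //; rewrite -(cards_cells j n).
apply: (semicircle_limit
  (B := fun n => edge_scale j p n *: adjacency R (X w n) j)).
- by move=> n; have [-> ->] := spec n.
- by near=> n; have [-> _ _] := spec n; rewrite bin_gt0; near: n; exact: nbhs_infty_ge.
- move=> i; apply: cvg_trans (cvg_w i); apply: near_eq_cvg; apply: nearW => n.
  have [dimE _ trE] := spec n; rewrite trE ?dimE ?cards_cells //.
  exact: lt_le_trans (height_ge2 _ _).
Unshelve. all: by end_near. Qed.
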